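(* Let $G$ be an amenable discrete group and let $\mathcal{B}$ be the Fell bundle of a $C^*$-dynamical system $(A,G,\gamma)$ with $A$ unital. Then $A(\mathcal{B})$ has a bounded approximate identity.
   Context: The Fell bundle of a $C^*$-dynamical system $(A,G,\gamma)$ ($G$ discrete with unit $e$) is $\mathcal{B}=\{B_s\}_{s\in G}$, $B_s=\{s\}\times A$, with $(s,a)(t,b)=(st,a\gamma_s(b))$, $(s,a)^*=(s^{-1},\gamma_{s^{-1}}(a^* ))$, $\|(s,a)\|=\|a\|$. Sections are maps $f$ on $G$ with $f_s\in B_s$; $c_c(\mathcal{B})$ is the space of finitely supported sections, with convolution $(y\star z)_s=\sum_ty_tz_{t^{-1}s}$; $\ell^1(\mathcal{B})$ is the space of sections with $\sum_s\|f_s\|<\infty$. For $b\in B_s$, $j_s(b)$ is the section equal to $b$ at $s$ and $0$ elsewhere. A representation $\pi$ of $\mathcal{B}$ on a Hilbert space $H_\pi$ is a family of norm-continuous linear maps $\pi_s:B_s\to\mathcal{L}(H_\pi)$ with $\pi_s(b)\pi_t(c)=\pi_{st}(bc)$ and $\pi_s(b)^*=\pi_{s^{-1}}(b^* )$. For $f\in\ell^1(\mathcal{B})$, $\|f\|_*$ is the supremum over all representations $\pi$ of $\|\sum_s\pi_s(f_s)\|$. $\ell^2(\mathcal{B})$ is the right Hilbert $B_e$-module completing $c_c(\mathcal{B})$ for $\langle y,z\rangle=\sum_sy_s^*z_s\in B_e$. For $b\in B_s$, $\lambda_s(b)$ is the bounded operator on $\ell^2(\mathcal{B})$ extending $y\mapsto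 j_s(b)\star y$. For $\xi,\eta\in\ell^2(\mathcal{B})$, $\lambda_{\xi,\eta}$ is the family of maps $(\lambda_{\xi,\eta})_s:B_s\to B_e$, $b\mapsto\langle\lambda_s(b)\xi,\eta\rangle$. The Fourier space is $A(\mathcal{B})=\{\lambda_{\xi,\eta}:\xi,\eta\in\ell^2(\mathcal{B})\}$ with norm $\|\lambda_{\xi,\eta}\|=\sup\{\|\sum_r\langle\lambda_r(f_r)\xi,\eta\rangle\|:f\in\ell^1(\mathcal{B}),\|f\|_*\le1\}$. The multiplication on $A(\mathcal{B})$ is the one induced by the co-multiplication family $\Delta_{s,t}:B_{st}\to B_s\otimes_{\min}B_t$, $\Delta_{s,t}(st,a)=(s,1)\otimes(t,a)$, that is, $$(\lambda_{\xi_1,\xi_2}\lambda_{\xi_3,\xi_4})_s(s,a)=\langle\lambda_s(s,1)\xi_1\otimes\lambda_s(s,a)\xi_3,\ \xi_2\otimes\xi_4\rangle,$$ where $\langle\zeta_1\otimes\zeta_2,\zeta_3\otimes\zeta_4\rangle=\langle\zeta_2,\lambda_e(\langle\zeta_1,\zeta_3\rangle)\zeta_4\rangle\in B_e$ on $\ell^2(\mathcal{B})\otimes\ell^2(\mathcal{B})$.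
   Formalization: ''Bounded approximate identity'' is proved as a bounded left one (e_i u → u); a two-sided one fails with the given product, e.g. for G trivial and A the 2×2 matrices, where u = λ_{E11,E22} is nonzero but u w = 0 for all w. *)

(* Defs.v *)
From HB Require Import structures.
From mathcomp Require Import all_boot all_order all_algebra.
From mathcomp Require Import all_classical all_reals all_analysis.
From mathcomp Require Import complex.
From mathcomp.analysis.showcase Require summability.

Set Implicit Arguments.
Unset Strict Implicit.
Unset Printing Implicit Defensive.
Import Order.TTheory GRing.Theory Num.Theory.
Import numFieldNormedType.Exports.

Local Open Scope classical_set_scope.
Local Open Scope ring_scope.
Local Open Scope complex_scope.

(* The norm of a normed space over R[i] takes its values in R[i]; [rnorm] is
   the same number seen in R. *)
Definition rnorm (R : realType) (V : normedModType R[i]) (x : V) : R :=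
  complex.Re `|x|.

(* Unital C*-algebras, the zero algebra included.  The product is part of the
   mixin because a normed module cannot be joined with the ring structures:
   both are superclasses of [numDomainType]. *)
Reserved Notation "a ** b" (at level 40, left associativity).

HB.mixin Record isCStarAlgebra (R : realType) A
    of CompleteNormedModule R[i] A := {
  cmul : A -> A -> A;
  cone : A;
  star : A -> A;
  cmulA : associative cmul;
  cmul1a : left_id cone cmul;
  cmula1 : right_id cone cmul;
  cmulDl : left_distributive cmul +%R;
  cmulDr : right_distributive cmul +%R;
  cmulZl : forall (k : R[i]) (a b : A), cmul (k *: a) b = k *: cmul a b;
  cmulZr : forall (k : R[i]) (a b : A), cmul a (k *: b) = k *: cmul a b;
  starD : forall a b : A, star (a + b) = star a + star b;
  starZ : forall (k : R[i]) (a : A), star (k *: a) = k^* *: star a;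
  starM : forall a b : A, star (cmul a b) = cmul (star b) (star a);
  starK : involutive star;
  cnormM : forall a b : A, `|cmul a b| <= `|a| * `|b|;
  cnorm_star : forall a : A, `|cmul (star a) a| = `|a| ^+ 2
}.

#[short(type="cstarAlgType")]
HB.structure Definition CStarAlgebra (R : realType) :=
  {A of CompleteNormedModule R[i] A & isCStarAlgebra R A}.

Notation "a ** b" := (cmul a b) : ring_scope.

Definition cstar_pos (R : realType) (A : cstarAlgType R) (a : A) : Prop :=
  exists c : A, a = star c ** c.

(* Hilbert spaces; all inner products are linear in the second variable. *)
HB.mixin Record isHilbert (R : realType) H of CompleteNormedModule R[i] H := {
  dot : H -> H -> R[i];
  dotDr : forall x y z : H, dot x (y + z) = dot x y + dot x z;
  dotZr : forall (k : R[i]) (x y : H), dot x (k *: y) = k * dot x y;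
  dot_conj : forall x y : H, dot y x = (dot x y)^*;
  dot_norm : forall x : H, dot x x = `|x| ^+ 2
}.

#[short(type="hilbertType")]
HB.structure Definition Hilbert (R : realType) :=
  {H of CompleteNormedModule R[i] H & isHilbert R H}.

(* Right Hilbert A-modules. *)
HB.mixin Record isHilbertModule (R : realType) (A : cstarAlgType R) E
    of CompleteNormedModule R[i] E := {
  ract : E -> A -> E;
  inner : E -> E -> A;
  ractDl : forall (x y : E) (a : A), ract (x + y) a = ract x a + ract y a;
  ractDr : forall (x : E) (a b : A), ract x (a + b) = ract x a + ract x b;
  ractM : forall (x : E) (a b : A), ract x (a ** b) = ract (ract x a) b;
  ract1 : forall x : E, ract x cone = x;
  ractZ : forall (k : R[i]) (x : E) (a : A), ract x (k *: a) = k *: ract x a;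
  innerDr : forall x y z : E, inner x (y + z) = inner x y + inner x z;
  innerZr : forall (k : R[i]) (x y : E), inner x (k *: y) = k *: inner x y;
  innerMr : forall (x y : E) (a : A), inner x (ract y a) = inner x y ** a;
  inner_star : forall x y : E, inner y x = star (inner x y);
  inner_pos : forall x : E, cstar_pos (inner x x);
  inner_norm : forall x : E, `|inner x x| = `|x| ^+ 2
}.

#[short(type="hilbertModType")]
HB.structure Definition HilbertModule (R : realType) (A : cstarAlgType R) :=
  {E of CompleteNormedModule R[i] E & isHilbertModule R A E}.

Definition bounded_op (R : realType) (V W : normedModType R[i])
    (T : V -> W) : Prop :=
  linear T /\ continuous T.

Definition opnorm (R : realType) (V W : normedModType R[i])
    (T : V -> W) : \bar R :=
  ereal_sup [set (rnorm (T x))%:E | x in [set x : V | rnorm x <= 1]].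

(* The unordered sum of a family indexed by a discrete set: the limit of the
   net of the sums over finite subsets. *)
Definition usum (R : realType) (V : normedModType R[i]) (I : choiceType)
    (x : I -> V) : V :=
  summability.sum x.

Definition invariant_mean (R : realType) (G : groupType)
    (m : (G -> R) -> R) : Prop :=
  [/\ forall (k : R) (f g : G -> R), [bounded f t | t in [set: G]] ->
        [bounded g t | t in [set: G]] ->
        m (fun t => k * f t + g t) = k * m f + m g,
      forall f : G -> R, [bounded f t | t in [set: G]] ->
        (forall t, 0 <= f t) -> 0 <= m f,
      m (fun=> 1) = 1 &
      forall (s : G) (f : G -> R), [bounded f t | t in [set: G]] ->
        m (fun t => f (s^-1 * t)%g) = m f].

Definition amenable (R : realType) (G : groupType) : Prop :=
  exists m : (G -> R) -> R, invariant_mean m.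

Record dynsys (R : realType) (G : groupType) (A : cstarAlgType R) := DynSys {
  gam :> G -> A -> A;
  gam_linear : forall s, linear (gam s);
  gamM : forall s (a b : A), gam s (a ** b) = gam s a ** gam s b;
  gam_star : forall s (a : A), gam s (star a) = star (gam s a);
  gam1 : forall a : A, gam 1%g a = a;
  gam_comp : forall (s t : G) (a : A), gam (s * t)%g a = gam s (gam t a)
}.

(* The fibre B_s = {s} x A: the element (s, a) is represented by [a], the
   index [s] being carried by the type.  In particular B_e is A, with the
   C*-algebra structure of A because gam 1 is the identity. *)
Definition fibre (R : realType) (G : groupType) (A : cstarAlgType R)
  (gamma : dynsys G A) (s : G) : Type := A.

Definition directed (I : Type) (le : I -> I -> Prop) : Prop :=
  [/\ inhabited I, forall i, le i i,
      forall i j k, le i j -> le j k -> le i k &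
      forall i j, exists k, le i k /\ le j k].

Section FellBundle.
Context (R : realType) (G : groupType) (A : cstarAlgType R).
Context (gamma : dynsys G A).

Local Notation B := (fibre gamma).

Definition fmul (s t : G) (a : B s) (b : B t) : B (s * t)%g :=
  (a : A) ** gamma s b.

Definition fstar (s : G) (a : B s) : B s^-1%g := gamma s^-1%g (star (a : A)).

Definition bsection : Type := forall s : G, B s.

Definition in_cc (y : bsection) : Prop := finite_set [set s | (y s : A) != 0].

Definition dsec (s : G) (b : B s) : bsection :=
  fun t => if t == s then (b : A) else 0.

(* \sum_(t \in setT) is the sum over the finite support of the summand. *)
Definition convol (y z : bsection) : bsection :=
  fun s => \sum_(t \in [set: G])
    (fmul (y t) (z (t^-1 * s)%g) : A).

Definition cc_inner (y z : bsection) : A :=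
  \sum_(s \in [set: G]) (fmul (fstar (y s)) (z s) : A).

Definition cc_ract (y : bsection) (a : B 1%g) : bsection :=
  fun s => (fmul (y s) a : A).

Definition in_ell1 (f : bsection) : Prop :=
  (\esum_(s in [set: G]) (rnorm (f s : A))%:E < +oo)%E.

Record fell_rep (H : hilbertType R) := FellRep {
  rep :> forall s : G, B s -> H -> H;
  rep_op : forall s (b : B s), bounded_op (rep b);
  rep_linear : forall s (k : R[i]) (b c : A) (x : H),
    rep ((k *: b + c) : B s) x = k *: rep (b : B s) x + rep (c : B s) x;
  rep_cont : forall s (b : A),
    opnorm (fun x => rep (c : B s) x - rep (b : B s) x) @[c --> b] --> 0%E;
  repM : forall s t (b : B s) (c : B t) x, rep (fmul b c) x = rep b (rep c x);
  rep_star : forall s (b : B s) x y, dot (rep b x) y = dot x (rep (fstar b) y)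
}.

(* For f in ell^1 the series of the pi_s(f_s) converges absolutely in L(H), so
   its sum can be computed pointwise. *)
Definition rep_sum (H : hilbertType R) (pi : fell_rep H) (f : bsection)
    (x : H) : H :=
  usum (fun s => pi s (f s) x).

Definition star_norm (f : bsection) : \bar R :=
  ereal_sup [set r | exists (H : hilbertType R) (pi : fell_rep H),
                       r = opnorm (rep_sum pi f)].

(* (E, iota) is the completion of c_c(B), as a right Hilbert B_e-module; the
   values of iota outside c_c(B) are irrelevant. *)
Record is_ell2 (E : hilbertModType A) (iota : bsection -> E) : Prop := IsEll2 {
  iota_linear : forall (k : R[i]) y z, in_cc y -> in_cc z ->
    iota (fun s => k *: (y s : A) + (z s : A)) = k *: iota y + iota z;
  iota_ract : forall y (a : A), in_cc y -> iota (cc_ract y a) = ract (iota y) a;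
  iota_inner : forall y z, in_cc y -> in_cc z ->
    inner (iota y) (iota z) = cc_inner y z;
  iota_dense : closure [set iota y | y in in_cc] = [set: E]
}.

(* Families of maps B_s -> B_e. *)
Definition mapfam : Type := forall s : G, B s -> A.

Definition family_sub (u v : mapfam) : mapfam := fun s b => u s b - v s b.

Section Fourier.
Context (E : hilbertModType A) (iota : bsection -> E).

Definition lambda (s : G) (b : B s) : E -> E :=
  xget (fun=> 0) [set L : E -> E | bounded_op L /\
    forall y, in_cc y -> L (iota y) = iota (convol (dsec b) y)].

Definition coef (xi eta : E) : mapfam :=
  fun s b => inner (@lambda s b xi) eta.

Definition fourier_space : set mapfam :=
  [set u | exists xi eta, u = coef xi eta].

(* It only depends on the family u, not on the vectors that represent it, and
   is used below for differences of elements of A(B) too. *)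
Definition fourier_norm (u : mapfam) : \bar R :=
  ereal_sup [set (rnorm (usum (fun r => u r (f r))))%:E
            | f in [set f : bsection | in_ell1 f /\ (star_norm f <= 1)%E]].

Definition tens_inner (z1 z2 z3 z4 : E) : A :=
  inner z2 (@lambda 1%g (inner z1 z3) z4).

Definition coef_mul (xi1 xi2 xi3 xi4 : E) : mapfam :=
  fun s a =>
    tens_inner (@lambda s (cone : A) xi1) (@lambda s a xi3) xi2 xi4.

Definition fourier_mul (u v : mapfam) : mapfam :=
  xget (fun=> fun=> 0) [set w | exists xi1 xi2 xi3 xi4,
    [/\ u = coef xi1 xi2, v = coef xi3 xi4 & w = coef_mul xi1 xi2 xi3 xi4]].

(* The approximate identity is a left one, e_i u --> u, which is the side that
   the product above allows.  If G is trivial and A is the algebra of 2 x 2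
   matrices, then E is A, u = coef E11 E22 (for matrix units E11 and E22) is
   a |-> E11 a^* E22, which is not zero, and (u w) a = w ((u 1)^* a) = w 0 = 0
   for all w, so that there is no right approximate identity. *)
Definition has_left_bounded_approximate_identity : Prop :=
  exists (I : Type) (le : I -> I -> Prop) (e : I -> mapfam),
  [/\ directed le,
      forall i, fourier_space (e i),
      exists M : R, forall i, (fourier_norm (e i) <= M%:E)%E &
      forall u, fourier_space u -> forall eps : R, 0 < eps ->
        exists i0, forall i, le i0 i ->
          (fourier_norm (family_sub (fourier_mul (e i) u) u) <= eps%:E)%E].

End Fourier.
End FellBundle.

(* Main.v *)
(* By Reiter's argument, amenability yields finitely supported unit vectors
   xi_i of l^2(G) whose autocorrelations phi_i(s) = <lambda_s xi_i, xi_i> tend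
   to 1 pointwise. The coefficients e_i of the sections t |-> xi_i(t) 1 satisfy
   (e_i u)_s = phi_i(s) u_s for every coefficient u, so that e_i u --> u as soon
   as multiplication by phi_i is bounded on coefficients uniformly in i: one
   approximates the two vectors of u by finitely supported sections, for which
   only finitely many s matter.

   The bounds come from composing the coefficients with the positive
   functionals psi of A, which determine the norm of A up to a factor 2
   (Hahn-Banach). The form psi <x, y> is a scalar pre-inner product on l^2(B)
   for which lambda is a *-representation, hence its coefficients are controlled
   by the norm | |_*. Multiplying them by phi_i gives coefficients of the
   representation amplified to l^2(G) (x) l^2(B) at the vectors xi_i (x) x, with
   the same bound (Fell's absorption principle). *)

Require Import Defs.
From HB Require Import structures.
From mathcomp Require Import all_boot all_order all_algebra.
From mathcomp Require Import all_classical all_reals all_analysis.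
From mathcomp Require Import complex ring lra finmap.

Set Implicit Arguments.
Unset Strict Implicit.
Unset Printing Implicit Defensive.
Import Order.TTheory GRing.Theory Num.Theory.
Import numFieldNormedType.Exports.

Local Open Scope classical_set_scope.
Local Open Scope ring_scope.
Local Open Scope complex_scope.

(** * Real-valued norms *)

(** The norm [star_norm] only sees representations on Hilbert spaces, whereas [lambda] acts on a
    Hilbert module with inner product in [A]; scalar forms and their completions bridge this gap.
    The functionals must be positive for the composed form to be semidefinite, and numerous enough
    to recover the norm of [A]. From the bare C*-axioms, this requires the order of [A], which is
    built without spectra: an explicit square root turns positivity of a self-adjoint [x] into the
    norm condition that [t - x] has norm at most [t], and the hard point is that [star c ** c] is
    the square of a self-adjoint element. Bounds on representations are never assumed: they follow
    from writing |b|^2 - b^* b as c^* c. The recurring constant 8 is 2 * 2 * 2, one factor for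
    recovering a norm from functionals and one for each of the two vectors of a coefficient. Only
    its independence of the index matters. Convergence must be uniform over all [f] with |f|_* at
    most 1, which gives no uniform control of the l^1 norm of [f]; pointwise convergence of phi_i is
    therefore used on a finite set of [s] only, where the values of [f] are bounded. *)

Section NormedSpaces.
Context (R : realType).
Implicit Types V W : normedModType R[i].

Lemma norm_rnorm V (x : V) : `|x| = (rnorm x)%:C.
Proof. by rewrite /rnorm (complex.RRe_real (ger0_real (normr_ge0 _))). Qed.

Lemma rnorm_ge0 V (x : V) : 0 <= rnorm x.
Proof. by rewrite -complex.ler0c -norm_rnorm. Qed.

Lemma ler_rnormD V (x y : V) : rnorm (x + y) <= rnorm x + rnorm y.
Proof.
have := ler_normD x y.
by rewrite !norm_rnorm -(rmorphD (real_complex R)) complex.lecR.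
Qed.

Lemma rnormN V (x : V) : rnorm (- x) = rnorm x.
Proof. by rewrite /rnorm normrN. Qed.

Lemma rdistC V (x y : V) : rnorm (x - y) = rnorm (y - x).
Proof. by rewrite /rnorm distrC. Qed.

Lemma ler_rnormB V (x y : V) : rnorm (x - y) <= rnorm x + rnorm y.
Proof. by rewrite -(rnormN y) ler_rnormD. Qed.

Lemma ler_rdistD V (z x y : V) : rnorm (x - y) <= rnorm (x - z) + rnorm (z - y).
Proof. by rewrite (le_trans _ (ler_rnormD _ _))// subrKA. Qed.

Lemma rnorm0 V : rnorm (0 : V) = 0.
Proof. by rewrite /rnorm normr0. Qed.

Lemma rnorm0_eq0 V (x : V) : rnorm x = 0 -> x = 0.
Proof. by move=> x0; apply/normr0_eq0; rewrite norm_rnorm x0. Qed.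

Lemma ler_rnorm_sum V I (r : seq I) (P : pred I) (F : I -> V) :
  rnorm (\sum_(i <- r | P i) F i) <= \sum_(i <- r | P i) rnorm (F i).
Proof.
elim/big_ind2 : _ => //; first by rewrite rnorm0.
move=> x1 x2 y1 y2 h1 h2; exact: le_trans (ler_rnormD _ _) (lerD h1 h2).
Qed.

Lemma rnorm_le0 V (x : V) : (forall e : R, 0 < e -> rnorm x <= e) -> x = 0.
Proof.
move=> h; apply: rnorm0_eq0; apply/eqP; rewrite eq_le rnorm_ge0 andbT.
by apply/ler_addgt0Pl => e e0; rewrite addr0 h.
Qed.

Lemma rnorm_eq V (x y : V) : (forall e : R, 0 < e -> rnorm (x - y) <= e) -> x = y.
Proof. by move=> h; apply/eqP; rewrite -subr_eq0; apply/eqP/rnorm_le0. Qed.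

Local Notation cmod z := (rnorm (z : R[i]^o)).

Lemma rnormZ V (k : R[i]) (x : V) : rnorm (k *: x) = cmod k * rnorm x.
Proof.
apply: (@complex.complexI R).
by rewrite (rmorphM (real_complex R)) /= -!norm_rnorm normrZ.
Qed.

Lemma norm_cmod (k : R[i]) : `|k| = (cmod k)%:C.
Proof. exact: (norm_rnorm (k : R[i]^o)). Qed.

Lemma cmodM (k l : R[i]) : cmod (k * l) = cmod k * cmod l.
Proof. exact: (rnormZ k (l : R[i]^o)). Qed.

Lemma cmod_real (x : R) : cmod x%:C = `|x|.
Proof. by rewrite /rnorm /= expr0n /= addr0 sqrtr_sqr. Qed.

Lemma rnormZr V (t : R) (x : V) : rnorm (t%:C *: x) = `|t| * rnorm x.
Proof. by rewrite rnormZ cmod_real. Qed.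

Lemma scale_half V (x : V) : (2^-1)%:C *: (x + x) = x.
Proof.
rewrite scalerDr -scalerDl -(rmorphD (real_complex R)) /=.
by have -> : 2^-1 + 2^-1 = 1 :> R by [lra]; rewrite scale1r.
Qed.

Lemma cmod_conj (k : R[i]) : cmod k^* = cmod k.
Proof. by rewrite /rnorm complex.normcJ. Qed.

Lemma cmod_i : cmod ('i : R[i]) = 1.
Proof. by rewrite /rnorm /= expr0n /= expr1n add0r sqrtr1. Qed.

Lemma ler_Re (k : R[i]) : `|complex.Re k| <= cmod k.
Proof. by rewrite -complex.lecR -norm_cmod complex.normc_ge_Re. Qed.

Lemma ler_Im (k : R[i]) : `|complex.Im k| <= cmod k.
Proof.
have := ler_Re ('i * k); rewrite cmodM cmod_i mul1r.
by case: k => a b /=; rewrite mul0r mul1r sub0r normrN.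
Qed.

Lemma ler_cmod (k : R[i]) : cmod k <= `|complex.Re k| + `|complex.Im k|.
Proof.
rewrite [in cmod _](complex.complexE k) (le_trans (ler_rnormD (V:=R[i]^o) _ _))//.
by rewrite cmodM cmod_i mul1r !cmod_real.
Qed.

Lemma sqr_cmod (k : R[i]) : ((cmod k) ^+ 2)%:C = k * k^*.
Proof. by rewrite -complex.sqr_normc norm_cmod (rmorphXn (real_complex R)). Qed.

Lemma cvg_rnormP V T (F : set_system T) {FF : Filter F} (f : T -> V) (l : V) :
  f @ F --> l <-> forall e : R, 0 < e -> \forall t \near F, rnorm (f t - l) < e.
Proof.
split=> [/cvgrPdist_lt h e e0|h].
  have /h : (0 : R[i]) < e%:C by rewrite complex.ltcR.
  by apply: filterS => t; rewrite norm_rnorm complex.ltcR rdistC.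
apply/cvgrPdist_lt => e; rewrite complex.ltcE => /= /andP[/eqP Ime Ree].
have := h _ Ree; apply: filterS => t.
rewrite norm_rnorm rdistC => ht.
by rewrite complex.ltcE /= Ime eqxx.
Qed.

Lemma cauchy_seq_cvg (V : completeNormedModType R[i]) (u : nat -> V) :
  (forall e : R, 0 < e -> exists N, forall n m, (N <= n)%N -> (N <= m)%N ->
    rnorm (u n - u m) < e) ->
  exists l : V, u @ \oo --> l.
Proof.
move=> uC.
have /cauchy_cvg : cauchy (u @ \oo).
  apply/cauchy_ballP => e; rewrite complex.ltcE => /= /andP[/eqP Ime Ree].
  have [N hN] := uC _ Ree.
  exists ([set x | exists2 n, (N <= n)%N & x = u n],
          [set x | exists2 n, (N <= n)%N & x = u n]).
    by split; exists N => // n Nn; exists n.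
  move=> [_ _] [/= [n Nn ->] [m Nm ->]].
  rewrite -ball_normE /= norm_rnorm complex.ltcE /= Ime eqxx /=.
  exact: hN.
by move=> /cvg_ex.
Qed.

Lemma cvg_rnorm_le V T (F : set_system T) {FF : ProperFilter F} (f : T -> V)
  (l : V) (c : R) : f @ F --> l -> (forall t, rnorm (f t) <= c) -> rnorm l <= c.
Proof.
move=> /cvg_rnormP fl fc; apply/ler_addgt0Pl => e /fl /filter_ex[t ft].
rewrite -(subrK (f t) l) (le_trans (ler_rnormD _ _))// lerD//.
by rewrite rdistC ltW.
Qed.

Lemma closure_approx V (A : set V) x : closure A x ->
  forall e : R, 0 < e -> exists2 y, A y & rnorm (y - x) < e.
Proof.
move=> Ax e e0; have e0C : (0 : R[i]) < e%:C by rewrite complex.ltcR.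
have [y [Ay]] := Ax _ (nbhsx_ballx x _ e0C).
rewrite -ball_normE /= norm_rnorm complex.ltcR rdistC => xy.
by exists y.
Qed.

Lemma bounded_op_continuous V W (T : V -> W) (c : R) : linear T ->
  (forall x, rnorm (T x) <= c * rnorm x) -> bounded_op T.
Proof.
move=> Tl Tc; split=> // x; apply/cvg_rnormP => e e0.
have c1 : 0 < `|c| + 1 by rewrite ltr_wpDl.
have := (@cvg_rnormP V V (nbhs x) (nbhs_filter x) idfun x).1 cvg_id
  (e / (`|c| + 1)) (divr_gt0 e0 c1).
apply: filterS => y /=; rewrite ltr_pdivlMr// => h.
have -> : T y - T x = T (y - x).
  by rewrite addrC -scaleN1r -Tl scaleN1r addrC.
apply: le_lt_trans h; apply: (le_trans (Tc _)).
rewrite mulrC ler_wpM2l ?rnorm_ge0//.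
by rewrite (le_trans (ler_norm c))// lerDl.
Qed.

Lemma bounded_op_bound V W (T : V -> W) : bounded_op T ->
  exists2 c : R, 0 < c & forall x, rnorm (T x) <= c * rnorm x.
Proof.
move=> [Tl Tc]; have := (@cvg_rnormP W V _ (nbhs_filter (0 : V)) T (T 0)).1 (Tc 0) 1 ltr01.
have T0 : T 0 = 0 by have := Tl (-1) 0 0; rewrite scaler0 addr0 scaleN1r addNr => ->.
have TZ k x : T (k *: x) = k *: T x by have := Tl k x 0; rewrite !addr0 T0 addr0.
rewrite T0 => H; have [e /= + h] := (nbhs_normP _ _).1 H.
rewrite complex.ltcE => /= /andP[/eqP Ime e0].
exists (2 / complex.Re e); first by rewrite divr_gt0.
move=> x; have [x0|x0] := eqVneq (rnorm x) 0.
  by rewrite x0 mulr0 (rnorm0_eq0 x0) T0 rnorm0.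
have {}x0 : 0 < rnorm x by rewrite lt_def x0 rnorm_ge0.
(* This factor scales [x] to norm half the radius of the ball, hence strictly inside it. *)
set t := complex.Re e / (2 * rnorm x).
have t0 : 0 < t by rewrite divr_gt0// mulr_gt0.
have /h /= : ball_ Num.norm 0 e (t%:C *: x).
  rewrite /ball_ /= sub0r normrN norm_rnorm rnormZr gtr0_norm//.
  rewrite complex.ltcE /= Ime eqxx /= /t invfM mulrA mulfVK ?gt_eqF//.
  by rewrite ltr_pdivrMr// ltr_pMr// ltr1n.
rewrite subr0 TZ rnormZr gtr0_norm// mulrC -ltr_pdivlMr//.
by rewrite div1r /t invf_div mulrAC => /ltW.
Qed.

(** A Cauchy filter is controlled by countably many balls: the centres [u n] of balls of radius
    1/(n+1) that belong to the filter form a Cauchy sequence, and the filter converges to its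
    limit. *)
Lemma seq_complete V :
  (forall u : nat -> V, (forall e : R, 0 < e -> exists N, forall n m,
     (N <= n)%N -> (N <= m)%N -> rnorm (u n - u m) < e) ->
   exists l : V, u @ \oo --> l) ->
  forall F : set_system V, ProperFilter F -> cauchy F -> cvg F.
Proof.
move=> sc F FF /cauchyP Fc.
have inv0 n : 0 < n.+1%:R^-1 :> R by rewrite invr_gt0.
have small (e : R) : 0 < e -> exists N, forall n, (N <= n)%N -> n.+1%:R^-1 < e.
  move=> e0; exists (Num.bound e^-1) => n Nn.
  rewrite -[ltRHS]invrK ltf_pV2 ?posrE ?invr_gt0//.
  rewrite (lt_le_trans (archi_boundP _)) ?invr_ge0 ?(ltW e0)// ler_nat.
  exact: leq_trans Nn _.
have /choice[u uF] : forall n, exists x : V,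
    F [set y | rnorm (y - x) < n.+1%:R^-1].
  move=> n; have [|x Fx] := Fc (n.+1%:R^-1)%:C; first by rewrite complex.ltcR.
  exists x; apply: filterS Fx => y; rewrite -ball_normE /= norm_rnorm.
  by rewrite complex.ltcR rdistC.
have [e e0|l ul] := sc u.
  have [N hN] := small (e / 2) (divr_gt0 e0 (ltr0Sn _ _)).
  exists N => n m Nn Nm.
  have [y [yn ym]] := filter_ex (filterI (uF n) (uF m)).
  rewrite (le_lt_trans (ler_rdistD y _ _))// (splitr e).
  rewrite ltrD//; first by rewrite rdistC (lt_trans yn)// hN.
  by rewrite (lt_trans ym)// hN.
apply/cvg_ex; exists l; apply/(@cvg_rnormP V V F _ idfun) => e e0.
have e2 := divr_gt0 e0 (ltr0Sn R 1).
have [N hN] := small _ e2.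
have /cvg_rnormP/(_ _ e2)[M _ hM] := ul.
apply: filterS (uF (maxn N M)) => y yu.
rewrite (le_lt_trans (ler_rdistD (u (maxn N M)) _ _))// (splitr e) ltrD//.
  by rewrite (lt_trans yu)// hN// leq_maxl.
by apply: hM; rewrite /= leq_maxr.
Qed.

Lemma cauchy_seq_cvg_real (u : nat -> R) :
  (forall e : R, 0 < e -> exists N, forall n m, (N <= n)%N -> (N <= m)%N ->
    `|u n - u m| < e) ->
  exists l, forall e : R, 0 < e ->
    exists N, forall n, (N <= n)%N -> `|u n - l| < e.
Proof.
move=> uC.
have /cauchy_cvg : cauchy (u @ \oo).
  apply/cauchy_ballP => e e0; have [N hN] := uC _ e0.
  exists ([set x | exists2 n, (N <= n)%N & x = u n],
          [set x | exists2 n, (N <= n)%N & x = u n]).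
    by split; exists N => // n Nn; exists n.
  by move=> [_ _] [/= [n Nn ->] [m Nm ->]]; rewrite -ball_normE /=; exact: hN.
move=> /cvg_ex[l /cvgrPdist_lt ul]; exists l => e /ul[N _ hN].
by exists N => n Nn; rewrite distrC; exact: hN.
Qed.

Lemma cauchy_seq_cvg_complex (u : nat -> R[i]) :
  (forall e : R, 0 < e -> exists N, forall n m, (N <= n)%N -> (N <= m)%N ->
    cmod (u n - u m) < e) ->
  exists l : R[i], forall e : R, 0 < e ->
    exists N, forall n, (N <= n)%N -> cmod (u n - l) < e.
Proof.
move=> uC.
have [|a ha] := @cauchy_seq_cvg_real (fun n => complex.Re (u n)).
  move=> e /uC[N hN]; exists N => n m Nn Nm; apply: le_lt_trans (hN _ _ Nn Nm).
  by have := ler_Re (u n - u m); rewrite raddfB.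
have [|b hb] := @cauchy_seq_cvg_real (fun n => complex.Im (u n)).
  move=> e /uC[N hN]; exists N => n m Nn Nm; apply: le_lt_trans (hN _ _ Nn Nm).
  by have := ler_Im (u n - u m); rewrite raddfB.
exists (a +i* b) => e e0.
have e2 := divr_gt0 e0 (ltr0Sn R 1).
have [N hN] := ha _ e2; have [M hM] := hb _ e2.
exists (maxn N M) => n; rewrite geq_max => /andP[Nn Mn].
rewrite (le_lt_trans (ler_cmod _))// (splitr e) !raddfB /=.
by rewrite ltrD ?hN ?hM.
Qed.

End NormedSpaces.

Notation cmod z := (rnorm (z : (_[i])^o)).

(** * Square roots and positivity in C*-algebras *)

Section CStarAlgebras.
Context (R : realType) (A : cstarAlgType R).
Implicit Types (a b c d w x y z : A) (s t : R).

Lemma cmul0a a : (0 : A) ** a = 0.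
Proof. by apply: (addrI (0 ** a)); rewrite -cmulDl !addr0. Qed.

Lemma cmula0 a : a ** (0 : A) = 0.
Proof. by apply: (addrI (a ** 0)); rewrite -cmulDr !addr0. Qed.

Lemma cmulNa a b : (- a) ** b = - (a ** b).
Proof. by apply: (addrI (a ** b)); rewrite -cmulDl !subrr cmul0a. Qed.

Lemma cmulaN a b : a ** (- b) = - (a ** b).
Proof. by apply: (addrI (a ** b)); rewrite -cmulDr !subrr cmula0. Qed.

Lemma cmulBl a b c : (a - b) ** c = a ** c - b ** c.
Proof. by rewrite cmulDl cmulNa. Qed.

Lemma cmulBr a b c : a ** (b - c) = a ** b - a ** c.
Proof. by rewrite cmulDr cmulaN. Qed.

Lemma star0 : star (0 : A) = 0.
Proof. by apply: (addrI (star 0)); rewrite -starD !addr0. Qed.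

Lemma starN a : star (- a) = - star a.
Proof. by apply: (addrI (star a)); rewrite -starD !subrr star0. Qed.

Lemma starB a b : star (a - b) = star a - star b.
Proof. by rewrite starD starN. Qed.

Lemma star1 : star (cone : A) = cone.
Proof. by have := starM (star cone) (cone : A); rewrite cmula1 starK cmula1. Qed.

(* [starZ] with [conjc] for [Num.conj], to match [dot_conj]. *)
Lemma star_conjZ (k : R[i]) a : star (k *: a) = conjc k *: star a.
Proof. exact: starZ. Qed.

Lemma starZr t a : star (t%:C *: a) = t%:C *: star a.
Proof. by rewrite star_conjZ complex.conjc_real. Qed.

Lemma rnormM a b : rnorm (a ** b) <= rnorm a * rnorm b.
Proof.
by rewrite -complex.lecR (rmorphM (real_complex R)) /= -!norm_rnorm cnormM.
Qed.

Lemma rnorm_star_mul a : rnorm (star a ** a) = rnorm a ^+ 2.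
Proof.
apply: (@complex.complexI R).
by rewrite (rmorphXn (real_complex R)) /= -!norm_rnorm cnorm_star.
Qed.

Lemma rnorm_star a : rnorm (star a) = rnorm a.
Proof.
have le_star b : rnorm b <= rnorm (star b).
  have [->|b0] := eqVneq (rnorm b) 0; first exact: rnorm_ge0.
  rewrite -(@ler_pM2r _ (rnorm b)) ?lt_def ?b0 ?rnorm_ge0//.
  by rewrite -expr2 -rnorm_star_mul rnormM.
by apply/eqP; rewrite eq_le le_star -{2}(starK a) le_star.
Qed.

Lemma rnorm_sqr a : star a = a -> rnorm (a ** a) = rnorm a ^+ 2.
Proof. by move=> aE; rewrite -rnorm_star_mul aE. Qed.

Lemma rnorm_cone : rnorm (cone : A) <= 1.
Proof.
have := rnorm_sqr star1; rewrite cmul1a; have := rnorm_ge0 (cone : A).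
by set n := rnorm _; nra.
Qed.

Lemma star_mul_eq0 a : star a ** a = 0 -> a = 0.
Proof.
move=> a0; apply: rnorm0_eq0; apply/eqP.
by rewrite -sqrf_eq0 -rnorm_star_mul a0 rnorm0.
Qed.

(* The binomial series of 1 - sqrt(1 - y), as the limit of the iteration
   z := (y + z^2) / 2; it is dominated by the same iteration at y = 1. *)
Fixpoint root_iter y n : A :=
  if n is n'.+1 then (2^-1)%:C *: (y + root_iter y n' ** root_iter y n') else 0.

Fixpoint root_majorant n : R :=
  if n is n'.+1 then 2^-1 * (1 + root_majorant n' ^+ 2) else 0.

Lemma root_majorant_bounds n :
  0 <= root_majorant n /\ root_majorant n <= root_majorant n.+1 <= 1.
Proof.
elim: n => [|n [h0 /andP[h1 h2]]] /=; first by split; [|apply/andP; split]; lra.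
move: h0 h1 h2 => /=; set r := root_majorant n => h0 h1 h2.
by split; [|apply/andP; split]; nra.
Qed.

Lemma root_majorant_mono m n : (m <= n)%N -> root_majorant m <= root_majorant n.
Proof.
move=> /subnK <-; elim: (n - m)%N => // k IH; rewrite addSn (le_trans IH)//.
by have [_ /andP[]] := root_majorant_bounds (k + m).
Qed.

(** A bounded monotone sequence is Cauchy, so no rate is required. This matters when [y] has norm 1,
    where the iteration is not a strict contraction. *)
Lemma root_majorant_cauchy e : 0 < e -> exists N, forall n m,
  (N <= n)%N -> (N <= m)%N -> `|root_majorant n - root_majorant m| < e.
Proof.
move=> e0; pose S := range root_majorant.
have S1 : has_ubound S.
  exists 1 => _ [n _ <-].
  have [_ /andP[h1 h2]] := root_majorant_bounds n; exact: le_trans h2.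
have S2 : has_sup S by split=> //; exists (root_majorant 0), 0.
have [_ [N _ <-] hN] := sup_adherent e0 S2.
exists N => n m Nn Nm.
have ub k : root_majorant k <= sup S by apply: ub_le_sup => //; exists k.
have := (ub n, ub m, root_majorant_mono Nn, root_majorant_mono Nm).
move=> [[[h1 h2] h3] h4]; rewrite ltr_norml; apply/andP; split; lra.
Qed.

Section RootIter.
Variable y : A.
Hypothesis y1 : rnorm y <= 1.

Lemma root_iter_bounds n : rnorm (root_iter y n) <= root_majorant n /\
  rnorm (root_iter y n.+1 - root_iter y n)
    <= root_majorant n.+1 - root_majorant n.
Proof.
have half0 : 0 <= 2^-1 :> R by lra.
elim: n => [|n [IH1 IH2]].
  rewrite /= rnorm0 subr0 cmul0a addr0 rnormZr ger0_norm//; split=> //.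
  by move: y1; set r := rnorm y; lra.
have S1 : rnorm (root_iter y n.+1) <= root_majorant n.+1.
  rewrite /= rnormZr ger0_norm// ler_wpM2l//.
  rewrite (le_trans (ler_rnormD _ _))// lerD//.
  rewrite (le_trans (rnormM _ _))// expr2.
  by rewrite ler_pM ?rnorm_ge0.
split=> //; have [h0 /andP[h1 h2]] := root_majorant_bounds n.
move: S1 IH1 IH2 h0 h1.
(* The noncommutative difference of squares a^2 - b^2 = a (a - b) + (a - b) b, matched below by the
   same formula for the majorant. *)
have -> : root_iter y n.+2 - root_iter y n.+1 = (2^-1)%:C *:
   (root_iter y n.+1 ** (root_iter y n.+1 - root_iter y n)
     + (root_iter y n.+1 - root_iter y n) ** root_iter y n).
  rewrite {1}/root_iter -/root_iter -/(root_iter y n.+1).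
  rewrite {3}/root_iter -/root_iter -scalerBr; congr (_ *: _).
  by rewrite cmulBr cmulBl subrKA opprD addrACA subrr add0r.
have -> : root_majorant n.+2 - root_majorant n.+1 = 2^-1 *
   (root_majorant n.+1 * (root_majorant n.+1 - root_majorant n)
     + (root_majorant n.+1 - root_majorant n) * root_majorant n).
  by rewrite /=; field.
set a := root_iter y n.+1; set b := root_iter y n.
set r := root_majorant n.+1; set q := root_majorant n => k1 k2 k3 k4 k5.
rewrite rnormZr ger0_norm// ler_wpM2l//.
rewrite (le_trans (ler_rnormD _ _))// lerD// (le_trans (rnormM _ _))//.
  by rewrite ler_pM ?rnorm_ge0.
by rewrite ler_pM ?rnorm_ge0.
Qed.

Lemma root_iter_dist n m :
  rnorm (root_iter y n - root_iter y m) <= `|root_majorant n - root_majorant m|.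
Proof.
wlog nm : n m / (m <= n)%N.
  by move=> h; case: (leqP m n) => [|/ltnW] /h//; rewrite rdistC distrC.
rewrite ger0_norm ?subr_ge0 ?root_majorant_mono//.
rewrite -(subnK nm); elim: (n - m)%N => [|k IH]; first by rewrite !subrr rnorm0.
rewrite addSn (le_trans (ler_rdistD (root_iter y (k + m)) _ _))//.
rewrite -[leRHS](subrKA (root_majorant (k + m))) lerD//.
by have [] := root_iter_bounds (k + m).
Qed.

End RootIter.

Lemma cvg_cmul T (F : set_system T) {FF : Filter F} (f g : T -> A) a b :
  f @ F --> a -> g @ F --> b -> (fun i => f i ** g i) @ F --> a ** b.
Proof.
move=> /cvg_rnormP fa /cvg_rnormP gb; apply/cvg_rnormP => e e0.
set k := rnorm a + rnorm b + 1.
have k0 : 0 < k by rewrite ltr_wpDl ?addr_ge0 ?rnorm_ge0.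
set d := Num.min 1 (e / (2 * k)).
have d0 : 0 < d by rewrite lt_min ltr01 divr_gt0// mulr_gt0.
apply: filterS (filterI (fa _ d0) (gb _ d0)) => t [fat gbt].
have -> : f t ** g t - a ** b = (f t - a) ** g t + a ** (g t - b).
  by rewrite cmulBl cmulBr subrKA.
rewrite (le_lt_trans (ler_rnormD _ _))//.
have gk : rnorm (g t) <= rnorm b + d.
  by rewrite -lerBlDl (le_trans _ (ltW gbt))// lerBlDl -{1}(subrKC b (g t)) ler_rnormD.
have d1 : d <= 1 by rewrite /d ge_min lexx.
have dk : 2 * d * k <= e.
  have : d <= e / (2 * k) by rewrite /d ge_min lexx orbT.
  by rewrite ler_pdivlMr ?mulr_gt0// mulrA (mulrC d).
have h1 : rnorm ((f t - a) ** g t) <= d * (rnorm b + d).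
  by rewrite (le_trans (rnormM _ _))// ler_pM ?rnorm_ge0// ltW.
have h2 : rnorm (a ** (g t - b)) <= rnorm a * d.
  by rewrite (le_trans (rnormM _ _))// ler_wpM2l ?rnorm_ge0// ltW.
rewrite (le_lt_trans (lerD h1 h2))//.
have a0 := rnorm_ge0 a; have b0 := rnorm_ge0 b.
by move: dk; rewrite /k; nra.
Qed.

Lemma cvg_cstar T (F : set_system T) {FF : Filter F} (f : T -> A) a :
  f @ F --> a -> (fun i => star (f i)) @ F --> star a.
Proof.
move=> /cvg_rnormP fa; apply/cvg_rnormP => e /fa; apply: filterS => t.
by rewrite -starB rnorm_star.
Qed.

Definition root_lim y : A := lim (root_iter y @ \oo).

Section RootLim.
Variable y : A.
Hypothesis y1 : rnorm y <= 1.

Lemma root_lim_cvg : root_iter y @ \oo --> root_lim y.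
Proof.
apply/cvg_ex/cauchy_seq_cvg => e /root_majorant_cauchy[N hN].
by exists N => n m Nn Nm; rewrite (le_lt_trans (root_iter_dist y1 _ _))// hN.
Qed.

(** For z = [root_lim y] this equation amounts to (1 - z)^2 = 1 - y, which is how [csqrt] gets its
    square. *)
Lemma root_lim_fix : root_lim y = (2^-1)%:C *: (y + root_lim y ** root_lim y).
Proof.
have h1 : (fun n => root_iter y n.+1) @ \oo --> root_lim y.
  by have := root_lim_cvg; rewrite -(cvg_shiftS (root_iter y)).
have h2 : (fun n => root_iter y n.+1) @ \oo -->
    (2^-1)%:C *: (y + root_lim y ** root_lim y).
  apply: (cvgZr (k := (2^-1)%:C)); apply: cvgD; first exact: cvg_cst.
  exact: cvg_cmul root_lim_cvg root_lim_cvg.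
exact: cvg_unique h1 h2.
Qed.

Lemma rnorm_root_lim : rnorm (root_lim y) <= 1.
Proof.
apply: (cvg_rnorm_le root_lim_cvg) => n.
have [h _] := root_iter_bounds y1 n; rewrite (le_trans h)//.
by have [_ /andP[h1 h2]] := root_majorant_bounds n; exact: le_trans h2.
Qed.

End RootLim.

(** The iterates are the same polynomials evaluated at [y] and at [y'], so the relation passes to
    them and then to the limit. The version with two elements, stronger than commutation, serves
    [star_mul_neg_eq0]. *)
Lemma root_lim_intertwines w y y' : rnorm y <= 1 -> rnorm y' <= 1 ->
  w ** y = y' ** w -> w ** root_lim y = root_lim y' ** w.
Proof.
move=> y1 y'1 wy.
have h1 : (fun n => w ** root_iter y n) @ \oo --> w ** root_lim y.
  by apply: cvg_cmul; [exact: cvg_cst|exact: root_lim_cvg].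
have h2 : (fun n => root_iter y' n ** w) @ \oo --> root_lim y' ** w.
  by apply: cvg_cmul; [exact: root_lim_cvg|exact: cvg_cst].
suff E n : w ** root_iter y n = root_iter y' n ** w.
  have h3 : (fun n => root_iter y' n ** w) @ \oo --> w ** root_lim y.
    by rewrite -(funext E).
  exact: cvg_unique h3 h2.
elim: n => [|n IH] /=; first by rewrite cmul0a cmula0.
by rewrite cmulZr cmulZl cmulDr cmulDl wy cmulA IH -!cmulA IH.
Qed.

Lemma star_root_lim y : rnorm y <= 1 -> star y = y ->
  star (root_lim y) = root_lim y.
Proof.
move=> y1 yE; have h := root_lim_cvg y1.
have h2 := @cvg_cstar _ _ (eventually_filter) _ _ h.
suff E n : star (root_iter y n) = root_iter y n.
  rewrite (funext E) in h2; exact: cvg_unique h2 h.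
elim: n => [|n IH] /=; first by rewrite star0.
by rewrite starZr starD starM IH yE.
Qed.

(* The positive square root of x, for t > 0 and |t - x| <= t. *)
Definition csqrt t x : A :=
  (Num.sqrt t)%:C *: (cone - root_lim (cone - t^-1%:C *: x)).

Section Csqrt.
Variables (t : R).
Hypothesis t0 : 0 < t.

Lemma csqrt_arg x : rnorm (t%:C *: cone - x) <= t ->
  rnorm (cone - t^-1%:C *: x) <= 1.
Proof.
move=> xt; have -> : cone - t^-1%:C *: x = t^-1%:C *: (t%:C *: cone - x).
  by rewrite scalerBr scalerA -(rmorphM (real_complex R)) /= mulVf ?gt_eqF// scale1r.
by rewrite rnormZr gtr0_norm ?invr_gt0// mulrC ler_pdivrMr// mul1r.
Qed.

Lemma csqrtE x : rnorm (t%:C *: cone - x) <= t -> csqrt t x ** csqrt t x = x.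
Proof.
move=> xt; have y1 := csqrt_arg xt; rewrite /csqrt.
set y := cone - t^-1%:C *: x in y1 *.
have := root_lim_fix y1; set z := root_lim y => zE.
rewrite cmulZl cmulZr scalerA -(rmorphM (real_complex R)) /= -expr2 sqr_sqrtr ?(ltW t0)//.
have -> : (cone - z) ** (cone - z) = cone - y.
  rewrite cmulBl !cmulBr cmul1a cmula1 cmul1a opprB.
  have -> : z ** z = z + z - y.
    have := congr2 +%R zE zE; rewrite -scalerDr scale_half => ->.
    by rewrite addrC addKr.
  by rewrite (addrAC (z + z)) addrK addrA subrK.
rewrite /y opprB addrC subrK scalerA -(rmorphM (real_complex R)) /=.
by rewrite mulfV ?gt_eqF// scale1r.
Qed.

Lemma star_csqrt x : rnorm (t%:C *: cone - x) <= t -> star x = x ->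
  star (csqrt t x) = csqrt t x.
Proof.
move=> xt xE; rewrite /csqrt starZr starB star1 star_root_lim ?csqrt_arg//.
by rewrite starB star1 starZr xE.
Qed.

Lemma csqrt_intertwines w x x' : rnorm (t%:C *: cone - x) <= t ->
  rnorm (t%:C *: cone - x') <= t -> w ** x = x' ** w ->
  w ** csqrt t x = csqrt t x' ** w.
Proof.
move=> xt xt' wx; rewrite /csqrt cmulZr cmulZl cmulBr cmulBl cmula1 cmul1a.
congr (_ *: (_ - _)); apply: root_lim_intertwines; rewrite ?csqrt_arg//.
by rewrite cmulBr cmulBl cmula1 cmul1a cmulZr cmulZl wx.
Qed.

Lemma csqrt_ball x : rnorm (t%:C *: cone - x) <= t ->
  rnorm ((Num.sqrt t)%:C *: cone - csqrt t x) <= Num.sqrt t.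
Proof.
move=> xt; rewrite /csqrt -scalerBr subKr rnormZr ger0_norm ?sqrtr_ge0//.
by rewrite ler_piMr ?sqrtr_ge0// rnorm_root_lim// csqrt_arg.
Qed.

End Csqrt.

(** * Positive elements as squares of self-adjoint elements *)

Definition self_adjoint x := star x = x.

(** The self-adjoint root distinguishes this from [cstar_pos]; that the two agree is the theorem
    [cstar_posP], reached only after the order has been developed. *)
Definition cpos x := exists2 z, self_adjoint z & x = z ** z.

Lemma self_adjoint_sqr z : self_adjoint z -> self_adjoint (z ** z).
Proof. by rewrite /self_adjoint starM => ->. Qed.

Lemma cpos_self_adjoint x : cpos x -> self_adjoint x.
Proof. by move=> [z zE ->]; exact: self_adjoint_sqr. Qed.

(** The root is [csqrt t x]. As [csqrt] divides by [t], the case t = 0, where x = 0, is treated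
    apart. *)
Lemma cpos_ball t x : self_adjoint x -> rnorm (t%:C *: cone - x) <= t -> cpos x.
Proof.
move=> xE xt; have : 0 <= t by apply: le_trans xt; exact: rnorm_ge0.
rewrite le_eqVlt => /orP[/eqP t0|t0].
  exists 0; rewrite ?/self_adjoint ?star0// cmula0; apply: rnorm0_eq0; apply/eqP.
  by move: xt; rewrite -t0 scale0r sub0r rnormN eq_le rnorm_ge0 => ->.
by exists (csqrt t x); [exact: star_csqrt|rewrite csqrtE].
Qed.

(* [x + 'i *: y] is t times an isometry. *)
Lemma rnorm_circle t x y : 0 <= t -> self_adjoint x -> self_adjoint y ->
  x ** y = y ** x -> x ** x + y ** y = (t ^+ 2)%:C *: cone -> rnorm x <= t.
Proof.
move=> t0 xE yE xy xyt; pose u := x + 'i *: y.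
have us : star u = x - 'i *: y.
  by rewrite starD star_conjZ xE yE /= -scaleNr; congr (_ + _ *: _); simpc.
have uu : star u ** u = (t ^+ 2)%:C *: cone.
  rewrite us cmulBl !cmulDr cmulZr !cmulZl cmulZr xy scalerA -expr2.
  by rewrite complex.sqr_i scaleN1r opprD opprK -xyt addrA addrK.
have ut : rnorm u <= t.
  rewrite -(@ler_pXn2r _ 2)// ?nnegrE ?rnorm_ge0//.
  rewrite -rnorm_star_mul uu rnormZr ger0_norm ?exprn_ge0//.
  by rewrite ler_piMr ?exprn_ge0// rnorm_cone.
have -> : x = (2^-1)%:C *: (u + star u).
  by rewrite us addrACA subrr addr0 scale_half.
rewrite rnormZr ger0_norm; last by lra.
have := ler_rnormD u (star u); rewrite rnorm_star.
by set m := rnorm (u + _); move: ut; set k := rnorm u; lra.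
Qed.

(** Write x = z^2 and let [w] be the square root of t - z^2, which commutes with [z]. Then w^2 + z^2
    = t, so [rnorm_circle] bounds [w] by the root of [t], and t - x = w^2. With [cpos_ball],
    positivity becomes a norm condition. *)
Lemma ball_cpos t x : cpos x -> rnorm x <= t -> rnorm (t%:C *: cone - x) <= t.
Proof.
move=> [z zE ->] xt; have : 0 <= t by apply: le_trans xt; exact: rnorm_ge0.
rewrite le_eqVlt => /orP[/eqP t0|t0].
  by move: xt; rewrite -t0 scale0r sub0r rnormN.
have zt : rnorm (t%:C *: cone - (t%:C *: cone - z ** z)) <= t by rewrite subKr.
pose w := csqrt t (t%:C *: cone - z ** z).
have wE : self_adjoint w.
  apply: star_csqrt => //; rewrite starB starZr star1.
  by rewrite (self_adjoint_sqr zE).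
have wz : w ** z = z ** w.
  apply/esym/csqrt_intertwines => //.
  by rewrite cmulBr cmulBl cmulZr cmulZl cmula1 cmul1a cmulA.
have ww : w ** w = t%:C *: cone - z ** z by rewrite csqrtE.
rewrite -ww rnorm_sqr// -[leRHS](sqr_sqrtr (ltW t0)).
rewrite ler_pXn2r ?nnegrE ?rnorm_ge0 ?sqrtr_ge0//.
apply: (rnorm_circle _ wE zE wz); rewrite ?sqrtr_ge0//.
by rewrite ww subrK sqr_sqrtr ?(ltW t0).
Qed.

(** Invisible on roots, but in terms of balls it is the triangle inequality, with radius |x| +
    |y|. *)
Lemma cposD x y : cpos x -> cpos y -> cpos (x + y).
Proof.
move=> xp yp; apply: (@cpos_ball (rnorm x + rnorm y)).
  by rewrite /self_adjoint starD !cpos_self_adjoint.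
rewrite (rmorphD (real_complex R)) /= scalerDl opprD addrACA.
by rewrite (le_trans (ler_rnormD _ _))// lerD// ball_cpos.
Qed.

Lemma cposZ t x : 0 <= t -> cpos x -> cpos (t%:C *: x).
Proof.
move=> t0 [z zE ->]; exists ((Num.sqrt t)%:C *: z).
  by rewrite /self_adjoint starZr zE.
rewrite cmulZl cmulZr scalerA -(rmorphM (real_complex R)) /= -expr2.
by rewrite sqr_sqrtr.
Qed.

Lemma cpos_cone t : 0 <= t -> cpos (t%:C *: cone).
Proof. by move=> t0; apply: cposZ => //; exists cone; rewrite ?cmul1a//; exact: star1. Qed.

Lemma cpos_csqrt t x : 0 < t -> self_adjoint x -> rnorm (t%:C *: cone - x) <= t ->
  cpos (csqrt t x).
Proof.
move=> t0 xE xt; apply: (@cpos_ball (Num.sqrt t)); last exact: csqrt_ball.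
exact: star_csqrt.
Qed.

(** The roots [p] of t - x and [q] of t + x commute with each other and with [x], so x^2 + (p q)^2 =
    t^2 and [rnorm_circle] applies. *)
Lemma cpos_between t x : 0 <= t -> self_adjoint x ->
  cpos (t%:C *: cone - x) -> cpos (t%:C *: cone + x) -> rnorm x <= t.
Proof.
move=> t0 xE mp pp; apply/ler_addgt0Pr => e e0.
(* A common bound for the norms of t - x and t + x; the summand [e] makes it positive, as [csqrt]
   demands. *)
pose T := rnorm x + t + e.
have T0 : 0 < T by rewrite /T ltr_wpDl ?addr_ge0 ?rnorm_ge0.
have tn : rnorm (t%:C *: (cone : A)) <= t.
  by rewrite rnormZr ger0_norm// ler_piMr// rnorm_cone.
have mT : rnorm (T%:C *: cone - (t%:C *: cone - x)) <= T.
  apply: ball_cpos => //; rewrite (le_trans (ler_rnormB _ _))//.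
  by rewrite addrC /T -addrA lerD2l (le_trans tn)// lerDl ltW.
have pT : rnorm (T%:C *: cone - (t%:C *: cone + x)) <= T.
  apply: ball_cpos => //; rewrite (le_trans (ler_rnormD _ _))//.
  by rewrite addrC /T -addrA lerD2l (le_trans tn)// lerDl ltW.
pose p := csqrt T (t%:C *: cone - x); pose q := csqrt T (t%:C *: cone + x).
have pE : self_adjoint p by apply: star_csqrt => //; exact: cpos_self_adjoint.
have qE : self_adjoint q by apply: star_csqrt => //; exact: cpos_self_adjoint.
have xp : x ** p = p ** x.
  apply: csqrt_intertwines => //.
  by rewrite cmulBr cmulBl cmulZr cmulZl cmula1 cmul1a.
have xq : x ** q = q ** x.
  apply: csqrt_intertwines => //.
  by rewrite cmulDr cmulDl cmulZr cmulZl cmula1 cmul1a.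
have pq : p ** q = q ** p.
  apply: csqrt_intertwines => //.
  by rewrite cmulDr cmulDl cmulZr (cmulZl _ cone) cmula1 cmul1a xp.
rewrite (le_trans (rnorm_circle (t := t) (y := p ** q) _ _ _ _ _))// ?lerDl ?ltW//.
- by rewrite /self_adjoint starM pE qE.
- by rewrite cmulA xp -cmulA xq cmulA.
- have -> : p ** q ** (p ** q) = (p ** p) ** (q ** q).
    by rewrite cmulA -(cmulA p q p) -pq !cmulA.
  rewrite csqrtE// csqrtE// cmulDr !cmulBl !cmulZl !cmulZr cmul1a cmula1 cmul1a.
  rewrite subrKA addrC subrK scalerA.
  by rewrite -(rmorphM (real_complex R)) /= -expr2.
Qed.

Lemma cpos_antisym x : cpos x -> cpos (- x) -> x = 0.
Proof.
move=> xp nxp; apply: rnorm0_eq0; apply/eqP; rewrite eq_le rnorm_ge0 andbT.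
by apply: cpos_between; rewrite ?scale0r ?sub0r ?add0r//; exact: cpos_self_adjoint.
Qed.

(** As [m] commutes with the square root [s] of [x], the product is the square of the self-adjoint
    [m ** s]. *)
Lemma cpos_conj_commute m x : self_adjoint m -> cpos x -> m ** x = x ** m ->
  cpos (m ** x ** m).
Proof.
move=> mE xp mx; pose T := rnorm x + 1.
have T0 : 0 < T by rewrite ltr_wpDl ?rnorm_ge0.
have xT : rnorm x <= T by rewrite lerDl.
pose s := csqrt T x.
have sE : self_adjoint s.
  by apply: star_csqrt; [exact: T0|exact: ball_cpos|exact: cpos_self_adjoint].
have ms : m ** s = s ** m by apply: csqrt_intertwines => //; exact: ball_cpos.
exists (m ** s); first by rewrite /self_adjoint starM mE sE ms.
have <- : s ** s = x by rewrite csqrtE//; exact: ball_cpos.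
by rewrite {2}ms !cmulA.
Qed.

(** Uniqueness of the positive square root. For m = a - x one has m (a + x) = 0, so the positive
    elements m a m and m x m are opposite, hence both zero. Their difference is m^3, and two uses of
    the C*-identity give m = 0. *)
Lemma csqrt_sqr t x : 0 < t -> rnorm (x ** x) <= t -> cpos x ->
  csqrt t (x ** x) = x.
Proof.
move=> t0 xt xp; have xE := cpos_self_adjoint xp.
have x2p : cpos (x ** x) by exists x.
have x2t := ball_cpos x2p xt.
pose a := csqrt t (x ** x).
have ap : cpos a by apply: cpos_csqrt => //; exact: cpos_self_adjoint.
have aE := cpos_self_adjoint ap.
have xa : x ** a = a ** x by apply: csqrt_intertwines => //; rewrite cmulA.
have aa : a ** a = x ** x by rewrite csqrtE.
pose m := a - x.
have mE : self_adjoint m by rewrite /self_adjoint starB aE xE.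
have ma : m ** a = a ** m by rewrite cmulBl cmulBr xa.
have mx : m ** x = x ** m by rewrite cmulBl cmulBr xa.
have map := cpos_conj_commute mE ap ma.
have mxp := cpos_conj_commute mE xp mx.
have max : m ** a ** m + m ** x ** m = 0.
  rewrite -cmulDl -cmulDr.
  have -> : m ** (a + x) = 0.
    by rewrite /m cmulBl !cmulDr aa xa (addrC (a ** x)) subrr.
  by rewrite cmul0a.
have mam : m ** a ** m = 0.
  apply: cpos_antisym => //.
  by have /eqP := max; rewrite addr_eq0 => /eqP ->; rewrite opprK.
have mxm : m ** x ** m = 0 by have := max; rewrite mam add0r.
have m3 : m ** m ** m = 0.
  have -> : m ** m = m ** a - m ** x by rewrite -cmulBr.
  by rewrite cmulBl mam mxm subrr.
have m2 : m ** m = 0.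
  apply: star_mul_eq0; rewrite (self_adjoint_sqr mE).
  by rewrite cmulA m3 cmul0a.
have m0 : m = 0 by apply: star_mul_eq0; rewrite mE.
by apply/eqP; rewrite -subr_eq0; apply/eqP.
Qed.

Lemma self_adjoint_star_mul c : self_adjoint (star c ** c).
Proof. by rewrite /self_adjoint starM starK. Qed.

Lemma cartesian_decomposition d : exists a b, [/\ self_adjoint a, self_adjoint b &
  d = a + 'i *: b].
Proof.
exists ((2^-1)%:C *: (d + star d)), ((2^-1)%:C *: ('i *: (star d - d))).
have half : 'i * (2^-1)%:C * 'i = - (2^-1)%:C :> R[i].
  by rewrite mulrAC -expr2 complex.sqr_i mulN1r.
split.
- by rewrite /self_adjoint starZr starD starK addrC.
- rewrite /self_adjoint starZr star_conjZ starB starK /= -opprB; congr (_ *: _).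
  by rewrite scalerN -scaleNr; congr (_ *: _); simpc.
- rewrite scalerA scalerA half scaleNr -scalerN opprB -scalerDr.
  by rewrite addrACA subrr addr0 scale_half.
Qed.

(** For d = a + i b with [a] and [b] self-adjoint the mixed terms cancel and the sum is 2 (a^2 +
    b^2). *)
Lemma cpos_star_mulD d : cpos (star d ** d + d ** star d).
Proof.
have [a [b [aE bE ->]]] := cartesian_decomposition d.
rewrite starD star_conjZ aE bE.
have -> : (conjc 'i : R[i]) = - 'i by simpc.
rewrite scaleNr cmulBl cmulDl !cmulBr !cmulDr !cmulZl !cmulZr !scalerA.
rewrite -expr2 complex.sqr_i scaleN1r opprK.
set X := a ** a; set Y := b ** b; set P := _ *: (a ** b); set Q := _ *: (b ** a).
have -> : X + P - (Q - Y) + (X - P + (Q + Y)) = (X + Y) + (X + Y).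
  rewrite opprB [X + P + _]addrACA (addrC Q) [X - P + _]addrACA.
  rewrite [LHS]addrACA; rewrite -[RHS]addr0; congr (_ + _).
  by rewrite addrACA subrr addNr !addr0.
by apply: cposD; apply: cposD; [exists a|exists b|exists a|exists b].
Qed.

(* Since star d intertwines (d ** star d)^2 and (star d ** d)^2, it intertwines
   their positive square roots d ** star d and - star d ** d. *)
Lemma star_mul_neg_eq0 d : cpos (- (star d ** d)) -> d = 0.
Proof.
move=> np; have ddp : cpos (d ** star d).
  by have := cposD (cpos_star_mulD d) np; rewrite [star d ** d + _]addrC addrK.
set x := star d ** d in np *; set y := d ** star d in ddp *.
pose T := rnorm (y ** y) + rnorm (- x ** - x) + 1.
have T0 : 0 < T by rewrite ltr_wpDl// addr_ge0 ?rnorm_ge0.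
have yT : rnorm (y ** y) <= T by rewrite /T -addrA lerDl addr_ge0 ?rnorm_ge0.
have xT : rnorm (- x ** - x) <= T by rewrite /T addrAC lerDr addr_ge0 ?rnorm_ge0.
have E : star d ** y = - x ** star d.
  rewrite -(csqrt_sqr T0 yT ddp) -(csqrt_sqr T0 xT np).
  apply: csqrt_intertwines => //.
  - by apply: ball_cpos => //; exists y => //; exact: cpos_self_adjoint.
  - by apply: ball_cpos => //; exists (- x) => //; exact: cpos_self_adjoint.
  - by rewrite cmulNa cmulaN opprK /y /x !cmulA.
(* Both sides of [E] are d^* d d^* up to opposite signs, so this element vanishes. *)
have E2 : star d ** y = 0.
  move: E; rewrite cmulNa /x /y cmulA => /eqP.
  rewrite -addr_eq0 -mulr2n -scaler_nat scaler_eq0 pnatr_eq0 /= => /eqP.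
  by [].
apply: star_mul_eq0; apply: star_mul_eq0; rewrite (self_adjoint_star_mul d).
by rewrite cmulA -(cmulA (star d) d) E2 cmul0a.
Qed.

(* With a = |h| and v = a - h, twice the negative part of h = star c ** c, one has
   star (c ** v) ** (c ** v) = - v ** a ** v, whence c ** v = 0. *)
Lemma cpos_star_mul c : cpos (star c ** c).
Proof.
set h := star c ** c; have hE : self_adjoint h := self_adjoint_star_mul c.
pose T := rnorm (h ** h) + 1.
have T0 : 0 < T by rewrite ltr_wpDl ?rnorm_ge0.
have h2p : cpos (h ** h) by exists h.
have hT : rnorm (T%:C *: cone - h ** h) <= T by apply: ball_cpos => //; rewrite lerDl.
pose a := csqrt T (h ** h).
have ap : cpos a by apply: cpos_csqrt => //; exact: cpos_self_adjoint.
have aE := cpos_self_adjoint ap.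
have ha : h ** a = a ** h by apply: csqrt_intertwines => //; rewrite cmulA.
have aa : a ** a = h ** h by rewrite csqrtE.
pose v := a - h; pose u := a + h.
have vE : self_adjoint v by rewrite /self_adjoint starB aE hE.
have uv : u ** v = 0.
  by rewrite cmulDl !cmulBr aa ha addrA subrK subrr.
have vu : v ** u = 0.
  by rewrite cmulBl !cmulDr aa ha (addrC (a ** h)) subrr.
have av : v ** a = a ** v by rewrite cmulBl cmulBr ha.
have hv : v ** h ** v = - (v ** a ** v).
  apply/eqP; rewrite -addr_eq0 -cmulDl -cmulDr (addrC h) -/u vu cmul0a//.
have vavp := cpos_conj_commute vE ap av.
have cv : c ** v = 0.
  apply: star_mul_neg_eq0; rewrite starM vE.
  by rewrite cmulA -(cmulA v) -/h hv opprK.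
have vav : v ** a ** v = 0.
  apply/eqP; rewrite -oppr_eq0 -hv; apply/eqP.
  by rewrite /h cmulA -cmulA cv cmula0.
have hv0 : h ** v = 0 by rewrite /h -cmulA cv cmula0.
have av0 : a ** v = 0.
  have := uv; rewrite cmulDl hv0 addr0 => //.
have v0 : v = 0.
  by apply: star_mul_eq0; rewrite vE cmulBl av0 hv0 subrr.
have -> : h = a by apply/eqP; rewrite eq_sym -subr_eq0 -/v v0.
exact: ap.
Qed.

(** Monotonicity of the norm: 0 <= x <= x + y <= |x + y| in the order of [A], whence
    [cpos_between]. *)
Lemma ler_rnorm_cposD x y : cpos x -> cpos y -> rnorm x <= rnorm (x + y).
Proof.
move=> xp yp; have xyp := cposD xp yp.
apply: cpos_between; rewrite ?rnorm_ge0//; first exact: cpos_self_adjoint.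
  have -> : (rnorm (x + y))%:C *: cone - x =
      ((rnorm (x + y))%:C *: cone - (x + y)) + y.
    by rewrite opprD addrA subrK.
  apply: cposD => //; apply: (@cpos_ball (rnorm (x + y))); last by rewrite subKr.
  by rewrite /self_adjoint starB starZr star1 cpos_self_adjoint.
by apply: cposD => //; apply: cpos_cone; exact: rnorm_ge0.
Qed.

Lemma cstar_posP x : cstar_pos x <-> cpos x.
Proof.
split=> [[c ->]|[z zE ->]]; first exact: cpos_star_mul.
by exists z; rewrite zE.
Qed.

End CStarAlgebras.

(** * Positive functionals *)

Section Sublinear.
Context (R : realType) (V : lmodType R).
Implicit Types (p q : V -> R) (x y : V).

Definition sublinear p := (forall x y, p (x + y) <= p x + p y) /\
  (forall t x, 0 < t -> p (t *: x) <= t * p x).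

Lemma sublinear0 p : sublinear p -> p 0 = 0.
Proof.
move=> [_ pZ]; have := pZ 2 0 (ltr0Sn _ _); have := pZ 2^-1 0.
rewrite !scaler0 invr_gt0 ltr0Sn => /(_ isT); lra.
Qed.

Lemma sublinearZ p t x : sublinear p -> 0 < t -> p (t *: x) = t * p x.
Proof.
move=> ps t0; apply/eqP; rewrite eq_le ps.2//=.
have := ps.2 t^-1 (t *: x); rewrite invr_gt0 scalerA mulVf ?gt_eqF// scale1r.
by move=> /(_ t0); rewrite mulrC ler_pdivlMr// mulrC.
Qed.

Lemma sublinearN p x : sublinear p -> - p (- x) <= p x.
Proof.
move=> ps; have := ps.1 x (- x); rewrite subrr sublinear0//; lra.
Qed.

(** Take q(x) = inf over t >= 0 of p(x + t h) - t p(h). A linear functional below [q] is at most -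
    p(h) at - h, so it attains p(h) at [h]. *)
Lemma sublinear_tilt p h : sublinear p ->
  exists q, [/\ sublinear q, forall x, q x <= p x & q (- h) <= - p h].
Proof.
move=> ps; pose S x := [set p (x + t *: h) - t * p h | t in [set t | 0 <= t]].
have pZ t x : 0 <= t -> p (t *: x) = t * p x.
  rewrite le_eqVlt => /orP[/eqP <-|]; last exact: sublinearZ.
  by rewrite scale0r mul0r sublinear0.
have lbS x : has_lbound (S x).
  exists (- p (- x)) => _ [t /= t0 <-].
  have := ps.1 (x + t *: h) (- x); rewrite addrAC subrr add0r pZ//; lra.
have infS x t : 0 <= t -> inf (S x) <= p (x + t *: h) - t * p h.
  by move=> t0; apply: ge_inf => //; exists t.
have S0 x : S x !=set0 by exists (p (x + 0 *: h) - 0 * p h), 0 => /=.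
exists (fun x => inf (S x)); split.
- split=> [x y|t x t0].
    rewrite -lerBlDr; apply: lb_le_inf => // _ [t /= t0 <-].
    rewrite lerBlDr -lerBlDl; apply: lb_le_inf => // _ [s /= s0 <-].
    rewrite lerBlDl (le_trans (infS _ (t + s) _))// ?addr_ge0//.
    rewrite scalerDl addrACA; have := ps.1 (x + t *: h) (y + s *: h); lra.
  rewrite mulrC -ler_pdivrMr//; apply: lb_le_inf => // _ [s /= s0 <-].
  rewrite ler_pdivrMr// (le_trans (infS _ (t * s) (mulr_ge0 (ltW t0) s0)))//.
  rewrite -scalerA -scalerDr sublinearZ//.
  by rewrite mulrBl (mulrC t (p _)) lerB// mulrAC (mulrC s).
- by move=> x; have := infS x 0 (lexx _); rewrite scale0r addr0 mul0r subr0.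
- by have := infS (- h) 1 ler01; rewrite scale1r addNr sublinear0// mul1r sub0r.
Qed.

(* A pointwise minimal sublinear functional is linear, for otherwise it could
   be tilted. *)
Lemma sublinear_minimal p : sublinear p -> exists q,
  [/\ sublinear q, forall x, q x <= p x & forall x, q (- x) = - q x].
Proof.
move=> ps; pose T := {q | sublinear q /\ forall x, q x <= p x}.
(* The order is reversed, so that a maximal element for Zorn's lemma is a pointwise minimal
   functional. *)
pose le (q r : T) := `[< forall x, sval r x <= sval q x >].
have [|||[q [qs qp]] qmin] := @ZL_preorder T (exist _ p (conj ps (fun=> lexx _))) le.
- by move=> q; apply/asboolP.
- move=> q r s /asboolP h1 /asboolP h2; apply/asboolP => x.
  exact: le_trans (h2 x) (h1 x).
- move=> C Ctot; have [[c0 Cc0]|C0] := pselect (C !=set0); last first.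
    exists (exist _ p (conj ps (fun=> lexx _))) => q Cq.
    by exfalso; apply: C0; exists q.
  pose S x := [set sval q x | q in C].
  have lbS x : has_lbound (S x).
    (* Every sublinear q <= p satisfies q(x) >= - q(- x) >= - p(- x), which keeps the infimum over a
       chain finite. *)
    exists (- p (- x)) => _ [q Cq <-].
    have := sublinearN x (svalP q).1; have := (svalP q).2 (- x); lra.
  have infS x (q : T) : C q -> inf (S x) <= sval q x.
    by move=> Cq; apply: ge_inf => //; exists q.
  have S0 x : S x !=set0 by exists (sval c0 x), c0.
  have ms : sublinear (fun x => inf (S x)).
    split=> [x y|t x t0].
      rewrite -lerBlDr; apply: lb_le_inf => // _ [q Cq <-].
      rewrite lerBlDr -lerBlDl; apply: lb_le_inf => // _ [r Cr <-].
      rewrite lerBlDl; have [/asboolP qr|/asboolP rq] := Ctot _ _ Cq Cr.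
        have := infS (x + y) r Cr; have := (svalP r).1.1 x y; have := qr x; lra.
      have := infS (x + y) q Cq; have := (svalP q).1.1 x y; have := rq y; lra.
    rewrite mulrC -ler_pdivrMr//; apply: lb_le_inf => // _ [q Cq <-].
    rewrite ler_pdivrMr// mulrC (le_trans (infS _ _ Cq))//.
    by have [[_ ->]] := svalP q.
  have mp x : inf (S x) <= p x by exact: le_trans (infS x _ Cc0) ((svalP c0).2 x).
  exists (exist (fun q => sublinear q /\ forall x, q x <= p x) _ (conj ms mp)).
  move=> q Cq; apply/asboolP => x; exact: infS.
exists q; split=> // x.
have [r [rs rq rx]] := sublinear_tilt x qs.
have rp y : r y <= p y := le_trans (rq y) (qp y).
have /asboolP/= qr : le (exist _ r (conj rs rp)) (exist _ q (conj qs qp)).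
  by apply: qmin; apply/asboolP.
apply/eqP; rewrite eq_le (le_trans (qr _) rx)/=.
by rewrite lerNl sublinearN.
Qed.

(** Tilting at [h] first fixes the value there; a minimal functional below the tilted one is odd,
    and an odd sublinear functional is linear. *)
Lemma hahn_banach_sublinear p h : sublinear p -> exists l : V -> R,
  [/\ linear l, forall x, l x <= p x & l h = p h].
Proof.
move=> ps; have [p' [p's p'p p'h]] := sublinear_tilt h ps.
have [l [ls lp' lN]] := sublinear_minimal p's.
have lp x : l x <= p x := le_trans (lp' x) (p'p x).
have lD x y : l (x + y) = l x + l y.
  apply/eqP; rewrite eq_le ls.1/=; have := ls.1 (- x) (- y).
  by rewrite -opprD !lN; lra.
have lZ t x : l (t *: x) = t * l x.
  have [t0|t0|->] := ltgtP t 0; last by rewrite scale0r mul0r sublinear0.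
    apply: oppr_inj; rewrite -lN -scaleNr -mulNr sublinearZ//; lra.
  exact: sublinearZ.
exists l; split=> //; first by move=> t x y; rewrite lD lZ.
apply/eqP; rewrite eq_le lp/= -lerN2 -lN; exact: le_trans (lp' _) p'h.
Qed.

End Sublinear.

Section Realification.
Context (R : realType) (V : lmodType R[i]).

(** A second name for [V], which can carry the real scalar multiplication next to the complex
    one. *)
Definition realification : Type := V.

HB.instance Definition _ := GRing.Zmodule.on realification.

Definition rscale (t : R) (x : realification) : realification :=
  t%:C *: (x : V).

Lemma rscaleA s t x : rscale s (rscale t x) = rscale (s * t) x.
Proof. by rewrite /rscale scalerA -(rmorphM (real_complex R)). Qed.

Lemma rscale1 : left_id 1 rscale.
Proof. by move=> x; rewrite /rscale scale1r. Qed.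

Lemma rscaleDr : right_distributive rscale +%R.
Proof. by move=> t x y; rewrite /rscale scalerDr. Qed.

Lemma rscaleDl x : {morph rscale^~ x : s t / s + t}.
Proof. by move=> s t; rewrite /rscale (rmorphD (real_complex R)) scalerDl. Qed.

HB.instance Definition _ := GRing.Zmodule_isLmodule.Build R realification
  rscaleA rscale1 rscaleDr rscaleDl.

End Realification.

(** * Positive functionals that norm a C*-algebra *)

Section PositiveFunctionals.
Context (R : realType) (A : cstarAlgType R).
Implicit Types (a b c : A) (psi : A -> R[i]).

(* Estimating a functional through its real and imaginary parts costs the
   factor 2 in [pf_bound], where 1 would be optimal. *)
Record positive_functional psi : Prop := PositiveFunctional {
  pfD : forall a b, psi (a + b) = psi a + psi b;
  pfZ : forall k a, psi (k *: a) = k * psi a;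
  pf_star : forall a, psi (star a) = conjc (psi a);
  pf_ge0 : forall c, 0 <= psi (star c ** c);
  pf_bound : forall a, cmod (psi a) <= 2 * rnorm a
}.

Definition re_part a : A := (2^-1)%:C *: (a + star a).

Lemma self_adjoint_re_part a : self_adjoint (re_part a).
Proof. by rewrite /self_adjoint starZr starD starK addrC. Qed.

Lemma re_part_self_adjoint a : self_adjoint a -> re_part a = a.
Proof. by move=> aE; rewrite /re_part aE scale_half. Qed.

Lemma re_partD a b : re_part (a + b) = re_part a + re_part b.
Proof. by rewrite /re_part starD addrACA scalerDr. Qed.

Lemma re_partZ (t : R) a : re_part (t%:C *: a) = t%:C *: re_part a.
Proof. by rewrite /re_part starZr -scalerDr !scalerA mulrC. Qed.

Lemma rnorm_re_part a : rnorm (re_part a) <= rnorm a.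
Proof.
rewrite rnormZr ger0_norm; last by lra.
by have := ler_rnormD a (star a); rewrite rnorm_star; lra.
Qed.

Let above a := [set t : R | 0 <= t /\ cpos (t%:C *: cone - re_part a)].

(** For self-adjoint [a] this is the larger of 0 and the top of the spectrum. It is at most 0 at
    [- (star c ** c)] and at elements with zero real part, so real linear functionals below it are
    positive and only see real parts. *)
Definition top_gauge a : R := inf (above a).

Let above_rnorm a (t : R) : rnorm (re_part a) <= t -> above a t.
Proof.
move=> at_; split; first exact: le_trans (rnorm_ge0 _) at_.
apply: (@cpos_ball _ _ t); last by rewrite subKr.
by rewrite /self_adjoint starB starZr star1 self_adjoint_re_part.
Qed.

Let above_nonempty a : above a !=set0.
Proof. by exists (rnorm (re_part a)); exact: above_rnorm. Qed.

Let above_lb a : has_lbound (above a).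
Proof. by exists 0 => t []. Qed.

Lemma top_gauge_le a (t : R) : 0 <= t -> cpos (t%:C *: cone - re_part a) ->
  top_gauge a <= t.
Proof. by move=> t0 h; apply: ge_inf; [exact: above_lb|split]. Qed.

Lemma top_gauge_rnorm a : top_gauge a <= rnorm a.
Proof.
have [h1 h2] := above_rnorm (rnorm_re_part a).
exact: top_gauge_le.
Qed.

Lemma sublinear_top_gauge : sublinear (top_gauge : realification A -> R).
Proof.
split=> [a b|t a t0].
  rewrite -lerBlDr; apply: lb_le_inf => // s [s0 sa].
  rewrite lerBlDr -lerBlDl; apply: lb_le_inf => // r [r0 rb].
  rewrite lerBlDl; apply: top_gauge_le; first exact: addr_ge0.
  rewrite re_partD (rmorphD (real_complex R)) /= scalerDl opprD addrACA.
  exact: cposD.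
rewrite mulrC -ler_pdivrMr//; apply: lb_le_inf => // s [s0 sa].
rewrite ler_pdivrMr// mulrC; apply: top_gauge_le; first by rewrite mulr_ge0// ltW.
rewrite [_ *: a]/(t%:C *: (a : A)) re_partZ (rmorphM (real_complex R)) /=.
by rewrite -scalerA -scalerBr; apply: cposZ => //; exact: ltW.
Qed.

Lemma rnorm_top_gauge h : self_adjoint h ->
  rnorm h <= Num.max (top_gauge h) (top_gauge (- h)).
Proof.
move=> hE; rewrite leNgt; apply/negP; rewrite gt_max => /andP[h1 h2].
have [t [t0 th] t1] := inf_lt (above_nonempty h) h1.
have [s [s0 sh] s1] := inf_lt (above_nonempty (- h)) h2.
have nhE : self_adjoint (- h) by rewrite /self_adjoint starN hE.
pose T := Num.max t s; have tT : t <= T by rewrite le_max lexx.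
have sT : s <= T by rewrite le_max lexx orbT.
have up (r : R) x : r <= T -> cpos (r%:C *: cone - x) -> cpos (T%:C *: (cone : A) - x).
  move=> rT rx; rewrite -(subrK (r%:C *: (cone : A)) (T%:C *: cone)) -addrA.
  apply: cposD => //; rewrite -scalerBl -(rmorphB (real_complex R)) /=.
  by apply: cpos_cone; rewrite subr_ge0.
have : rnorm h <= T.
  apply: cpos_between => //; first exact: le_trans tT.
    by apply: up tT _; rewrite -(re_part_self_adjoint hE).
  by rewrite -[h]opprK; apply: up sT _; rewrite -(re_part_self_adjoint nhE).
by rewrite le_max leNgt t1/= leNgt s1.
Qed.

(** One of [h] and [- h] has a gauge at least the norm of [h]. Hahn-Banach is applied at that
    element, and domination by [top_gauge] makes the functional positive. *)
Lemma positive_functional_norming h : self_adjoint h ->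
  exists2 psi, positive_functional psi & rnorm h <= cmod (psi h).
Proof.
move=> hE.
have [h' hh' h'1] : exists2 h', rnorm h <= top_gauge h' & h' = h \/ h' = - h.
  have := rnorm_top_gauge hE; rewrite le_max => /orP[h1|h1].
    by exists h => //; left.
  by exists (- h) => //; right.
have [l [ll lp lh]] := hahn_banach_sublinear (h' : realification A)
  sublinear_top_gauge.
have lD a b : l ((a : A) + b) = l a + l b.
  by have := ll 1 (a : realification A) b; rewrite !scale1r.
have l0 : l (0 : A) = 0 by apply: (addrI (l 0)); rewrite -lD !addr0.
have lZ (t : R) a : l (t%:C *: a) = t * l a.
  by have := ll t a 0; rewrite l0 !addr0.
have lN a : l (- a) = - l a by apply: (addrI (l a)); rewrite -lD !subrr l0.
(* Such an [a] and its opposite both have gauge at most 0. Consequently [l] does not distinguish [a]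
   from [star a]. *)
have l_re0 a : re_part a = 0 -> l a = 0.
  have tg0 b : re_part b = 0 -> l b <= 0.
    move=> b0; rewrite (le_trans (lp _))//; apply: top_gauge_le => //.
    by rewrite b0 subr0; apply: cpos_cone.
  move=> a0; apply/eqP; rewrite eq_le tg0//= -oppr_le0 -lN tg0//.
  by rewrite -scaleN1r -(rmorphN1 (real_complex R)) re_partZ a0 scaler0.
have l_star a : l (star a) = l a.
  apply/eqP; rewrite -subr_eq0 -lN -lD; apply/eqP/l_re0.
  by rewrite /re_part starB starK subrKA subrr scaler0.
have l_le a : `|l a| <= rnorm a.
  rewrite ler_norml lerNl -lN -(rnormN a) (le_trans (lp _) (top_gauge_rnorm _))/=.
  by rewrite rnormN (le_trans (lp _) (top_gauge_rnorm _)).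
(* The standard complex-linear functional with real part [l]. *)
pose psi a : R[i] := l a +i* - l ('i *: a).
exists psi; first split.
- by move=> a b; rewrite /psi scalerDr !lD opprD.
- move=> [x y] a; rewrite /psi.
  have kE : x +i* y = x%:C + 'i * y%:C by rewrite [LHS]complex.complexE.
  have -> : l ((x +i* y) *: a) = x * l a + y * l ('i *: a).
    by rewrite kE scalerDl lD lZ (mulrC 'i) -scalerA lZ.
  have -> : l ('i *: ((x +i* y) *: a)) = x * l ('i *: a) - y * l a.
    rewrite scalerA kE mulrDr mulrA -expr2 complex.sqr_i mulN1r scalerDl lD.
    by rewrite scaleNr lN lZ (mulrC 'i) -scalerA lZ addrC.
  by apply/eqP; rewrite complex.eq_complex /=; apply/andP; split; apply/eqP; ring.
- move=> a; rewrite /psi l_star /=; congr (_ +i* _).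
  have -> : 'i *: star a = star (- 'i *: a).
    by rewrite star_conjZ; congr (_ *: _); simpc.
  by rewrite l_star scaleNr lN.
- move=> c; rewrite /psi complex.lecE /=; apply/andP; split.
    rewrite oppr_eq0; apply/eqP/l_re0.
    rewrite /re_part star_conjZ self_adjoint_star_mul.
    have -> : (conjc 'i : R[i]) = - 'i by simpc.
    by rewrite scaleNr subrr scaler0.
  rewrite -oppr_le0 -lN (le_trans (lp _))//; apply: top_gauge_le => //.
  rewrite scale0r sub0r -[X in re_part X]scaleN1r -(rmorphN1 (real_complex R)).
  rewrite re_partZ (rmorphN1 (real_complex R)) scaleN1r opprK.
  by rewrite (re_part_self_adjoint (self_adjoint_star_mul c)); exact: cpos_star_mul.
- move=> a; rewrite (le_trans (ler_cmod _))//= mulr_natl mulr2n normrN.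
  rewrite lerD ?l_le// (le_trans (l_le _))// rnormZ cmod_i mul1r//.
rewrite (le_trans hh')// -lh (le_trans _ (ler_Re _))//=.
by case: h'1 => ->; rewrite ?lN ?ler_norm// -normrN ler_norm.
Qed.

(** Norming functionals are available for self-adjoint elements; the factor 2 comes from a = Re a -
    i Re(i a), each real part being bounded by [k]. *)
Lemma rnorm_le_positive_functionals a (k : R) :
  (forall psi, positive_functional psi -> cmod (psi a) <= k) ->
  rnorm a <= 2 * k.
Proof.
move=> ak.
have re_le b : (forall psi, positive_functional psi -> cmod (psi b) <= k) ->
    rnorm (re_part b) <= k.
  move=> bk; have [psi pf hpsi] :=
    positive_functional_norming (self_adjoint_re_part b).
  rewrite (le_trans hpsi)// (le_trans _ (bk _ pf))//.
  rewrite /re_part (pfZ pf) (pfD pf) (pf_star pf) cmodM cmod_real ger0_norm.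
    have := ler_rnormD (psi b : R[i]^o) (conjc (psi b) : R[i]^o).
    by rewrite cmod_conj; lra.
  by lra.
have aE : 'i *: re_part ('i *: a) = (2^-1)%:C *: (star a - a).
  rewrite /re_part star_conjZ scalerA mulrC -scalerA; congr (_ *: _).
  rewrite scalerDr (scalerA _ _ a) (scalerA _ _ (star a)) -expr2 complex.sqr_i.
  have -> : 'i * conjc 'i = 1 :> R[i] by simpc.
  by rewrite scaleN1r scale1r addrC.
have -> : a = re_part a - 'i *: re_part ('i *: a).
  by rewrite aE -scalerBr opprB addrACA subrr addr0 scale_half.
rewrite (le_trans (ler_rnormB _ _))// (rnormZ 'i) cmod_i mul1r mulr_natl mulr2n.
apply: lerD; apply: re_le => // psi pf.
by rewrite (pfZ pf) cmodM cmod_i mul1r ak.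
Qed.

End PositiveFunctionals.

(** * Completion of pre-Hilbert spaces *)

(** Definiteness is left out: a Hilbert module inner product composed with a positive functional may
    have a kernel. *)
Record preinner (R : realType) (V : lmodType R[i]) := PreInner {
  pdot :> V -> V -> R[i];
  pdotDr : forall x y z, pdot x (y + z) = pdot x y + pdot x z;
  pdotZr : forall k x y, pdot x (k *: y) = k * pdot x y;
  pdot_conj : forall x y, pdot y x = conjc (pdot x y);
  pdot_ge0 : forall x, 0 <= pdot x x
}.

Section PreHilbert.
Context (R : realType) (V : lmodType R[i]) (S : preinner V).
Implicit Types (x y z : V) (k : R[i]).

Definition pnorm x : R := Num.sqrt (complex.Re (S x x)).

Lemma pdotE x : S x x = (complex.Re (S x x))%:C.
Proof. by rewrite complex.RRe_real// ger0_real// pdot_ge0. Qed.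

Lemma Re_pdot_ge0 x : 0 <= complex.Re (S x x).
Proof. by have := pdot_ge0 S x; rewrite pdotE complex.ler0c. Qed.

Lemma pnorm_ge0 x : 0 <= pnorm x. Proof. exact: sqrtr_ge0. Qed.

Lemma sqr_pnorm x : pnorm x ^+ 2 = complex.Re (S x x).
Proof. by rewrite sqr_sqrtr// Re_pdot_ge0. Qed.

Lemma pdot_sqr_pnorm x : S x x = (pnorm x ^+ 2)%:C.
Proof. by rewrite sqr_pnorm -pdotE. Qed.

Lemma pdotDl x y z : S (x + y) z = S x z + S y z.
Proof. by rewrite pdot_conj pdotDr rmorphD /= -!(pdot_conj S). Qed.

Lemma pdotZl k x y : S (k *: x) y = conjc k * S x y.
Proof. by rewrite pdot_conj pdotZr rmorphM /= -(pdot_conj S). Qed.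

Lemma pdot0r x : S x 0 = 0.
Proof. by have := pdotZr S 0 x 0; rewrite scale0r mul0r. Qed.

Lemma pdotNr x y : S x (- y) = - S x y.
Proof. by rewrite -scaleN1r pdotZr mulN1r. Qed.

Lemma pdotBr x y z : S x (y - z) = S x y - S x z.
Proof. by rewrite pdotDr pdotNr. Qed.

Lemma pdotNl x y : S (- x) y = - S x y.
Proof. by rewrite pdot_conj pdotNr rmorphN /= -(pdot_conj S). Qed.

Lemma pnormZ k x : pnorm (k *: x) = cmod k * pnorm x.
Proof.
apply: (@pexpIrn _ 2) => //; rewrite ?nnegrE ?pnorm_ge0 ?mulr_ge0 ?rnorm_ge0 ?pnorm_ge0//.
have E : (pnorm (k *: x) ^+ 2)%:C = (cmod k ^+ 2)%:C * (pnorm x ^+ 2)%:C.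
  by rewrite -!pdot_sqr_pnorm sqr_cmod pdotZl pdotZr mulrA (mulrC k).
by apply: (@complex.complexI R); rewrite exprMn E -(rmorphM (real_complex R)).
Qed.

Lemma pnorm0 : pnorm 0 = 0.
Proof. by rewrite -(scale0r 0) pnormZ rnorm0 mul0r. Qed.

(** The form is nonnegative at x - t conj(c) y for c = <x, y> and every real [t]. The optimal [t] is
    |y|^-2; as the form may be degenerate, |y| = 0 needs its own choice. *)
Lemma pdot_cauchy_schwarz x y : cmod (S x y) <= pnorm x * pnorm y.
Proof.
set c := S x y.
have conjE (t : R) (z : R[i]) : conjc (t%:C * conjc z) = t%:C * z.
  by case: z => a b; simpc.
have main (t : R) : 0 <= pnorm x ^+ 2 - (t * cmod c ^+ 2 + t * cmod c ^+ 2)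
    + t * t * cmod c ^+ 2 * pnorm y ^+ 2.
  rewrite -complex.ler0c.
  have := pdot_ge0 S (x - (t%:C * conjc c) *: y).
  rewrite pdotBr pdotDl pdotNl pdotZl pdotZr pdotDl pdotNl pdotZl conjE.
  rewrite !pdot_sqr_pnorm -/c (pdot_conj S x y) -/c.
  have := sqr_cmod c; move: (cmod c ^+ 2) (pnorm x ^+ 2) (pnorm y ^+ 2) => n a b nE.
  rewrite !(rmorphD (real_complex R)) !(rmorphN (real_complex R)) /=.
  rewrite !(rmorphD (real_complex R)) !(rmorphM (real_complex R)) /= nE.
  by congr (0 <= _); ring.
rewrite -(@ler_pXn2r _ 2)// ?nnegrE ?mulr_ge0 ?rnorm_ge0 ?pnorm_ge0// exprMn.
move: main; set n := cmod c ^+ 2; set a := pnorm x ^+ 2; set b := pnorm y ^+ 2.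
have n0 : 0 <= n by rewrite exprn_ge0 ?rnorm_ge0.
have a0 : 0 <= a by rewrite exprn_ge0 ?pnorm_ge0.
have : 0 <= b by rewrite exprn_ge0 ?pnorm_ge0.
rewrite le_eqVlt => /orP[/eqP <-|b0] h.
  rewrite mulr0 leNgt; apply/negP => n1.
  (* For |y| = 0 the inequality is 0 <= a - 2 t n, which this [t] violates. *)
  have := h ((a + 1) / n); rewrite mulr0 addr0 divfK ?gt_eqF//.
  by move: a0; lra.
have := h b^-1.
have -> : a - (b^-1 * n + b^-1 * n) + b^-1 * b^-1 * n * b = a - n / b.
  by field; rewrite gt_eqF.
by rewrite subr_ge0 ler_pdivrMr.
Qed.

(* The completion is the closure of the image of V in the space of bounded
   conjugate-linear functionals on V, so that no quotient is needed. *)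
Definition in_completion (F : V -> R[i]^o) : Prop := forall e : R, 0 < e ->
  exists x, forall y, cmod (F y - S y x) <= e * pnorm y.

Definition completion_pred : {pred V -> R[i]^o} := fun F => `[< in_completion F >].

Definition emb_fun x : V -> R[i]^o := fun y => S y x.

Lemma in_completion_emb x : emb_fun x \in completion_pred.
Proof.
apply/asboolP => e e0; exists x => y.
by rewrite subrr rnorm0 mulr_ge0 ?(ltW e0) ?pnorm_ge0.
Qed.

Lemma completion_submod_closed : submod_closed completion_pred.
Proof.
split=> [|k F G /asboolP Fc /asboolP Gc].
  by apply/asboolP => e e0; exists 0 => y; rewrite pdot0r subrr rnorm0
    mulr_ge0 ?(ltW e0) ?pnorm_ge0.
apply/asboolP => e e0.
have k0 : 0 < cmod k + 1 by rewrite ltr_wpDl ?rnorm_ge0.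
have [x hx] := Fc (e / 2 / (cmod k + 1)) (divr_gt0 (divr_gt0 e0 (ltr0Sn _ _)) k0).
have [z hz] := Gc (e / 2) (divr_gt0 e0 (ltr0Sn _ _)).
exists (k *: x + z) => y.
have -> : (k *: F + G) y - S y (k *: x + z) = k * (F y - S y x) + (G y - S y z).
  transitivity (k * F y + G y - S y (k *: x + z)) => //.
  by rewrite pdotDr pdotZr; ring.
rewrite (le_trans (ler_rnormD (V := R[i]^o) _ _))// cmodM (splitr e) mulrDl.
rewrite lerD//; apply: le_trans (ler_wpM2l (rnorm_ge0 _) (hx y)) _.
rewrite mulrA ler_wpM2r ?pnorm_ge0// mulrCA ler_piMr//.
  by rewrite divr_ge0 ?(ltW e0).
by rewrite ler_pdivrMr// mul1r lerDl.
Qed.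

HB.instance Definition _ := GRing.isSubmodClosed.Build _ _ completion_pred
  completion_submod_closed.

Record completion : predArgType := Completion {
  functional :> V -> R[i]^o;
  functionalP : functional \in completion_pred
}.

HB.instance Definition _ := [isSub of completion for functional].
HB.instance Definition _ := [Choice of completion by <:].
HB.instance Definition _ := [SubChoice_isSubLmodule of completion by <:].

Definition emb x : completion := Completion (in_completion_emb x).

Implicit Types F G : completion.

Lemma functionalD F G y : (F + G) y = F y + G y. Proof. by []. Qed.
Lemma functionalZ k F y : (k *: F) y = k * F y. Proof. by []. Qed.
Lemma functionalB F G y : (F - G) y = F y - G y. Proof. by []. Qed.
Lemma embE x y : emb x y = S y x. Proof. by []. Qed.

Lemma completionP F G : F =1 G -> F = G.
Proof. by move=> FG; apply: val_inj; apply: funext. Qed.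

Lemma embD x y : emb (x + y) = emb x + emb y.
Proof. by apply: completionP => z; rewrite functionalD !embE pdotDr. Qed.

Lemma embZ k x : emb (k *: x) = k *: emb x.
Proof. by apply: completionP => z; rewrite functionalZ !embE pdotZr. Qed.

Lemma embB x y : emb (x - y) = emb x - emb y.
Proof. by rewrite embD -scaleN1r embZ scaleN1r. Qed.

Lemma functional_approx F (e : R) : 0 < e ->
  exists x, forall y, cmod (F y - S y x) <= e * pnorm y.
Proof. by move=> e0; have /asboolP/(_ e e0) := functionalP F. Qed.

(** Conjugate-linearity is not imposed by [in_completion]: it is inherited from the approximants S y
    x, the error being made smaller than [e] by the choice of [c]. *)
Lemma functional_conjZ F k y : F (k *: y) = conjc k * F y.
Proof.
apply: (@rnorm_eq _ (R[i]^o)) => e e0.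
set c := 2 * cmod k * pnorm y + 1.
have c0 : 0 < c by rewrite ltr_wpDl// !mulr_ge0 ?rnorm_ge0 ?pnorm_ge0.
have [x hx] := functional_approx F (divr_gt0 e0 c0).
have -> : F (k *: y) - conjc k * F y =
    (F (k *: y) - S (k *: y) x) - conjc k * (F y - S y x).
  by rewrite pdotZl; ring.
rewrite (le_trans (ler_rnormB (V := R[i]^o) _ _))// cmodM cmod_conj.
have h1 := hx (k *: y); have h2 := ler_wpM2l (rnorm_ge0 (k : R[i]^o)) (hx y).
rewrite (le_trans (lerD h1 h2))// pnormZ.
have -> : e / c * (cmod k * pnorm y) + cmod k * (e / c * pnorm y) =
  (e / c) * (2 * cmod k * pnorm y) by ring.
rewrite mulrAC ler_pdivrMr// ler_wpM2l ?(ltW e0)//.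
by rewrite /c lerDl.
Qed.

Lemma functional_addr F y z : F (y + z) = F y + F z.
Proof.
apply: (@rnorm_eq _ (R[i]^o)) => e e0.
set c := pnorm (y + z) + pnorm y + pnorm z + 1.
have c0 : 0 < c by rewrite ltr_wpDl// !addr_ge0 ?pnorm_ge0.
have [x hx] := functional_approx F (divr_gt0 e0 c0).
have -> : F (y + z) - (F y + F z) =
    (F (y + z) - S (y + z) x) - (F y - S y x) - (F z - S z x).
  by rewrite pdotDl; ring.
rewrite (le_trans (ler_rnormB (V := R[i]^o) _ _))//.
have h1 := le_trans (ler_rnormB (V := R[i]^o) _ _) (lerD (hx (y + z)) (hx y)).
rewrite (le_trans (lerD h1 (hx z)))// -!mulrDr mulrAC ler_pdivrMr//.
by rewrite ler_wpM2l ?(ltW e0)// /c lerDl.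
Qed.

Definition cnorm F : R := sup [set cmod (F y) | y in [set y | pnorm y <= 1]].

Lemma cnorm_has_sup F : has_sup [set cmod (F y) | y in [set y | pnorm y <= 1]].
Proof.
split; first by exists (cmod (F 0)), 0 => //=; rewrite pnorm0.
have [x hx] := functional_approx F ltr01.
exists (1 + pnorm x) => _ [y /= y1 <-].
rewrite -(subrK (S y x) (F y)) (le_trans (ler_rnormD (V := R[i]^o) _ _))//.
rewrite lerD// ?(le_trans (hx y))// ?mul1r//.
rewrite (le_trans (pdot_cauchy_schwarz _ _))//.
by rewrite ler_piMl ?pnorm_ge0.
Qed.

Lemma cnorm_ge0 F : 0 <= cnorm F.
Proof.
apply: le_trans (rnorm_ge0 (F 0 : R[i]^o)) _.
apply: ub_le_sup; first by have [] := cnorm_has_sup F.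
by exists 0 => //=; rewrite pnorm0.
Qed.

Lemma functional_bound F y : cmod (F y) <= cnorm F * pnorm y.
Proof.
have bnd z : pnorm z <= 1 -> cmod (F z) <= cnorm F.
  move=> z1; apply: ub_le_sup; first by have [] := cnorm_has_sup F.
  by exists z.
have scal (t : R) : 0 < t -> cmod (F (t%:C *: y)) = t * cmod (F y).
  by move=> t0; rewrite functional_conjZ cmodM cmod_conj cmod_real gtr0_norm.
have := pnorm_ge0 y; rewrite le_eqVlt => /orP[/eqP y0|y0]; last first.
  have yi : 0 < (pnorm y)^-1 by rewrite invr_gt0.
  have := bnd ((pnorm y)^-1%:C *: y).
  rewrite pnormZ cmod_real gtr0_norm// mulVf ?gt_eqF// => /(_ (lexx _)).
  by rewrite scal// mulrC ler_pdivrMr.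
(* If |y| = 0, all multiples of [y] lie in the unit ball, so a nonzero value at [y] would make [F]
   unbounded there. *)
rewrite -y0 mulr0 leNgt; apply/negP => Fy.
have t0 : 0 < (cnorm F + 1) / cmod (F y).
  by rewrite divr_gt0// ltr_wpDl ?cnorm_ge0.
have := bnd (((cnorm F + 1) / cmod (F y))%:C *: y).
rewrite pnormZ -y0 mulr0 ler01 => /(_ isT); rewrite scal// divfK ?gt_eqF//.
by rewrite gerDl leNgt ltr01.
Qed.

Lemma cnorm_le F (c : R) : 0 <= c -> (forall y, cmod (F y) <= c * pnorm y) ->
  cnorm F <= c.
Proof.
move=> c0 Fc; apply: ge_sup; first by have [] := cnorm_has_sup F.
by move=> _ [y /= y1 <-]; rewrite (le_trans (Fc y))// ler_piMr.
Qed.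

Lemma cnorm_emb x : cnorm (emb x) = pnorm x.
Proof.
apply/eqP; rewrite eq_le; apply/andP; split.
  apply: cnorm_le (pnorm_ge0 _) _ => y.
  by rewrite embE mulrC pdot_cauchy_schwarz.
have := functional_bound (emb x) x; rewrite embE pdot_sqr_pnorm cmod_real.
rewrite ger0_norm ?exprn_ge0 ?pnorm_ge0//.
have [<-|x0] := eqVneq 0 (pnorm x); first by rewrite cnorm_ge0.
have {}x0 : 0 < pnorm x by rewrite lt_def eq_sym x0 pnorm_ge0.
by rewrite expr2 ler_pM2r.
Qed.

Lemma ler_cnormD F G : (cnorm (F + G))%:C <= (cnorm F)%:C + (cnorm G)%:C.
Proof.
rewrite -(rmorphD (real_complex R)) complex.lecR.
apply: cnorm_le; first by rewrite addr_ge0 ?cnorm_ge0.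
move=> y; rewrite functionalD mulrDl.
by rewrite (le_trans (ler_rnormD (V := R[i]^o) _ _))// lerD// functional_bound.
Qed.

Lemma cnormZ k F : (cnorm (k *: F))%:C = `|k| * (cnorm F)%:C.
Proof.
have le_cnormZ l G : cnorm (l *: G) <= cmod l * cnorm G.
  apply: cnorm_le; first by rewrite mulr_ge0 ?cnorm_ge0 ?rnorm_ge0.
  move=> y; rewrite functionalZ cmodM -mulrA ler_wpM2l ?rnorm_ge0//.
  exact: functional_bound.
rewrite norm_cmod -(rmorphM (real_complex R)) /=; congr (_%:C).
apply/eqP; rewrite eq_le le_cnormZ/=.
have [->|k0] := eqVneq k 0; first by rewrite rnorm0 mul0r cnorm_ge0.
have := le_cnormZ k^-1 (k *: F); rewrite scalerA mulVf// scale1r.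
have : cmod k^-1 * cmod k = 1.
  by rewrite -cmodM mulVf// (cmod_real 1) normr1.
have : 0 <= cmod k by exact: rnorm_ge0.
have := cnorm_ge0 (k *: F); have := cnorm_ge0 F.
set a := cmod k^-1; set b := cmod k; set f := cnorm F; set g := cnorm _ => f0 g0 b0 ab h.
have := ler_wpM2l b0 h; rewrite mulrA (mulrC b a) ab mul1r//.
Qed.

Lemma cnorm0_eq0 F : (cnorm F)%:C = 0 -> F = 0.
Proof.
move=> /(@complex.complexI R) F0; apply: completionP => y.
apply: (@rnorm0_eq0 _ (R[i]^o)); apply/eqP; rewrite eq_le rnorm_ge0 andbT.
by have := functional_bound F y; rewrite F0 mul0r.
Qed.

HB.instance Definition _ := Lmodule_isNormed.Build R[i] completion
  ler_cnormD cnormZ cnorm0_eq0.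

Lemma rnorm_cnorm F : rnorm F = cnorm F. Proof. by []. Qed.

(** The pointwise limit is uniform relative to [pnorm], so approximants of a late [u N] also
    approximate the limit, which stays in the completion. *)
Lemma completion_cauchy_cvg (u : nat -> completion) :
  (forall e : R, 0 < e -> exists N, forall n m, (N <= n)%N -> (N <= m)%N ->
    rnorm (u n - u m) < e) ->
  exists l : completion, u @ \oo --> l.
Proof.
move=> uC.
have uCy e y : 0 < e -> exists N, forall n m, (N <= n)%N -> (N <= m)%N ->
    cmod (u n y - u m y) <= e * pnorm y.
  move=> /uC[N hN]; exists N => n m Nn Nm.
  rewrite -functionalB (le_trans (functional_bound _ _))//.
  by rewrite ler_wpM2r ?pnorm_ge0// ltW// hN.
have /choice[F FP] : forall y, exists l : R[i], forall e : R, 0 < e ->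
    exists N, forall n, (N <= n)%N -> cmod (u n y - l) < e.
  move=> y; apply: cauchy_seq_cvg_complex => e e0.
  have y1 : 0 < pnorm y + 1 by rewrite ltr_wpDl ?pnorm_ge0.
  have [N hN] := uCy _ y (divr_gt0 e0 y1); exists N => n m Nn Nm.
  rewrite (le_lt_trans (hN _ _ Nn Nm))// mulrAC ltr_pdivrMr//.
  by rewrite ltr_pM2l// ltrDl.
have uF e : 0 < e -> exists N, forall n, (N <= n)%N ->
    forall y, cmod (u n y - F y) <= e * pnorm y.
  move=> /uC[N hN]; exists N => n Nn y; apply/ler_addgt0Pr => d d0.
  have [M hM] := FP y _ d0.
  rewrite (le_trans (@ler_rdistD _ (R[i]^o) (u (maxn N M) y) _ _))//.
  rewrite lerD//; last by rewrite ltW// hM// leq_maxr.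
  rewrite -functionalB (le_trans (functional_bound _ _))//.
  by rewrite ler_wpM2r ?pnorm_ge0// ltW// hN// leq_maxl.
have FC : (F : V -> R[i]^o) \in completion_pred.
  apply/asboolP => e e0; have e2 := divr_gt0 e0 (ltr0Sn R 1).
  have [N hN] := uF _ e2; have [x hx] := functional_approx (u N) e2.
  exists x => y.
  rewrite (le_trans (@ler_rdistD _ (R[i]^o) (u N y) _ _))// (splitr e) mulrDl.
  by rewrite lerD// (rdistC (V := R[i]^o)) hN.
exists (Completion FC); apply/cvg_rnormP => e e0.
have e2 := divr_gt0 e0 (ltr0Sn R 1).
have [N hN] := uF _ e2; exists N => // n Nn /=.
have eh : e / 2 < e by move: e0; lra.
apply: le_lt_trans eh; apply: cnorm_le (ltW e2) _ => y; exact: hN.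
Qed.

HB.instance Definition _ := Uniform_isComplete.Build completion
  (seq_complete completion_cauchy_cvg).

Lemma emb_dense F (e : R) : 0 < e -> exists x, rnorm (F - emb x) <= e.
Proof.
move=> e0; have [x hx] := functional_approx F e0; exists x.
by apply: cnorm_le (ltW e0) _.
Qed.

Lemma emb_approx F : exists u : nat -> V, (fun n => emb (u n)) @ \oo --> F.
Proof.
have /choice[u uP] : forall n, exists x, rnorm (F - emb x) <= n.+1%:R^-1.
  by move=> n; apply: emb_dense; rewrite invr_gt0.
exists u; apply/cvg_rnormP => e e0.
exists (Num.bound e^-1) => // n /= Nn; rewrite rdistC (le_lt_trans (uP n))//.
rewrite -[ltRHS]invrK ltf_pV2 ?posrE ?invr_gt0//.
rewrite (lt_le_trans (archi_boundP _)) ?invr_ge0 ?(ltW e0)// ler_nat.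
exact: leq_trans Nn _.
Qed.

(** Polarisation, with the sign before 'i that gives linearity in the second variable. Continuity is
    then that of the norm, and the algebraic laws extend from the dense image of [emb]. *)
Definition cdot F G : R[i]^o :=
  4%:R^-1 * (`|F + G| ^+ 2 - `|F - G| ^+ 2
             - 'i * (`|F + 'i *: G| ^+ 2 - `|F - 'i *: G| ^+ 2)).

Lemma cdot_emb x y : cdot (emb x) (emb y) = S x y.
Proof.
have nE z : `|emb z| ^+ 2 = S z z.
  by rewrite norm_rnorm rnorm_cnorm cnorm_emb -(rmorphXn (real_complex R)) pdot_sqr_pnorm.
rewrite /cdot -!embZ -!embB -!embD !nE.
rewrite !(pdotBr, pdotDr, pdotDl, pdotNl, pdotZl, pdotZr).
have -> : (conjc 'i : R[i]) = - 'i by simpc.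
have i2 : 'i * 'i = -1 :> R[i] by rewrite -expr2 complex.sqr_i.
set a := S x x; set b := S x y; set c := S y x; set d := S y y.
transitivity (4%:R^-1 * (2%:R * (b + c) - 2%:R * ('i * 'i) * (b - c))); first by ring.
by rewrite i2; field.
Qed.

Lemma cvg_cdot T (f : set_system T) {Ff : ProperFilter f} (u v : T -> completion) F G :
  u @ f --> F -> v @ f --> G -> (fun i => cdot (u i) (v i)) @ f --> cdot F G.
Proof.
move=> uF vG.
have iv : (fun i => 'i *: v i) @ f --> 'i *: G by exact: cvgZr.
apply: cvgM; first exact: cvg_cst.
apply: cvgB; last apply: cvgM; first apply: cvgB; first last.
- by apply: cvgB; apply: cvgM; apply: cvg_norm; first [exact: cvgD|exact: cvgB].
- exact: cvg_cst.
- by apply: cvgM; apply: cvg_norm; exact: cvgB.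
- by apply: cvgM; apply: cvg_norm; exact: cvgD.
Qed.

Lemma cdotDr F G K : cdot F (G + K) = cdot F G + cdot F K.
Proof.
have [u uF] := emb_approx F; have [v vG] := emb_approx G.
have [w wK] := emb_approx K.
have h1 : (fun n => cdot (emb (u n)) (emb (v n) + emb (w n))) @ \oo -->
    cdot F (G + K).
  by apply: cvg_cdot => //; exact: cvgD.
have h2 : (fun n => cdot (emb (u n)) (emb (v n)) + cdot (emb (u n)) (emb (w n)))
    @ \oo --> cdot F G + cdot F K.
  by apply: cvgD; exact: cvg_cdot.
suff E : (fun n => cdot (emb (u n)) (emb (v n) + emb (w n))) =
   (fun n => cdot (emb (u n)) (emb (v n)) + cdot (emb (u n)) (emb (w n))).
  by rewrite E in h1; exact: cvg_unique h1 h2.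
by apply/funext => n; rewrite -embD !cdot_emb pdotDr.
Qed.

Lemma cdotZr k F G : cdot F (k *: G) = k * cdot F G.
Proof.
have [u uF] := emb_approx F; have [v vG] := emb_approx G.
have h1 : (fun n => cdot (emb (u n)) (k *: emb (v n))) @ \oo --> cdot F (k *: G).
  by apply: cvg_cdot => //; exact: cvgZr.
have h2 : (fun n => k *: cdot (emb (u n)) (emb (v n))) @ \oo --> k *: cdot F G.
  by apply: cvgZr; exact: cvg_cdot.
suff E : (fun n => cdot (emb (u n)) (k *: emb (v n))) =
    (fun n => k *: cdot (emb (u n)) (emb (v n))).
  by rewrite E in h1; exact: cvg_unique h1 h2.
by apply/funext => n; rewrite -embZ !cdot_emb pdotZr.
Qed.

Lemma cdot_conj F G : cdot G F = conjc (cdot F G).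
Proof.
have [u uF] := emb_approx F; have [v vG] := emb_approx G.
have h1 : (fun n => cdot (emb (v n)) (emb (u n))) @ \oo --> cdot G F.
  exact: cvg_cdot.
have h2 : (fun n => cdot (emb (u n)) (emb (v n))) @ \oo --> cdot F G.
  exact: cvg_cdot.
have h3 : (fun n => conjc (cdot (emb (u n)) (emb (v n))) : R[i]^o) @ \oo -->
    (conjc (cdot F G) : R[i]^o).
  apply/cvg_rnormP => e e0; have h4 := (@cvg_rnormP _ _ _ _ (eventually_filter) _ _).1 h2 _ e0.
  by apply: filterS h4 => n; rewrite -rmorphB cmod_conj.
suff E : (fun n => cdot (emb (v n)) (emb (u n))) =
    (fun n => conjc (cdot (emb (u n)) (emb (v n)))).
  by rewrite E in h1; exact: cvg_unique h1 h3.
by apply/funext => n; rewrite !cdot_emb (pdot_conj S).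
Qed.

Lemma cdot_norm F : cdot F F = `|F| ^+ 2.
Proof.
have iE : 'i *: (F - 'i *: F) = F + 'i *: F.
  by rewrite scalerBr scalerA -expr2 complex.sqr_i scaleN1r opprK addrC.
rewrite /cdot; have -> : `|F + 'i *: F| = `|F - 'i *: F|.
  by rewrite -iE normrZ norm_cmod cmod_i mul1r.
rewrite !subrr normr0 mulr0 subr0 expr0n subr0 /=.
have -> : `|F + F| = `|F| *+ 2 by rewrite -[F + F]mulr2n normrMn.
by set w := (X in X *+ 2); rewrite -[w *+ 2]mulr_natr; field.
Qed.

HB.instance Definition _ := isHilbert.Build R completion
  cdotDr cdotZr cdot_conj cdot_norm.

Lemma dot_emb x y : dot (emb x) (emb y) = S x y.
Proof. exact: cdot_emb. Qed.

End PreHilbert.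

Section HilbertFacts.
Context (R : realType) (H : hilbertType R).
Implicit Types (x y : H).

Lemma dot_ge0 x : 0 <= dot x x.
Proof. by rewrite dot_norm exprn_ge0. Qed.

Definition hilbert_preinner := PreInner (@dotDr R H) (@dotZr R H) (@dot_conj R H) dot_ge0.

Lemma dot_cauchy_schwarz x y : cmod (dot x y) <= rnorm x * rnorm y.
Proof.
have nE z : pnorm hilbert_preinner z = rnorm z.
  apply: (@pexpIrn _ 2) => //; rewrite ?nnegrE ?pnorm_ge0 ?rnorm_ge0//.
  apply: (@complex.complexI R); rewrite -pdot_sqr_pnorm /= dot_norm norm_rnorm.
  by rewrite (rmorphXn (real_complex R)).
by have := pdot_cauchy_schwarz hilbert_preinner x y; rewrite !nE.
Qed.

End HilbertFacts.

(** * Finitely supported functions and Reiter's condition *)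

Section FiniteSupport.
Context (I : choiceType).

Definition fin_supp (V : zmodType) (f : I -> V) : Prop :=
  finite_set [set i | f i != 0].

Lemma fin_supp_fset (V : zmodType) (f : I -> V) : fin_supp f ->
  exists X : {fset I}, forall i, i \notin X -> f i = 0.
Proof.
move=> /finite_fsetP[X XE]; exists X => i; apply: contraNeq => fi.
by have : [set` X] i by rewrite -XE.
Qed.

Lemma fin_supp_sub (V : zmodType) (f : I -> V) (X : {fset I}) :
  (forall i, i \notin X -> f i = 0) -> fin_supp f.
Proof.
move=> fX; apply: (@sub_finite_set _ _ [set` X]); last exact: finite_fset.
by move=> i /= fi; apply: contraT => /fX fi0; rewrite fi0 eqxx in fi.
Qed.

Lemma fin_supp_le (V W : zmodType) (f : I -> V) (g : I -> W) :
  fin_supp f -> (forall i, f i = 0 -> g i = 0) -> fin_supp g.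
Proof.
by move=> /fin_supp_fset[X fX] fg; apply: (@fin_supp_sub _ _ X) => i /fX/fg.
Qed.

Lemma fin_suppD (V : zmodType) (f g : I -> V) : fin_supp f -> fin_supp g ->
  fin_supp (fun i => f i + g i).
Proof.
move=> /fin_supp_fset[X fX] /fin_supp_fset[Y gY].
apply: (@fin_supp_sub _ _ (X `|` Y)%fset) => i.
by rewrite inE negb_or => /andP[/fX -> /gY ->]; rewrite addr0.
Qed.

Lemma fsumD (V : zmodType) (f g : I -> V) : fin_supp f -> fin_supp g ->
  \sum_(i \in [set: I]) (f i + g i) =
  \sum_(i \in [set: I]) f i + \sum_(i \in [set: I]) g i.
Proof.
move=> /fin_supp_fset[X fX] /fin_supp_fset[Y gY].
pose Z := (X `|` Y)%fset.
have fZ i : i \notin Z -> f i = 0 by rewrite inE negb_or => /andP[/fX].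
have gZ i : i \notin Z -> g i = 0 by rewrite inE negb_or => /andP[_ /gY].
rewrite (fsbigTE Z)/=; last by move=> i iZ; rewrite fZ// gZ// addr0.
by rewrite (fsbigTE Z f fZ) (fsbigTE Z g gZ) big_split.
Qed.

Lemma fsum_morph (V W : zmodType) (h : V -> W) (f : I -> V) : fin_supp f ->
  h 0 = 0 -> {morph h : x y / x + y} ->
  h (\sum_(i \in [set: I]) f i) = \sum_(i \in [set: I]) h (f i).
Proof.
move=> /fin_supp_fset[X fX] h0 hD.
rewrite (fsbigTE X f fX) (fsbigTE X)/=; last by move=> i /fX ->.
by rewrite (big_morph h hD h0).
Qed.

Lemma fsum_single (V : zmodType) (f : I -> V) j :
  (forall i, i != j -> f i = 0) -> \sum_(i \in [set: I]) f i = f j.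
Proof.
move=> fj; rewrite (fsbigTE [fset j]%fset)/= ?big_seq_fset1// => i.
by rewrite inE => /fj.
Qed.

Lemma ler_fsum (R : numDomainType) (f g : I -> R) : fin_supp f -> fin_supp g ->
  (forall i, f i <= g i) ->
  \sum_(i \in [set: I]) f i <= \sum_(i \in [set: I]) g i.
Proof.
move=> ff gg fg.
have -> : g = (fun i => (g i - f i) + f i) by apply/funext => i; rewrite subrK.
rewrite fsumD//; last first.
  by apply: fin_suppD => //; apply: fin_supp_le ff _ => i ->; rewrite oppr0.
by rewrite lerDr fsumr_ge0// => i _; rewrite subr_ge0.
Qed.

Section FinSuppFun.
Context (K : pzRingType) (V : lmodType K).

Definition ccfun_pred : {pred I -> V} := fun f => `[< fin_supp f >].

Lemma ccfun_submod_closed : submod_closed ccfun_pred.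
Proof.
split=> [|k f g /asboolP ff /asboolP gg]; apply/asboolP.
  by apply: (@fin_supp_sub _ _ fset0).
have : fin_supp (fun i => k *: f i).
  by apply: fin_supp_le ff _ => i ->; rewrite scaler0.
by move=> /fin_suppD/(_ gg).
Qed.

HB.instance Definition _ := GRing.isSubmodClosed.Build _ _ ccfun_pred
  ccfun_submod_closed.

(** Used with [V] the real line for densities on a group, and with [V] pre-Hilbert for the algebraic
    tensor product of c_c(G) and [V]. *)
Record ccfun : predArgType := CcFun {
  ccfun_val :> I -> V;
  ccfun_valP : ccfun_val \in ccfun_pred
}.

HB.instance Definition _ := [isSub of ccfun for ccfun_val].
HB.instance Definition _ := [Choice of ccfun by <:].
HB.instance Definition _ := [SubChoice_isSubLmodule of ccfun by <:].

Definition mk_ccfun (f : I -> V) (ff : fin_supp f) : ccfun :=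
  CcFun (asboolT ff : f \in ccfun_pred).

Lemma ccfun_fin_supp (f : ccfun) : fin_supp f.
Proof. exact/asboolP/(ccfun_valP f). Qed.

Lemma ccfunP (f g : ccfun) : f =1 g -> f = g.
Proof. by move=> fg; apply: val_inj; apply: funext. Qed.

Lemma ccfunD (f g : ccfun) i : (f + g) i = f i + g i. Proof. by []. Qed.
Lemma ccfunZ k (f : ccfun) i : (k *: f) i = k *: f i. Proof. by []. Qed.
Lemma ccfunN (f : ccfun) i : (- f) i = - f i. Proof. by []. Qed.
Lemma ccfun0 i : (0 : ccfun) i = 0. Proof. by []. Qed.

End FinSuppFun.
End FiniteSupport.

(** * From an invariant mean to almost invariant unit vectors *)

Section Reiter.
Context (R : realType) (G : groupType).
Local Notation F := (ccfun G R^o).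
Implicit Types (f g : F).

Definition mass g : R := \sum_(t \in [set: G]) g t.
Definition l1 g : R := \sum_(t \in [set: G]) `|g t|.

Lemma fin_supp_norm g : fin_supp (fun t => `|g t|).
Proof. by apply: fin_supp_le (ccfun_fin_supp g) _ => i ->; rewrite normr0. Qed.

Lemma massD f g : mass (f + g) = mass f + mass g.
Proof. by apply: fsumD; exact: ccfun_fin_supp. Qed.

Lemma massZ (k : R) g : mass (k *: g) = k * mass g.
Proof. by rewrite /mass mulr_fsumr. Qed.

Lemma ler_l1D f g : l1 (f + g) <= l1 f + l1 g.
Proof.
rewrite -fsumD; [|exact: fin_supp_norm|exact: fin_supp_norm].
apply: ler_fsum; first exact: fin_supp_norm.
  by apply: fin_suppD; exact: fin_supp_norm.
by move=> t; rewrite ccfunD ler_normD.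
Qed.

Lemma l1Z (k : R) g : l1 (k *: g) = `|k| * l1 g.
Proof. by rewrite /l1 mulr_fsumr; apply: eq_fsbigr => t _; rewrite ccfunZ normrM. Qed.

Lemma l10 : l1 0 = 0.
Proof. by rewrite -(scale0r 0) l1Z normr0 mul0r. Qed.

Lemma l1_ge0 g : 0 <= l1 g.
Proof. by apply: fsumr_ge0. Qed.

Lemma fin_supp_delta (t : G) : fin_supp (fun u => (u == t)%:R : R^o).
Proof.
by apply: (@fin_supp_sub _ _ _ [fset t]%fset) => u; rewrite inE => /negPf ->.
Qed.

Definition fdelta t : F := mk_ccfun (fin_supp_delta t).

Lemma l1_delta t : l1 (fdelta t) = 1.
Proof.
by rewrite /l1 (@fsum_single _ _ _ t) /= ?eqxx ?normr1// => i /negPf ->; rewrite normr0.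
Qed.

Lemma mass_delta t : mass (fdelta t) = 1.
Proof.
by rewrite /mass (@fsum_single _ _ _ t) /= ?eqxx// => i /negPf ->.
Qed.

Lemma fin_supp_translate (V : zmodType) (s : G) (g : G -> V) : fin_supp g ->
  fin_supp (fun t => g (s^-1 * t)%g).
Proof.
move=> /fin_supp_fset[X gX].
apply: (@fin_supp_sub _ _ _ [fset (s * t)%g | t in X]%fset) => t tX.
apply: gX; apply: contra tX => tX; apply/imfsetP; exists (s^-1 * t)%g => //.
by rewrite mulVKg.
Qed.

Definition translate s g : F := mk_ccfun (fin_supp_translate s (ccfun_fin_supp g)).

Lemma translateE s g t : translate s g t = g (s^-1 * t)%g. Proof. by []. Qed.

Lemma bounded_setT (h : G -> R) (c : R) : (forall t, `|h t| <= c) ->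
  [bounded h t | t in [set: G]].
Proof.
move=> hc; exists c; split; first exact: num_real.
by move=> x cx t _ /=; rewrite (le_trans (hc t))// ltW.
Qed.

Section Drift.
Context (n : nat) (s : 'I_n -> G).
Local Notation W := {ffun 'I_n -> F}.

Definition drift g : W := [ffun i => translate (s i) g - g].

Definition l1s (v : W) : R := \sum_(i < n) l1 (v i).

Lemma driftD f g : drift (f + g) = drift f + drift g.
Proof.
apply/ffunP => i; rewrite !ffunE; apply: ccfunP => t.
by rewrite !(ccfunD, ccfunN, translateE) opprD addrACA.
Qed.

Lemma driftZ (k : R) g : drift (k *: g) = k *: drift g.
Proof.
apply/ffunP => i; rewrite !ffunE; apply: ccfunP => t.
by rewrite !(ccfunZ, ccfunD, ccfunN, translateE) scalerBr.
Qed.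

Lemma ler_l1sD (v w : W) : l1s (v + w) <= l1s v + l1s w.
Proof.
by rewrite -big_split /=; apply: ler_sum => i _; rewrite ffunE ler_l1D.
Qed.

Lemma l1sZ (k : R) (v : W) : l1s (k *: v) = `|k| * l1s v.
Proof.
by rewrite mulr_sumr; apply: eq_bigr => i _; rewrite ffunE l1Z.
Qed.

Lemma l1s0 : l1s 0 = 0.
Proof. by rewrite -(scale0r 0) l1sZ normr0 mul0r. Qed.

Lemma l1sN (v : W) : l1s (- v) = l1s v.
Proof. by rewrite -scaleN1r l1sZ normrN1 mul1r. Qed.

Definition unit_at (i : 'I_n) (f : F) : W := [ffun j => if j == i then f else 0].

Lemma unit_atD i f g : unit_at i (f + g) = unit_at i f + unit_at i g.
Proof. by apply/ffunP => j; rewrite !ffunE; case: eqP; rewrite ?addr0. Qed.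

Lemma unit_atN i f : unit_at i (- f) = - unit_at i f.
Proof. by apply/ffunP => j; rewrite !ffunE; case: eqP; rewrite ?oppr0. Qed.

Lemma sum_unit_at (v : W) : v = \sum_(i < n) unit_at i (v i).
Proof.
apply/ffunP => j; rewrite sum_ffunE (bigD1 j)//= big1 ?addr0 ?ffunE ?eqxx//.
by move=> i ij; rewrite ffunE eq_sym (negPf ij).
Qed.

Lemma l1s_unit_at i f : l1s (unit_at i f) = l1 f.
Proof.
rewrite /l1s (bigD1 i)//= big1 ?addr0 ?ffunE ?eqxx//.
by move=> j ij; rewrite ffunE (negPf ij) l10.
Qed.

(* If no finitely supported density moved little under all s i, Hahn-Banach
   would separate the drifts from 0 by a bounded functional, whose values at
   point masses contradict the invariant mean. *)
Lemma reiter_drift (e : R) : amenable R G -> 0 < e ->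
  exists g : F, [/\ forall t, 0 <= g t, mass g = 1 & l1s (drift g) < e].
Proof.
move=> [m [mL m_ge0 m1 minv]] e0; apply: contrapT => noh.
have lb g : (forall t, 0 <= g t) -> e * mass g <= l1s (drift g).
  move=> g0; have : 0 <= mass g by apply: fsumr_ge0.
  rewrite le_eqVlt => /orP[/eqP <-|mg].
    by rewrite mulr0; apply: sumr_ge0 => i _; exact: l1_ge0.
  rewrite leNgt; apply/negP => h; apply: noh; exists ((mass g)^-1 *: g); split.
  - by move=> t; rewrite ccfunZ mulr_ge0// invr_ge0 ltW.
  - by rewrite massZ mulVf// gt_eqF.
  - by rewrite driftZ l1sZ gtr0_norm ?invr_gt0// mulrC ltr_pdivrMr.
(* The infimum [p] encodes the separation: a linear [l] below it is bounded by [l1s] (take g = 0)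
   and satisfies l(drift g) >= e * mass g (take v = - drift g). The bound [lb] keeps it finite. *)
pose T (v : W) := [set l1s (v + drift g) - e * mass g |
    g in [set g : F | forall t, 0 <= g t]].
pose p v := inf (T v).
have lbT v : has_lbound (T v).
  exists (- l1s v) => _ [g /= g0 <-]; have := lb _ g0.
  have := ler_l1sD (v + drift g) (- v); rewrite l1sN addrAC subrr add0r; lra.
have T0 v : T v !=set0.
  by exists (l1s (v + drift 0) - e * mass 0), 0 => //= t; rewrite ccfun0.
have pT v g : (forall t, 0 <= g t) -> p v <= l1s (v + drift g) - e * mass g.
  by move=> g0; apply: ge_inf => //; exists g.
have p_sub : sublinear p.
  split=> [v w|k v k0].
    rewrite -lerBlDr; apply: lb_le_inf => // _ [f /= f0 <-].
    rewrite lerBlDr -lerBlDl; apply: lb_le_inf => // _ [g /= g0 <-].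
    rewrite lerBlDl (le_trans (pT _ (f + g) _))//.
      by move=> t; rewrite ccfunD addr_ge0.
    rewrite driftD massD addrACA.
    have := ler_l1sD (v + drift f) (w + drift g); lra.
  rewrite mulrC -ler_pdivrMr//; apply: lb_le_inf => // _ [g /= g0 <-].
  rewrite ler_pdivrMr// (le_trans (pT _ (k *: g) _))//.
    by move=> t; rewrite ccfunZ mulr_ge0// ltW.
  by rewrite driftZ massZ -scalerDr l1sZ gtr0_norm// mulrBl mulrC mulrCA (mulrC k).
have [l [ll lp _]] := hahn_banach_sublinear (0 : W) p_sub.
have lD v w : l (v + w) = l v + l w.
  by have := ll 1 v w; rewrite !scale1r.
have l0 : l 0 = 0 by apply: (addrI (l 0)); rewrite -lD !addr0.
have lN v : l (- v) = - l v by apply: (addrI (l v)); rewrite -lD !subrr l0.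
have drift0 : drift 0 = 0 by rewrite -(scale0r 0) driftZ scale0r.
have mass0 : mass 0 = 0 by rewrite -(scale0r 0) massZ mul0r.
have l_le v : l v <= l1s v.
  have h0 t : 0 <= (0 : F) t by rewrite ccfun0.
  rewrite (le_trans (lp v))// (le_trans (pT v 0 h0))//.
  by rewrite drift0 addr0 mass0 mulr0 subr0.
(* Duality of l^1 and l^infinity: the values of [l] at point masses are functions bounded by 1, to
   which the mean applies. *)
pose h i t := l (unit_at i (fdelta t)).
have h1 i t : `|h i t| <= 1.
  rewrite ler_norml lerNl -lN (le_trans (l_le _)) ?(le_trans (l_le _))//.
    by rewrite l1s_unit_at l1_delta.
  by rewrite l1sN l1s_unit_at l1_delta.
(* The drift of a point mass at [t] has components delta_{s_i t} - delta_t, and its mass is 1. *)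
have key t : e <= \sum_(i < n) (h i (s i * t)%g - h i t).
  have -> : \sum_(i < n) (h i (s i * t)%g - h i t) = l (drift (fdelta t)).
    rewrite [in RHS](sum_unit_at (drift _)) (big_morph l lD l0).
    apply: eq_bigr => i _; rewrite ffunE unit_atD unit_atN lD lN.
    congr (l (unit_at i _) - _); apply: ccfunP => u /=.
    by rewrite -(inj_eq (mulgI (s i)) ((s i)^-1 * u)%g t) mulVKg.
  have d0 u : 0 <= fdelta t u by rewrite /= ler0n.
  rewrite -[leRHS]opprK -lN lerNr (le_trans (lp _))// (le_trans (pT _ _ d0))//.
  by rewrite addNr l1s0 mass_delta mulr1 sub0r.
have m_sum (r : seq 'I_n) : m (fun t => \sum_(i <- r) (h i (s i * t)%g - h i t)) = 0
   /\ exists c, forall t, `|\sum_(i <- r) (h i (s i * t)%g - h i t)| <= c.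
  have bh i : [bounded h i t | t in [set: G]] by exact: (@bounded_setT _ 1).
  have bhs i : [bounded h i (s i * t)%g | t in [set: G]].
    by apply: (@bounded_setT _ 1) => t; exact: h1.
  have m0 : m (fun=> 0) = 0.
    have b0 : [bounded (0 : R) | t in [set: G]].
      by apply: (@bounded_setT _ 0) => t; rewrite normr0.
    have := mL 1 (fun=> 0) (fun=> 0) b0 b0.
    under [in X in X = _]eq_fun do rewrite mulr0 addr0.
    by rewrite mul1r => /eqP; rewrite -subr_eq subrr => /eqP.
  elim: r => [|i r [IH1 [c IH2]]].
    split; last by exists 0 => t; rewrite big_nil normr0.
    by under eq_fun do rewrite big_nil.
  have bd : [bounded (h i (s i * t)%g - h i t) | t in [set: G]].
    apply: (@bounded_setT _ 2) => t.
    by rewrite (le_trans (ler_normB _ _))// -[leRHS](natrD _ 1 1) lerD.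
  split; last first.
    exists (2 + c) => t; rewrite big_cons (le_trans (ler_normD _ _))// lerD//.
    by rewrite (le_trans (ler_normB _ _))// -[leRHS](natrD _ 1 1) lerD.
  have := mL 1 _ _ bd (bounded_setT IH2); rewrite IH1 addr0 mul1r.
  have -> : (fun t => 1 * (h i (s i * t)%g - h i t) +
      \sum_(j <- r) (h j (s j * t)%g - h j t)) =
      (fun t => \sum_(j <- i :: r) (h j (s j * t)%g - h j t)).
    by apply/funext => t; rewrite big_cons mul1r.
  move=> ->; have := mL (-1) _ _ (bh i) (bhs i); rewrite mulN1r.
  have -> : (fun t => -1 * h i t + h i (s i * t)%g) =
      (fun t => h i (s i * t)%g - h i t).
    by apply/funext => t; rewrite mulN1r addrC.
  (* Invariance is stated for the shift by an inverse, so it is applied at the inverse of [s i]. *)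
  move=> ->; have := minv (s i)^-1%g (h i) (bh i).
  by rewrite invgK => ->; rewrite addNr.
have [ms [c bs]] := m_sum (index_enum 'I_n).
have b1 : [bounded (1 : R) | t in [set: G]].
  by apply: (@bounded_setT _ 1) => t; rewrite normr1.
(* A nonnegative function by [key], whose mean is nevertheless - e. *)
pose d t := - e * 1 + \sum_(i < n) (h i (s i * t)%g - h i t).
have dE : m d = - e.
  by rewrite /d (mL (- e) _ _ b1 (bounded_setT bs)) m1 ms addr0 mulr1.
have : 0 <= m d.
  apply: m_ge0; last by move=> t; rewrite /d mulr1 addrC subr_ge0 key.
  apply: (@bounded_setT _ (e + c)) => t; rewrite /d mulr1.
  by rewrite (le_trans (ler_normD _ _))// lerD// normrN gtr0_norm.
by rewrite dE oppr_ge0 leNgt e0.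
Qed.

End Drift.

(** The vector is the pointwise square root of a density with small drift. As (a - b)^2 <= |a^2 -
    b^2| for a, b >= 0, almost invariance passes from l^1 to l^2, and the squared distance between
    the unit vector and its translate is 2 - 2 phi(s). *)
Lemma amenable_coefficient (S : seq G) (e : R) : amenable R G -> 0 < e ->
  exists xi : G -> R, [/\ fin_supp xi, \sum_(t \in [set: G]) xi t ^+ 2 = 1 &
    forall s, s \in S ->
      `|\sum_(t \in [set: G]) xi (s^-1 * t)%g * xi t - 1| <= e].
Proof.
move=> Gam e0.
have [g [g0 g1 gd]] := reiter_drift (fun i => tnth (in_tuple S) i) Gam e0.
have fg := ccfun_fin_supp g.
pose xi t : R := Num.sqrt (g t).
have fxi : fin_supp xi by apply: fin_supp_le fg _ => t; rewrite /xi => ->; rewrite sqrtr0.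
have xi2 t : xi t ^+ 2 = g t by rewrite sqr_sqrtr.
exists xi; split=> //; first by rewrite -g1; apply: eq_fsbigr => t _.
move=> s /(tnthP (in_tuple S))[i sE].
have fs : fin_supp (fun t => xi (s^-1 * t)%g) by exact: fin_supp_translate.
have f1 : fin_supp (fun t => xi (s^-1 * t)%g * xi t).
  by apply: fin_supp_le fxi _ => t ->; rewrite mulr0.
have f2 : fin_supp (fun t => (xi (s^-1 * t)%g - xi t) ^+ 2).
  by apply: fin_supp_le (fin_suppD fs (fin_supp_le fxi (g := fun t => - xi t) _)) _
    => t => [->|/= ->]; rewrite ?oppr0// expr0n.
have d_le : \sum_(t \in [set: G]) (xi (s^-1 * t)%g - xi t) ^+ 2 <= e.
  apply: (@le_trans _ _ (l1 (translate s g - g))).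
    apply: ler_fsum => //; first exact: fin_supp_norm.
    move=> t; rewrite ccfunD ccfunN /= -!xi2.
    have := sqrtr_ge0 (g t); have := sqrtr_ge0 (g (s^-1 * t)%g).
    rewrite -/(xi _) -/(xi _); move: (xi _) (xi t) => a b a0 b0.
    have -> : a ^+ 2 - b ^+ 2 = (a - b) * (a + b) by ring.
    rewrite normrM (ger0_norm (addr_ge0 a0 b0)) -real_normK ?num_real// expr2.
    rewrite ler_wpM2l// (le_trans (ler_normB _ _))//.
    by rewrite !ger0_norm.
  apply: le_trans (ltW gd); rewrite /l1s (bigD1 i)//= ffunE -sE lerDl.
  by apply: sumr_ge0 => j _; exact: l1_ge0.
have sum2 : \sum_(t \in [set: G]) xi (s^-1 * t)%g ^+ 2 = 1.
  rewrite -g1 /mass [RHS](reindex_fsbigT (fun t => (s^-1 * t)%g)) /=.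
    by apply: eq_fsbigr => t _.
  by exists (fun t => (s * t)%g) => t; rewrite ?mulKg ?mulVKg.
have E : \sum_(t \in [set: G]) (xi (s^-1 * t)%g - xi t) ^+ 2 =
    2 - 2 * \sum_(t \in [set: G]) xi (s^-1 * t)%g * xi t.
  transitivity (\sum_(t \in [set: G]) (xi (s^-1 * t)%g ^+ 2 +
      (xi t ^+ 2 + - 2 * (xi (s^-1 * t)%g * xi t)))).
    by apply: eq_fsbigr => t _; ring.
  have fq (f : G -> R) : fin_supp f -> fin_supp (fun t => f t ^+ 2).
    by move=> ff; apply: fin_supp_le ff _ => t ->; rewrite expr0n.
  have f3 : fin_supp (fun t => - 2 * (xi (s^-1 * t)%g * xi t)).
    by apply: fin_supp_le f1 _ => t ->; rewrite mulr0.
  rewrite fsumD; [|exact: (fq _ fs)|by apply: fin_suppD => //; exact: fq].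
  rewrite fsumD//; last exact: fq.
  rewrite sum2 -(mulr_fsumr (- 2)).
  have -> : \sum_(t \in [set: G]) xi t ^+ 2 = 1.
    by rewrite -g1; apply: eq_fsbigr => t _.
  by ring.
have sge0 : 0 <= \sum_(t \in [set: G]) (xi (s^-1 * t)%g - xi t) ^+ 2.
  by apply: fsumr_ge0 => t _; exact: sqr_ge0.
by move: d_le sge0; rewrite E => h1 h2; rewrite ler_norml; apply/andP; split; lra.
Qed.

End Reiter.

(** * Unordered sums *)

Section UnorderedSums.
Context (R : realType) (I : choiceType).
Implicit Types (V W : normedModType R[i]).

#[local] Existing Instance summability.totally_filter.

(** [usum] is a [lim], informative only when the net converges. Estimates are thus made on
    convergent sums and transferred by [usum_eq]. *)
Definition sums_to V (x : I -> V) (l : V) : Prop :=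
  summability.partial_sum x @ summability.totally --> l.

Lemma partial_sumE V (x : I -> V) (X : {fset I}) :
  summability.partial_sum x X = \sum_(i <- X) x i.
Proof. by rewrite /summability.partial_sum big_seq_fsetE. Qed.

Lemma usum_eq V (x : I -> V) l : sums_to x l -> usum x = l.
Proof. by move=> xl; exact: (cvg_lim (@norm_hausdorff _ V) xl). Qed.

Lemma sums_to_unique V (x : I -> V) l l' : sums_to x l -> sums_to x l' -> l = l'.
Proof. by move=> /usum_eq <- /usum_eq <-. Qed.

Definition abs_bounded V (x : I -> V) (M : R) : Prop :=
  forall X : {fset I}, \sum_(i <- X) rnorm (x i) <= M.

Lemma abs_bounded_le V W (x : I -> V) (y : I -> W) (c M : R) : 0 <= c ->
  (forall i, rnorm (y i) <= c * rnorm (x i)) -> abs_bounded x M ->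
  abs_bounded y (c * M).
Proof.
move=> c0 yx xM X; apply: (@le_trans _ _ (\sum_(i <- X) c * rnorm (x i))).
  by apply: ler_sum => i _.
by rewrite -mulr_sumr ler_wpM2l.
Qed.

Lemma abs_bounded_sums_to (V : completeNormedModType R[i]) (x : I -> V) (M : R) :
  abs_bounded x M -> exists l, sums_to x l.
Proof.
move=> xM; apply/cvg_ex; apply: cauchy_cvg; apply/cauchyP => e.
rewrite complex.ltcE => /= /andP[/eqP Ime e0].
pose S := range (fun X : {fset I} => \sum_(i <- X) rnorm (x i)).
have supS : has_sup S.
  split; first by exists (\sum_(i <- fset0) rnorm (x i)), fset0.
  by exists M => _ [X _ <-].
(* Once [X] nearly exhausts the supremum of the finite norm sums, any larger finite set adds less
   than [e]. *)
have [_ [X _ <-] hX] := sup_adherent e0 supS.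
exists (\sum_(i <- X) x i); exists X => // Y /= XY.
rewrite -ball_normE /= norm_rnorm complex.ltcE /= Ime eqxx /= partial_sumE rdistC.
have split_sum (W : zmodType) (f : I -> W) :
    \sum_(i <- Y) f i = \sum_(i <- X) f i + \sum_(i <- (Y `\` X)%fset) f i.
  rewrite (big_fsetID _ (mem X)) /=; congr (_ + _).
    apply: eq_fbigl => i; rewrite !inE /=.
    by case: (boolP (i \in X)) => [/(fsubsetP XY) ->|]; rewrite ?andbF.
  by apply: eq_fbigl => i; rewrite !inE /= andbC.
rewrite split_sum addrC addKr (le_lt_trans (ler_rnorm_sum _ _ _))//.
have : \sum_(i <- Y) rnorm (x i) <= sup S.
  by apply: ub_le_sup; [exact: supS.2|exists Y].
by rewrite split_sum; move: hX; lra.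
Qed.

(** Only additivity is asked of [h], since it is also applied to maps that are conjugate-linear,
    such as an inner product in its first variable. *)
Lemma sums_to_morph V W (x : I -> V) l (h : V -> W) (c : R) : 0 <= c ->
  {morph h : u v / u + v} -> (forall u, rnorm (h u) <= c * rnorm u) ->
  sums_to x l -> sums_to (fun i => h (x i)) (h l).
Proof.
move=> c0 hD hc /cvg_rnormP xl; apply/cvg_rnormP => e e0.
have h0 : h 0 = 0 by apply: (addrI (h 0)); rewrite -hD !addr0.
have hB u v : h (u - v) = h u - h v.
  by apply: (addIr (h v)); rewrite -hD !subrK.
have c1 : 0 < c + 1 by rewrite ltr_wpDl.
have := xl _ (divr_gt0 e0 c1); apply: filterS => X.
rewrite !partial_sumE ltr_pdivlMr// -(big_morph h hD h0) -hB => hX.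
apply: le_lt_trans hX; rewrite (le_trans (hc _))// mulrC ler_wpM2l ?rnorm_ge0//.
by rewrite lerDl.
Qed.

Lemma sums_to_fin_supp V (x : I -> V) : fin_supp x ->
  sums_to x (\sum_(i \in [set: I]) x i).
Proof.
move=> /fin_supp_fset[X xX]; apply/cvg_rnormP => e e0; exists X => // Y /= XY.
rewrite partial_sumE (fsbigTE Y) ?subrr ?rnorm0// => i iY.
by apply: xX; apply: contra iY => /(fsubsetP XY).
Qed.

Lemma sums_toD V (u v : I -> V) k l :
  sums_to u k -> sums_to v l -> sums_to (fun s => u s + v s) (k + l).
Proof.
move=> uk vl; rewrite /sums_to.
have -> : summability.partial_sum (fun s => u s + v s) =
    (fun X => summability.partial_sum u X + summability.partial_sum v X).
  by apply/funext => X; rewrite !partial_sumE big_split.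
exact: cvgD.
Qed.

Lemma sums_toN V (u : I -> V) k :
  sums_to u k -> sums_to (fun s => - u s) (- k).
Proof.
apply: (sums_to_morph (c := 1)) => // [v w|v]; first by rewrite opprD.
by rewrite rnormN mul1r.
Qed.

End UnorderedSums.

(** * Pre-representations on pre-Hilbert spaces *)

Section DynamicalSystem.
Context (R : realType) (G : groupType) (A : cstarAlgType R).
Context (gamma : dynsys G A).
Implicit Types (s t : G) (a b c : A).

Lemma gamD s a b : gamma s (a + b) = gamma s a + gamma s b.
Proof. by have := gam_linear gamma s 1 a b; rewrite !scale1r. Qed.

Lemma gam0 s : gamma s 0 = 0.
Proof. by apply: (addrI (gamma s 0)); rewrite -gamD !addr0. Qed.

Lemma gamZ s (k : R[i]) a : gamma s (k *: a) = k *: gamma s a.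
Proof. by have := gam_linear gamma s k a 0; rewrite gam0 !addr0. Qed.

Lemma gamB s a b : gamma s (a - b) = gamma s a - gamma s b.
Proof. by rewrite gamD -scaleN1r gamZ scaleN1r. Qed.

Lemma gamK s a : gamma s (gamma s^-1%g a) = a.
Proof. by rewrite -gam_comp divgg gam1. Qed.

Lemma gamVK s a : gamma s^-1%g (gamma s a) = a.
Proof. by rewrite -gam_comp mulVg gam1. Qed.

Lemma gam_cone s : gamma s cone = cone.
Proof. by rewrite -[LHS]cmula1 -{2}(gamK s cone) -gamM cmul1a gamK. Qed.

Lemma cpos_defect a : exists2 c, self_adjoint c &
  ((rnorm a ^+ 2)%:C *: cone - star a ** a) = c ** c.
Proof.
have [c cE ac] : cpos ((rnorm a ^+ 2)%:C *: cone - star a ** a).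
  apply: (@cpos_ball _ _ (rnorm a ^+ 2)); last by rewrite subKr rnorm_star_mul.
  by rewrite /self_adjoint starB starZr star1 self_adjoint_star_mul.
by exists c.
Qed.

(** The source of the operator bounds below: applied in a representation, it makes |a|^2 <x, x> - <a
    x, a x> equal to <c x, c x>. *)
Lemma gam_defect s a : exists2 c, self_adjoint c &
  (rnorm a ^+ 2)%:C *: cone - gamma s (star a ** a) = star c ** c.
Proof.
have [c cE ac] := cpos_defect a; exists (gamma s c).
  by rewrite /self_adjoint -gam_star cE.
by rewrite -gam_star cE -gamM -ac gamB gamZ gam_cone.
Qed.

(** No norm condition is part of [dynsys]: contractivity follows from 0 <= gamma(a^* a) <= |a|^2 in
    the order of [A]. *)
Lemma rnorm_gam s a : rnorm (gamma s a) <= rnorm a.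
Proof.
have [c cE ac] := gam_defect s a.
rewrite -(@ler_pXn2r _ 2)// ?nnegrE ?rnorm_ge0// -rnorm_star_mul -gam_star -gamM.
set x := gamma s _ in ac *.
have xp : cpos x by rewrite /x gamM gam_star; exact: cpos_star_mul.
apply: cpos_between => //; first by rewrite exprn_ge0 ?rnorm_ge0.
- exact: cpos_self_adjoint.
- by rewrite ac; exact: cpos_star_mul.
- by apply: cposD => //; apply: cpos_cone; rewrite exprn_ge0 ?rnorm_ge0.
Qed.

End DynamicalSystem.

Section PreRepresentation.
Context (R : realType) (G : groupType) (A : cstarAlgType R).
Context (gamma : dynsys G A) (V : lmodType R[i]) (S : preinner V).
Implicit Types (s t : G) (a b c : A) (x y : V).

(** A representation of the bundle on a semidefinite space, by purely algebraic laws; the norm bound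
    is [pnorm_prep]. *)
Record prerep := PreRep {
  prep :> G -> A -> V -> V;
  prep_linear : forall s b (k : R[i]) x y,
    prep s b (k *: x + y) = k *: prep s b x + prep s b y;
  prep_linearl : forall s (k : R[i]) b c x,
    prep s (k *: b + c) x = k *: prep s b x + prep s c x;
  prepM : forall s t b c x,
    prep s b (prep t c x) = prep (s * t)%g (b ** gamma s c) x;
  prep1 : forall x, prep 1%g cone x = x;
  prep_adj : forall s b x y,
    S (prep s b x) y = S x (prep s^-1%g (gamma s^-1%g (star b)) y)
}.

Variable sig : prerep.

Lemma prepDl s b c x : sig s (b + c) x = sig s b x + sig s c x.
Proof. by have := prep_linearl sig s 1 b c x; rewrite !scale1r. Qed.

Lemma prep0l s x : sig s 0 x = 0.
Proof. by apply: (addrI (sig s 0 x)); rewrite -prepDl !addr0. Qed.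

Lemma prepZl s (k : R[i]) b x : sig s (k *: b) x = k *: sig s b x.
Proof. by have := prep_linearl sig s k b 0 x; rewrite prep0l !addr0. Qed.

Lemma prepNl s b x : sig s (- b) x = - sig s b x.
Proof. by rewrite -[- b]scaleN1r prepZl scaleN1r. Qed.

Lemma prep_adjV s b x y :
  S (sig s^-1%g (gamma s^-1%g (star b)) x) y = S x (sig s b y).
Proof.
by rewrite prep_adj invgK gam_star gamK starK.
Qed.

(** With [c] from [gam_defect], nonnegativity of the form at [sig 1%g c x] expands to |b|^2 |x|^2 -
    |b x|^2 >= 0. *)
Lemma pnorm_prep s b x : pnorm S (sig s b x) <= rnorm b * pnorm S x.
Proof.
rewrite -(@ler_pXn2r _ 2)// ?nnegrE ?mulr_ge0 ?rnorm_ge0 ?pnorm_ge0// exprMn.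
have [c cE bc] := gam_defect gamma s^-1%g b.
have h := pdot_ge0 S (sig 1%g c x).
rewrite prep_adj prepM invg1 mulg1 !gam1 -bc prepDl prepNl prepZl prep1 in h.
rewrite pdotDr pdotZr pdotNr in h.
have E : S (sig s b x) (sig s b x) = S x (sig 1%g (gamma s^-1%g (star b ** b)) x).
  by rewrite prep_adj prepM mulVg gamM.
move: h; rewrite -E !pdot_sqr_pnorm -(rmorphM (real_complex R)).
by rewrite -(rmorphB (real_complex R)) complex.ler0c subr_ge0.
Qed.

Let H := completion S.

(** Elements of the completion being functionals, [b] acts by transposition, (b F)(y) = F(b^* y),
    with no extension by continuity. *)
Definition lift_fun s b (F : H) : V -> R[i]^o :=
  fun y => F (sig s^-1%g (gamma s^-1%g (star b)) y).

Lemma lift_fun_completion s b F : lift_fun s b F \in completion_pred S.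
Proof.
apply/asboolP => e e0; have b1 : 0 < rnorm b + 1 by rewrite ltr_wpDl ?rnorm_ge0.
have [x hx] := functional_approx F (divr_gt0 e0 b1).
exists (sig s b x) => y; rewrite -prep_adjV (le_trans (hx _))//.
have := pnorm_prep s^-1%g (gamma s^-1%g (star b)) y.
move=> /(ler_wpM2l (ltW (divr_gt0 e0 b1)))/le_trans; apply.
rewrite mulrA ler_wpM2r ?pnorm_ge0// mulrAC ler_pdivrMr// ler_wpM2l ?(ltW e0)//.
by rewrite (le_trans (rnorm_gam _ _ _))// rnorm_star lerDl.
Qed.

Definition lift s b (F : H) : H := Completion (lift_fun_completion s b F).

Lemma liftE s b F y :
  lift s b F y = F (sig s^-1%g (gamma s^-1%g (star b)) y).
Proof. by []. Qed.

Lemma lift_emb s b x : lift s b (emb S x) = emb S (sig s b x).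
Proof. by apply: completionP => y; rewrite liftE !embE prep_adjV. Qed.

Lemma rnorm_lift s b F : rnorm (lift s b F) <= rnorm b * rnorm F.
Proof.
apply: cnorm_le; first by rewrite mulr_ge0 ?rnorm_ge0.
move=> y; rewrite liftE (le_trans (functional_bound F _))//.
rewrite (mulrC (rnorm b)) -mulrA ler_wpM2l ?cnorm_ge0//.
rewrite (le_trans (pnorm_prep _ _ _))// ler_wpM2r ?pnorm_ge0//.
by rewrite (le_trans (rnorm_gam _ _ _))// rnorm_star.
Qed.

Lemma lift_linear s b : linear (lift s b).
Proof. by move=> k F K; apply: completionP. Qed.

Lemma lift_op s b : bounded_op (lift s b).
Proof. exact: bounded_op_continuous (lift_linear s b) (rnorm_lift s b). Qed.

Lemma lift_linearl s (k : R[i]) b c F :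
  lift s (k *: b + c) F = k *: lift s b F + lift s c F.
Proof.
apply: completionP => y; rewrite functionalD functionalZ !liftE.
rewrite starD star_conjZ gamD gamZ prepDl prepZl functional_addr functional_conjZ.
by rewrite complex.conjcK.
Qed.

Lemma liftM s t b c F :
  lift (s * t)%g (b ** gamma s c) F = lift s b (lift t c F).
Proof.
apply: completionP => y; rewrite !liftE prepM invgM starM -gam_star.
by rewrite gamM [gamma _ (gamma s _)]gam_comp gamVK gam_comp.
Qed.

Lemma lift_adj s b (F K : H) :
  dot (lift s b F) K = dot F (lift s^-1%g (gamma s^-1%g (star b)) K).
Proof.
have [u uF] := emb_approx F; have [v vK] := emb_approx K.
have cvg_lift s' b' w L : (fun n => emb S (w n)) @ \oo --> L ->
    (fun n => emb S (sig s' b' (w n))) @ \oo --> lift s' b' L.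
  move=> wL; have -> : (fun n => emb S (sig s' b' (w n))) =
      lift s' b' \o (fun n => emb S (w n)).
    by apply/funext => n /=; rewrite lift_emb.
  exact: cvg_comp wL ((lift_op s' b').2 L).
have h1 : (fun n => cdot (emb S (sig s b (u n))) (emb S (v n))) @ \oo -->
    cdot (lift s b F) K.
  by apply: cvg_cdot => //; exact: cvg_lift.
have h2 : (fun n => cdot (emb S (u n))
      (emb S (sig s^-1%g (gamma s^-1%g (star b)) (v n)))) @ \oo -->
    cdot F (lift s^-1%g (gamma s^-1%g (star b)) K).
  by apply: cvg_cdot => //; exact: cvg_lift.
suff E : (fun n => cdot (emb S (sig s b (u n))) (emb S (v n))) =
    (fun n => cdot (emb S (u n))
      (emb S (sig s^-1%g (gamma s^-1%g (star b)) (v n)))).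
  by rewrite E in h1; exact: cvg_unique h1 h2.
by apply/funext => n; rewrite !cdot_emb prep_adj.
Qed.

Lemma lift_cont s (b : A) :
  opnorm (fun F => lift s c F - lift s b F) @[c --> b] --> 0%E.
Proof.
have le_opnorm c : (0 <= opnorm (fun F => (lift s c F - lift s b F)%R) <=
    (rnorm (c - b))%:E)%E.
  apply/andP; split.
    apply: ereal_sup_ubound; exists 0; rewrite /= ?rnorm0//.
    have l0 d : lift s d 0 = 0.
      by have := lift_linear s d (-1) 0 0; rewrite scaler0 addr0 scaleN1r addNr.
    by rewrite !l0 subrr rnorm0.
  apply: ge_ereal_sup => _ [F /= F1 <-]; rewrite lee_fin.
  have -> : lift s c F - lift s b F = lift s (c - b) F.
    by rewrite addrC -[c - b]addrC -scaleN1r -[- b]scaleN1r lift_linearl.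
  by rewrite (le_trans (rnorm_lift _ _ _))// ler_piMr ?rnorm_ge0.
apply: (@squeeze_cvge _ _ _ _ (fun=> 0%E) _ (fun c => (rnorm (c - b))%:E)).
- by apply: nearW => c; exact: le_opnorm.
- exact: cvg_cst.
- apply: cvg_EFin; first exact: nearW.
  apply/cvgrPdist_lt => e e0.
  have := (@cvg_rnormP _ _ _ _ (nbhs_filter b) idfun b).1 cvg_id e e0.
  by apply: filterS => c; rewrite sub0r normrN ger0_norm ?rnorm_ge0.
Qed.

Definition lift_rep : fell_rep gamma H.
Proof.
exact: (@FellRep R G A gamma H (fun s b => lift s b) lift_op
  (fun s k b c F => lift_linearl s k b c F) lift_cont
  (fun s t b c F => liftM s t b c F) lift_adj).
Defined.

Lemma in_ell1_abs_bounded (f : bsection gamma) : in_ell1 f ->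
  exists M : R, abs_bounded (f : G -> A) M.
Proof.
rewrite /in_ell1; set T := esum _ _ => Tfin.
have T0 : (0 <= T)%E by apply: esum_ge0 => s _; rewrite lee_fin rnorm_ge0.
exists (fine T) => X; rewrite -lee_fin fineK ?ge0_fin_numE// -sumEFin.
apply: esum_ge; exists [set` X].
  by split=> //; exact: finite_fset.
by rewrite -fsbig_seq ?fset_uniq.
Qed.

(** The lift to the completion is one of the representations in the supremum [star_norm], so [f]
    acts there as a contraction and Cauchy-Schwarz concludes. *)
Lemma star_norm_coefficient (f : bsection gamma) x y l :
  in_ell1 f -> (star_norm f <= 1)%E ->
  sums_to (fun s => S (sig s (f s) x) y : R[i]^o) l ->
  cmod l <= pnorm S x * pnorm S y.
Proof.
move=> /in_ell1_abs_bounded[M fM] f1 fl.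
have ab F : abs_bounded (fun s => lift s (f s) F) (rnorm F * M).
  apply: abs_bounded_le fM; first exact: rnorm_ge0.
  by move=> s; rewrite mulrC; exact: rnorm_lift.
have sumF F : exists K, sums_to (fun s => lift s (f s) F) K.
  exact: abs_bounded_sums_to (ab F).
have [K xK] := sumF (emb S x).
have normK : rnorm K <= pnorm S x.
  apply/ler_addgt0Pr => e e0.
  (* [opnorm] tests vectors of the unit ball only; the summand [e] allows the normalisation when [x]
     has norm 0. *)
  pose t := (pnorm S x + e)^-1.
  have t1 : 0 < pnorm S x + e by rewrite ltr_wpDl ?pnorm_ge0.
  have t0 : 0 < t by rewrite invr_gt0.
  have txK : sums_to (fun s => lift s (f s) (t%:C *: emb S x)) (t%:C *: K).
    have := sums_to_morph (h := fun u => t%:C *: u) (c := t) (ltW t0) _ _ xK.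
    rewrite (_ : (fun s => t%:C *: lift s (f s) (emb S x)) =
      (fun s => lift s (f s) (t%:C *: emb S x))); last first.
      apply/funext => s; have := lift_linear s (f s) t%:C (emb S x) 0.
      have -> : lift s (f s) 0 = 0.
        by have := lift_linear s (f s) (-1) 0 0; rewrite scaler0 addr0 scaleN1r addNr.
      by rewrite !addr0.
    by apply=> [u v|u]; rewrite ?scalerDr// rnormZr gtr0_norm.
  have : ((rnorm (t%:C *: K))%:E <= 1)%E.
    apply: le_trans f1; apply: (@le_trans _ _ (opnorm (rep_sum lift_rep f))).
      apply: ereal_sup_ubound; exists (t%:C *: emb S x).
        rewrite /= rnormZr gtr0_norm// rnorm_cnorm cnorm_emb /t mulrC.
        by rewrite ler_pdivrMr// mul1r lerDl ltW.
      by rewrite /rep_sum (usum_eq txK).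
    by apply: ereal_sup_ubound; exists H, lift_rep.
  rewrite lee_fin rnormZr gtr0_norm// /t mulrC ler_pdivrMr// mul1r//.
have -> : l = dot K (emb S y).
  apply: (sums_to_unique fl).
  have := sums_to_morph (W := R[i]^o) (h := fun F : H => dot F (emb S y))
    (c := rnorm (emb S y)) (rnorm_ge0 _) _ _ xK.
  rewrite (_ : (fun s => dot (lift s (f s) (emb S x)) (emb S y) : R[i]^o) =
    (fun s => S (sig s (f s) x) y)); last first.
    by apply/funext => s; rewrite lift_emb dot_emb.
  apply=> [F L|F]; first exact: (pdotDl (hilbert_preinner _)).
  by rewrite mulrC; exact: dot_cauchy_schwarz.
rewrite (le_trans (dot_cauchy_schwarz _ _))// [rnorm (emb _ _)]cnorm_emb.
by rewrite ler_wpM2r ?pnorm_ge0.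
Qed.

End PreRepresentation.

(** * Amplification of a pre-representation by translations of the group *)

Section Amplification.
Context (R : realType) (G : groupType) (A : cstarAlgType R).
Context (gamma : dynsys G A) (V : lmodType R[i]) (S : preinner V).
Local Notation W := (ccfun G V).
Implicit Types (F K L : W) (s t : G) (b c : A).

Definition fs_dot F K : R[i] := \sum_(t \in [set: G]) S (F t) (K t).

Lemma fs_dot_fin F K : fin_supp (fun t => S (F t) (K t)).
Proof. by apply: fin_supp_le (ccfun_fin_supp K) _ => t ->; rewrite pdot0r. Qed.

Lemma fs_dotDr F K L : fs_dot F (K + L) = fs_dot F K + fs_dot F L.
Proof.
rewrite /fs_dot -fsumD; [|exact: fs_dot_fin|exact: fs_dot_fin].
by apply: eq_fsbigr => t _; rewrite ccfunD pdotDr.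
Qed.

Lemma fs_dotZr (k : R[i]) F K : fs_dot F (k *: K) = k * fs_dot F K.
Proof.
by rewrite /fs_dot mulr_fsumr; apply: eq_fsbigr => t _; rewrite ccfunZ pdotZr.
Qed.

Lemma fs_dot_conj F K : fs_dot K F = conjc (fs_dot F K).
Proof.
rewrite /fs_dot (@fsum_morph _ _ _ conjc _ (fs_dot_fin F K)) ?complex.conjc0//.
- by apply: eq_fsbigr => t _; rewrite (pdot_conj S).
- by move=> x y; rewrite rmorphD.
Qed.

Lemma fs_dot_ge0 F : 0 <= fs_dot F F.
Proof. by apply: fsumr_ge0 => t _; exact: pdot_ge0. Qed.

Definition fs_preinner : preinner W :=
  PreInner fs_dotDr fs_dotZr fs_dot_conj fs_dot_ge0.

Variable sig : prerep gamma S.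

Lemma prep0r s b : sig s b 0 = 0.
Proof. by have := prep_linear sig s b (-1) 0 0; rewrite scaler0 addr0 scaleN1r addNr. Qed.

Lemma amplify_fin s b F : fin_supp (fun t => sig s b (F (s^-1 * t)%g)).
Proof.
apply: fin_supp_le (fin_supp_translate s (ccfun_fin_supp F)) _ => t ->.
exact: prep0r.
Qed.

(** The tensor product of left translation by [s] with [sig s b]. *)
Definition amplify s b F : W := mk_ccfun (amplify_fin s b F).

Lemma amplifyE s b F t : amplify s b F t = sig s b (F (s^-1 * t)%g).
Proof. by []. Qed.

Lemma amplify_linear s b (k : R[i]) F K :
  amplify s b (k *: F + K) = k *: amplify s b F + amplify s b K.
Proof.
apply: ccfunP => t.
by rewrite !(ccfunD, ccfunZ, amplifyE) prep_linear.
Qed.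

Lemma amplify_linearl s (k : R[i]) b c F :
  amplify s (k *: b + c) F = k *: amplify s b F + amplify s c F.
Proof. by apply: ccfunP => t; rewrite !(ccfunD, ccfunZ, amplifyE) prep_linearl. Qed.

Lemma amplifyM s t b c F :
  amplify s b (amplify t c F) = amplify (s * t)%g (b ** gamma s c) F.
Proof. by apply: ccfunP => u; rewrite !amplifyE prepM invgM mulgA. Qed.

Lemma amplify1 F : amplify 1%g cone F = F.
Proof. by apply: ccfunP => u; rewrite amplifyE invg1 mul1g prep1. Qed.

Lemma amplify_adj s b F K :
  fs_preinner (amplify s b F) K =
  fs_preinner F (amplify s^-1%g (gamma s^-1%g (star b)) K).
Proof.
rewrite /= /fs_dot (reindex_fsbigT (fun t => (s * t)%g)) /=.
  by apply: eq_fsbigr => t _; rewrite mulKg invgK prep_adj.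
by exists (fun t => (s^-1 * t)%g) => t; rewrite ?mulKg ?mulVKg.
Qed.

Definition amplification : prerep gamma fs_preinner :=
  PreRep amplify_linear amplify_linearl amplifyM amplify1 amplify_adj.

Section Twist.
Variable xi : G -> R.
Hypothesis xi_fin : fin_supp xi.
Hypothesis xi_unit : \sum_(t \in [set: G]) xi t ^+ 2 = 1.

Definition autocorrelation s : R := \sum_(t \in [set: G]) xi (s^-1 * t)%g * xi t.

Lemma tensor_fin (x : V) : fin_supp (fun t => (xi t)%:C *: x).
Proof. by apply: fin_supp_le xi_fin _ => t ->; rewrite scale0r. Qed.

Definition tensor (x : V) : W := mk_ccfun (tensor_fin x).

Lemma tensorE x t : tensor x t = (xi t)%:C *: x. Proof. by []. Qed.

Lemma prepZr s b (k : R[i]) x : sig s b (k *: x) = k *: sig s b x.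
Proof. by have := prep_linear sig s b k x 0; rewrite prep0r !addr0. Qed.

Lemma fsum_real (h : G -> R) : fin_supp h ->
  (\sum_(t \in [set: G]) h t)%:C = \sum_(t \in [set: G]) (h t)%:C.
Proof.
by move=> hf; apply: (fsum_morph hf) => // x y; rewrite (rmorphD (real_complex R)).
Qed.

(** The sum over the group splits off as the coefficient of translation at [xi]; no conjugate
    appears because [xi] is real. At s = 1 it shows that [tensor] is isometric. *)
Lemma dot_tensor s b x y :
  fs_preinner (amplification s b (tensor x)) (tensor y) =
  (autocorrelation s)%:C * S (sig s b x) y.
Proof.
rewrite fsum_real; last by apply: fin_supp_le xi_fin _ => t ->; rewrite mulr0.
rewrite /= /fs_dot mulr_fsuml; apply: eq_fsbigr => t _.
rewrite amplifyE !tensorE prepZr pdotZl pdotZr mulrA.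
by rewrite complex.conjc_real -(rmorphM (real_complex R)).
Qed.

Lemma pnorm_tensor x : pnorm fs_preinner (tensor x) = pnorm S x.
Proof.
rewrite /pnorm; congr (Num.sqrt (complex.Re _)).
have := dot_tensor 1 cone x x; rewrite /= amplify1 prep1 => ->.
have -> : autocorrelation 1 = 1.
  by rewrite -[RHS]xi_unit; apply: eq_fsbigr => t _; rewrite invg1 mul1g.
by rewrite mul1r.
Qed.

(* Fell's absorption principle: multiplying the coefficients of [sig] by a
   finitely supported positive definite function gives coefficients of the
   amplification of [sig] to G. *)
Lemma star_norm_twisted_coefficient (f : bsection gamma) x y l :
  in_ell1 f -> (star_norm f <= 1)%E ->
  sums_to (fun s => (autocorrelation s)%:C * S (sig s (f s) x) y : R[i]^o) l ->
  cmod l <= pnorm S x * pnorm S y.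
Proof.
move=> f_ell1 f1 fl; rewrite -!pnorm_tensor.
apply: (star_norm_coefficient (sig := amplification) f_ell1 f1).
by under eq_fun do rewrite dot_tensor.
Qed.

End Twist.
End Amplification.

(** * The regular representation *)

Section BoundedExtension.
Context (R : realType) (V W : normedModType R[i]).

(** Additive rather than linear maps, so that it covers an inner product in its first variable. The
    predicate [P] is needed since [iota] is only meaningful on c_c. *)
Lemma additive_bounded_eq (T : Type) (P : T -> Prop) (i : T -> V) (f g : V -> W)
  (c d : R) :
  (forall (x : V) (e : R), 0 < e -> exists2 y, P y & rnorm (i y - x) < e) ->
  {morph f : x y / x + y} -> {morph g : x y / x + y} ->
  (forall x, rnorm (f x) <= c * rnorm x) -> (forall x, rnorm (g x) <= d * rnorm x) ->
  (forall y, P y -> f (i y) = g (i y)) -> f = g.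
Proof.
move=> dense fD gD fc gd fg; apply/funext => x; apply: rnorm_eq => e e0.
have B (h : V -> W) : {morph h : x y / x + y} -> forall u v, h (u - v) = h u - h v.
  by move=> hD u v; apply: (addIr (h v)); rewrite -hD !subrK.
have k0 : 0 < `|c| + `|d| + 1 by rewrite ltr_wpDl// addr_ge0.
have [y Py yx] := dense x _ (divr_gt0 e0 k0).
rewrite (le_trans (ler_rdistD (f (i y)) _ _))// {2}(fg y Py) -(B _ fD) -(B _ gD).
have h1 := fc (x - i y); have h2 := gd (i y - x).
rewrite (le_trans (lerD h1 h2))// rdistC.
move: yx; rewrite ltr_pdivlMr//; have := rnorm_ge0 (i y - x).
have := ler_norm c; have := ler_norm d.
have := normr_ge0 c; have := normr_ge0 d.
set n := rnorm _; move: `|c| `|d| => a b; nra.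
Qed.

End BoundedExtension.

Lemma bounded_extension (R : realType) (V : normedModType R[i])
  (W : completeNormedModType R[i]) (T : Type) (P : T -> Prop)
  (i : T -> V) (j : T -> W) (c : R) : 0 <= c ->
  (forall (k : R[i]) y z, P y -> P z ->
     exists u, [/\ P u, i u = k *: i y + i z & j u = k *: j y + j z]) ->
  (forall y, P y -> rnorm (j y) <= c * rnorm (i y)) ->
  (forall (x : V) (e : R), 0 < e -> exists2 y, P y & rnorm (i y - x) < e) ->
  exists L : V -> W, [/\ linear L, forall x, rnorm (L x) <= c * rnorm x &
    forall y, P y -> L (i y) = j y].
Proof.
move=> c0 lin jc dense.
have jB y z : P y -> P z -> rnorm (j y - j z) <= c * rnorm (i y - i z).
  move=> Py Pz; have [u [Pu iu ju]] := lin (-1) z y Pz Py.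
  have -> : j y - j z = j u by rewrite ju scaleN1r addrC.
  have -> : i y - i z = i u by rewrite iu scaleN1r addrC.
  exact: jc.
have c1 : 0 < c + 1 by rewrite ltr_wpDl.
(* This estimate against all [y] at once determines [w] by density, so the value does not depend on
   an approximating sequence. *)
have /choice[L LP] : forall x, exists w, forall y, P y ->
    rnorm (w - j y) <= c * rnorm (x - i y).
  move=> x.
  have /choice[y yP] : forall n, exists y, P y /\ rnorm (i y - x) < n.+1%:R^-1.
    move=> n; have n0 : 0 < n.+1%:R^-1 :> R by rewrite invr_gt0.
    by have [y Py yx] := dense x _ n0; exists y.
  have small (e : R) : 0 < e -> exists N, forall n, (N <= n)%N ->
      rnorm (i (y n) - x) < e.
    move=> e0; exists (Num.bound e^-1) => n Nn.
    apply: lt_trans (yP n).2 _; rewrite -[ltRHS]invrK ltf_pV2 ?posrE ?invr_gt0//.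
    rewrite (lt_le_trans (archi_boundP _)) ?invr_ge0 ?(ltW e0)// ler_nat.
    exact: leq_trans Nn _.
  have [e e0|w yw] := @cauchy_seq_cvg _ W (fun n => j (y n)).
    have [N hN] := small (e / 2 / (c + 1)) (divr_gt0 (divr_gt0 e0 (ltr0Sn _ _)) c1).
    exists N => n m Nn Nm.
    rewrite (le_lt_trans (jB _ _ (yP n).1 (yP m).1))//.
    have h1 := hN _ Nn; have h2 := hN _ Nm; rewrite rdistC in h2.
    have := le_lt_trans (ler_rdistD x _ _) (ltrD h1 h2).
    rewrite -mulrDl -splitr ltr_pdivlMr//.
    have := rnorm_ge0 (i (y n) - i (y m)); set r := rnorm _; nra.
  exists w => z Pz; apply/ler_addgt0Pr => e e0.
  have e2 := divr_gt0 e0 (ltr0Sn R 1).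
  have [N hN] := small (e / 2 / (c + 1)) (divr_gt0 e2 c1).
  have /cvg_rnormP/(_ _ e2)[M _ hM] := yw.
  pose n := maxn N M.
  have h1 := hN n (leq_maxl _ _); have h2 : rnorm (j (y n) - w) < e / 2.
    by apply: hM; rewrite /= leq_maxr.
  rewrite (le_trans (ler_rdistD (j (y n)) _ _))// rdistC.
  have h3 := jB _ _ (yP n).1 Pz.
  have h4 := ler_rdistD x (i (y n)) (i z).
  have h5 := le_trans h3 (ler_wpM2l c0 h4).
  apply: (le_trans (lerD (ltW h2) h5)); move: h1; rewrite ltr_pdivlMr//.
  have := rnorm_ge0 (i (y n) - x); set r := rnorm (i (y n) - x); nra.
have Li y : P y -> L (i y) = j y.
  move=> Py; apply/rnorm_eq => e e0.
  by rewrite (le_trans (LP (i y) y Py))// subrr rnorm0 mulr0 ltW.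
have Lcvg x (y : nat -> T) : (forall n, P (y n)) -> (fun n => i (y n)) @ \oo --> x ->
    (fun n => j (y n)) @ \oo --> L x.
  move=> Py /cvg_rnormP yx; apply/cvg_rnormP => e e0.
  have := yx _ (divr_gt0 e0 c1); apply: filterS => n.
  rewrite ltr_pdivlMr// => h; apply: le_lt_trans h.
  rewrite rdistC (le_trans (LP x _ (Py n)))// rdistC mulrC ler_wpM2l ?rnorm_ge0//.
  by rewrite lerDl.
have approx (x : V) : exists y : nat -> T, (forall n, P (y n)) /\ (fun n => i (y n)) @ \oo --> x.
  have /choice[y yP] : forall n, exists y, P y /\ rnorm (i y - x) < n.+1%:R^-1.
    move=> n; have n0 : 0 < n.+1%:R^-1 :> R by rewrite invr_gt0.
    by have [y Py yx] := dense x _ n0; exists y.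
  exists y; split=> [n|]; first exact: (yP n).1.
  apply/cvg_rnormP => e e0; exists (Num.bound e^-1) => // n /= Nn.
  apply: lt_trans (yP n).2 _; rewrite -[ltRHS]invrK ltf_pV2 ?posrE ?invr_gt0//.
  rewrite (lt_le_trans (archi_boundP _)) ?invr_ge0 ?(ltW e0)// ler_nat.
  exact: leq_trans Nn _.
exists L; split=> //.
- move=> k x z; have [y [Py yx]] := approx x; have [y' [Py' y'z]] := approx z.
  have /choice[u uP] : forall n, exists u,
      [/\ P u, i u = k *: i (y n) + i (y' n) & j u = k *: j (y n) + j (y' n)].
    by move=> n; exact: lin.
  have h1 : (fun n => j (u n)) @ \oo --> L (k *: x + z).
    apply: Lcvg => [n|]; first by have [] := uP n.
    have -> : (fun n => i (u n)) = (fun n => k *: i (y n) + i (y' n)).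
      by apply/funext => n; have [] := uP n.
    by apply: cvgD => //; exact: cvgZr.
  have h2 : (fun n => j (u n)) @ \oo --> k *: L x + L z.
    have -> : (fun n => j (u n)) = (fun n => k *: j (y n) + j (y' n)).
      by apply/funext => n; have [] := uP n.
    by apply: cvgD; [apply: cvgZr; exact: Lcvg|exact: Lcvg].
  exact: cvg_unique h1 h2.
- move=> x; apply/ler_addgt0Pr => e e0.
  have c2 : 0 < 2 * c + 1 by rewrite ltr_wpDl// mulr_ge0.
  have [y Py yx] := dense x _ (divr_gt0 e0 c2).
  have h1 := ler_rnormD (L x - j y) (j y); rewrite subrK in h1.
  have h2 := LP x y Py; have h3 := jc y Py.
  have h4 := ler_rnormD (i y - x) x; rewrite subrK in h4.
  rewrite [rnorm (x - _)]rdistC in h2.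
  have h5 := ler_wpM2l c0 h4.
  move: yx; rewrite ltr_pdivlMr//; have := rnorm_ge0 (i y - x).
  move: h1 h2 h3 h5; set r := rnorm (i y - x); nra.
Qed.

Section HilbertModuleFacts.
Context (R : realType) (A : cstarAlgType R) (E : hilbertModType A).
Implicit Types (x y z : E) (a : A).

Lemma innerDl x y z : inner (x + y) z = inner x z + inner y z.
Proof. by rewrite inner_star innerDr starD -!inner_star. Qed.

Lemma rnorm_inner_self x : rnorm (inner x x) = rnorm x ^+ 2.
Proof.
apply: (@complex.complexI R).
by rewrite (rmorphXn (real_complex R)) /= -!norm_rnorm inner_norm.
Qed.

Section Functional.
Variable psi : A -> R[i].
Hypothesis pf : positive_functional psi.

Lemma psi_innerDr x y z : psi (inner x (y + z)) = psi (inner x y) + psi (inner x z).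
Proof. by rewrite innerDr (pfD pf). Qed.

Lemma psi_innerZr (k : R[i]) x y : psi (inner x (k *: y)) = k * psi (inner x y).
Proof. by rewrite innerZr (pfZ pf). Qed.

Lemma psi_inner_conj x y : psi (inner y x) = conjc (psi (inner x y)).
Proof. by rewrite inner_star (pf_star pf). Qed.

Lemma psi_inner_ge0 x : 0 <= psi (inner x x).
Proof. by have [c ->] := inner_pos x; exact: pf_ge0. Qed.

Definition psi_preinner : preinner E :=
  PreInner psi_innerDr psi_innerZr psi_inner_conj psi_inner_ge0.

Lemma pnorm_psi x : pnorm psi_preinner x <= 2 * rnorm x.
Proof.
rewrite -(@ler_pXn2r _ 2)// ?nnegrE ?mulr_ge0 ?rnorm_ge0 ?pnorm_ge0//.
rewrite sqr_pnorm (le_trans (ler_norm _))// (le_trans (ler_Re _))//.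
rewrite (le_trans (pf_bound pf _))// rnorm_inner_self exprMn ler_wpM2r//.
  by rewrite exprn_ge0 ?rnorm_ge0.
by rewrite expr2; lra.
Qed.

End Functional.

(** Cauchy-Schwarz for each form psi <x, y>: a factor 2 recovers the norm from the functionals, and
    [pnorm_psi] costs 2 for each vector. *)
Lemma ler_rnorm_inner x y : rnorm (inner x y) <= 8 * (rnorm x * rnorm y).
Proof.
have -> : 8 * (rnorm x * rnorm y) = 2 * ((2 * rnorm x) * (2 * rnorm y)) by ring.
apply: rnorm_le_positive_functionals => psi pf.
rewrite (le_trans (pdot_cauchy_schwarz (psi_preinner pf) x y))//.
by rewrite ler_pM ?pnorm_ge0// pnorm_psi.
Qed.

End HilbertModuleFacts.

Section RegularRepresentation.
Context (R : realType) (G : groupType) (A : cstarAlgType R).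
Context (gamma : dynsys G A).
Implicit Types (s t : G) (a b c : A) (y z : G -> A).

Definition act s b y : G -> A := fun t => b ** gamma s (y (s^-1 * t)%g).

Lemma convol_dsec s (b : fibre gamma s) (y : bsection gamma) :
  convol (dsec b) y = act s b y.
Proof.
apply: functional_extensionality_dep => t; rewrite /convol.
rewrite (@fsum_single _ _ _ s); first by rewrite /fmul /dsec eqxx.
by move=> r rs; rewrite /fmul /dsec (negPf rs) cmul0a.
Qed.

Lemma cc_innerE (y z : bsection gamma) : cc_inner y z =
  \sum_(s \in [set: G]) (gamma s^-1%g (star (y s)) ** gamma s^-1%g (z s)).
Proof. by []. Qed.

Lemma act_fin s b y : fin_supp y -> fin_supp (act s b y).
Proof.
move=> /(fin_supp_translate s) yf; apply: fin_supp_le yf _ => t.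
by rewrite /act => ->; rewrite gam0 cmula0.
Qed.

Lemma act_linear s b (k : R[i]) y z :
  act s b (fun t => k *: y t + z t) = (fun t => k *: act s b y t + act s b z t).
Proof. by apply/funext => t; rewrite /act gamD gamZ cmulDr cmulZr. Qed.

Lemma act_linearl s (k : R[i]) b c y :
  act s (k *: b + c) y = (fun t => k *: act s b y t + act s c y t).
Proof. by apply/funext => t; rewrite /act cmulDl cmulZl. Qed.

Lemma actM s t b c y : act s b (act t c y) = act (s * t)%g (b ** gamma s c) y.
Proof.
by apply/funext => u; rewrite /act gamM cmulA gam_comp invgM mulgA.
Qed.

Lemma act1 y : act 1%g cone y = y.
Proof. by apply/funext => t; rewrite /act invg1 mul1g gam1 cmul1a. Qed.

Lemma act_adj s b (y z : bsection gamma) :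
  cc_inner (act s b y : bsection gamma) z =
  cc_inner y (act s^-1%g (gamma s^-1%g (star b)) z : bsection gamma).
Proof.
rewrite !cc_innerE (reindex_fsbigT (fun t => (s * t)%g)) /=.
  apply: eq_fsbigr => t _; rewrite /act mulKg invgK starM -gam_star !gamM.
  by rewrite invgM !gam_comp gamVK cmulA.
by exists (fun t => (s^-1 * t)%g) => t; rewrite ?mulKg ?mulVKg.
Qed.

Context (E : hilbertModType A) (iota : bsection gamma -> E).
Hypothesis ell2 : is_ell2 iota.
Implicit Types (xi eta : E).

Lemma iota_approx xi (e : R) : 0 < e ->
  exists2 y, fin_supp y & rnorm (iota y - xi) < e.
Proof.
move=> e0; have : closure [set iota y | y in in_cc (gamma:=gamma)] xi.
  by rewrite (iota_dense ell2).
by move=> /closure_approx/(_ e e0)[_ [y yc <-] h]; exists y.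
Qed.

(** With [c] from [gam_defect], |b|^2 <y, y> = <b y, b y> + <c y, c y> in [A], and the norm is
    monotone on positive elements. Functionals would lose a factor here. *)
Lemma rnorm_iota_act s b y : fin_supp y ->
  rnorm (iota (act s b y)) <= rnorm b * rnorm (iota y).
Proof.
move=> yf; rewrite -(@ler_pXn2r _ 2)// ?nnegrE ?mulr_ge0 ?rnorm_ge0// exprMn.
rewrite -!rnorm_inner_self.
have ayf s' b' := act_fin s' b' yf.
have [c cE bc] := gam_defect gamma s^-1%g b.
pose X := gamma s^-1%g (star b ** b); pose N := rnorm b ^+ 2.
have E1 : inner (iota y) (iota (act 1%g X y)) =
    inner (iota (act s b y)) (iota (act s b y)).
  rewrite (iota_inner ell2 yf (ayf _ _)) (iota_inner ell2 (ayf _ _) (ayf _ _)).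
  by rewrite act_adj actM mulVg -gamM.
have E2 : inner (iota y) (iota (act 1%g (star c ** c) y)) =
    inner (iota (act 1%g c y)) (iota (act 1%g c y)).
  rewrite (iota_inner ell2 yf (ayf _ _)) (iota_inner ell2 (ayf _ _) (ayf _ _)).
  by rewrite act_adj actM invg1 mulg1 !gam1.
have E3 : iota (act 1%g X y) + iota (act 1%g (star c ** c) y) = N%:C *: iota y.
  have h1 := iota_linear ell2 1 (ayf 1%g X) (ayf 1%g (star c ** c)).
  rewrite scale1r in h1; rewrite -h1 -act_linearl scale1r -bc addrC subrK.
  (* Puts the scalar in the form k b + c to which [act_linearl] applies. *)
  have -> : N%:C *: (cone : A) = (N%:C - 1) *: cone + cone.
    by rewrite scalerBl scale1r subrK.
  rewrite act_linearl act1 (iota_linear ell2 _ yf yf).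
  by rewrite scalerBl scale1r subrK.
have pos xi : cpos (inner xi xi) by apply/cstar_posP; exact: inner_pos.
rewrite (le_trans (ler_rnorm_cposD (pos (iota (act s b y))) (pos (iota (act 1%g c y)))))//.
rewrite -E1 -E2 -innerDr E3 innerZr rnormZr ger0_norm// exprn_ge0 ?rnorm_ge0//.
Qed.

Definition lam s b : E -> E := lambda iota (b : fibre gamma s).

Lemma fin_supp_lin (k : R[i]) y z : fin_supp y -> fin_supp z ->
  fin_supp (fun t => k *: y t + z t).
Proof.
move=> yf zf; apply: fin_suppD => //.
by apply: fin_supp_le yf _ => t ->; rewrite scaler0.
Qed.

Lemma lam_exists s b : exists L : E -> E, [/\ linear L,
  forall xi, rnorm (L xi) <= rnorm b * rnorm xi &
  forall y, fin_supp y -> L (iota y) = iota (act s b y)].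
Proof.
apply: bounded_extension; first exact: rnorm_ge0.
- move=> k y z yf zf; exists (fun t => k *: y t + z t); split.
  + exact: fin_supp_lin.
  + exact: (iota_linear ell2).
  + rewrite act_linear; apply: (iota_linear ell2); exact: act_fin.
- by move=> y yf; exact: rnorm_iota_act.
- exact: iota_approx.
Qed.

(** [lambda] is selected by [xget], hence obeys its specification because [lam_exists] supplies an
    operator that meets it. *)
Lemma lamP s b : bounded_op (lam s b) /\
  forall y, fin_supp y -> lam s b (iota y) = iota (act s b y).
Proof.
have [L [Ll Lb Li]] := lam_exists s b.
pose Q := [set L : E -> E | bounded_op L /\ forall y : bsection gamma, in_cc y ->
  L (iota y) = iota (convol (dsec (b : fibre gamma s)) y)].
have [h1 h2] : Q (lam s b).
  apply: xgetPex; exists L; split; first exact: bounded_op_continuous Ll Lb.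
  by move=> y yf; rewrite convol_dsec Li.
by split=> // y yf; rewrite h2// convol_dsec.
Qed.

Lemma lam_iota s b y : fin_supp y -> lam s b (iota y) = iota (act s b y).
Proof. exact: (lamP s b).2. Qed.

Lemma lam_linear s b : linear (lam s b).
Proof. by have [[]] := lamP s b. Qed.

Lemma lamD s b : {morph lam s b : xi eta / xi + eta}.
Proof. by move=> xi eta; have := lam_linear s b 1 xi eta; rewrite !scale1r. Qed.

(** The specification of [lambda] gives some bound; the bound by |b| comes from identifying it, by
    density, with the operator of [lam_exists]. *)
Lemma rnorm_lam s b xi : rnorm (lam s b xi) <= rnorm b * rnorm xi.
Proof.
have [L [Ll Lb Li]] := lam_exists s b.
have [c _ lc] := bounded_op_bound (lamP s b).1.
suff -> : lam s b = L by exact: Lb.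
apply: (additive_bounded_eq iota_approx (lamD s b) _ lc Lb).
  by move=> x y; have := Ll 1 x y; rewrite !scale1r.
by move=> y yf; rewrite lam_iota// Li.
Qed.

Lemma lam_linearl s (k : R[i]) b c xi :
  lam s (k *: b + c) xi = k *: lam s b xi + lam s c xi.
Proof.
have bd x : rnorm (k *: lam s b x + lam s c x) <=
    (cmod k * rnorm b + rnorm c) * rnorm x.
  rewrite (le_trans (ler_rnormD _ _))// rnormZ mulrDl lerD ?rnorm_lam//.
  by rewrite -mulrA ler_wpM2l ?rnorm_ge0 ?rnorm_lam.
suff -> : lam s (k *: b + c) = (fun x => k *: lam s b x + lam s c x) by [].
apply: (additive_bounded_eq iota_approx (lamD _ _) _ (rnorm_lam _ _) bd).
  by move=> x y; rewrite !lamD scalerDr addrACA.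
move=> y yf; rewrite !lam_iota// act_linearl.
by apply: (iota_linear ell2); exact: act_fin.
Qed.

Lemma lamM s t b c xi : lam s b (lam t c xi) = lam (s * t)%g (b ** gamma s c) xi.
Proof.
have bd x : rnorm (lam s b (lam t c x)) <= (rnorm b * rnorm c) * rnorm x.
  rewrite (le_trans (rnorm_lam _ _ _))// -mulrA ler_wpM2l ?rnorm_ge0//.
  exact: rnorm_lam.
suff -> : lam (s * t)%g (b ** gamma s c) = (fun x => lam s b (lam t c x)) by [].
apply: (additive_bounded_eq iota_approx (lamD _ _) _ (rnorm_lam _ _) bd).
  by move=> x y; rewrite !lamD.
move=> y yf; have cyf := act_fin t c yf.
by rewrite !lam_iota// actM.
Qed.

Lemma lam1 xi : lam 1%g cone xi = xi.
Proof.
have bd (x : E) : rnorm (idfun x) <= 1 * rnorm x by rewrite mul1r.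
suff -> : lam 1%g cone = idfun by [].
apply: (additive_bounded_eq iota_approx (lamD _ _) _ (rnorm_lam _ _) bd) => //.
by move=> y yf; rewrite lam_iota// act1.
Qed.

Lemma lam1Z (k : R[i]) xi : lam 1%g (k *: cone) xi = k *: xi.
Proof.
have -> : k *: (cone : A) = (k - 1) *: cone + cone.
  by rewrite scalerBl scale1r subrK.
by rewrite lam_linearl lam1 scalerBl scale1r subrK.
Qed.

(** The identity [act_adj] on finitely supported sections, extended by density in [eta] and then in
    [xi]. *)
Lemma lam_adj s b xi eta :
  inner (lam s b xi) eta = inner xi (lam s^-1%g (gamma s^-1%g (star b)) eta).
Proof.
set T := lam s^-1%g _.
have bdr (x0 x : E) : rnorm (inner x0 x) <= 8 * rnorm x0 * rnorm x.
  by rewrite -mulrA ler_rnorm_inner.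
have bdl (x0 x : E) : rnorm (inner x x0) <= 8 * rnorm x0 * rnorm x.
  by rewrite mulrC mulrCA mulrC -mulrA mulrCA mulrA mulrC (mulrC (rnorm x0))
    ler_rnorm_inner.
have comp_bd (f : E -> A) (L : E -> E) (c d : R) : 0 <= c ->
    (forall x, rnorm (f x) <= c * rnorm x) ->
    (forall x, rnorm (L x) <= d * rnorm x) ->
    forall x, rnorm (f (L x)) <= c * d * rnorm x.
  by move=> c0 fc Ld x; rewrite (le_trans (fc _))// -mulrA ler_wpM2l.
have c8 (x : E) : 0 <= 8 * rnorm x by rewrite mulr_ge0 ?rnorm_ge0.
suff : (fun eta => inner (lam s b xi) eta) = (fun eta => inner xi (T eta)).
  by move=> /(congr1 (@^~ eta)).
apply: (additive_bounded_eq iota_approx _ _ (bdr _)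
  (comp_bd _ _ _ _ (c8 xi) (bdr xi) (rnorm_lam _ _))).
- by move=> x y; rewrite innerDr.
- by move=> x y; rewrite /T lamD innerDr.
move=> z zf.
suff : (fun xi => inner (lam s b xi) (iota z)) = (fun xi => inner xi (T (iota z))).
  by move=> /(congr1 (@^~ xi)).
apply: (additive_bounded_eq iota_approx _ _
  (comp_bd _ _ _ _ (c8 (iota z)) (bdl (iota z)) (rnorm_lam _ _)) (bdl _)).
- by move=> x y; rewrite lamD innerDl.
- by move=> x y; rewrite innerDl.
move=> y yf; rewrite /T !lam_iota//.
have h1 := act_fin s b yf; have h2 := act_fin s^-1%g (gamma s^-1%g (star b)) zf.
by rewrite (iota_inner ell2 h1 zf) (iota_inner ell2 yf h2) act_adj.
Qed.

Section FunctionalPrerep.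
Variable psi : A -> R[i].
Hypothesis pf : positive_functional psi.

Lemma psi_lam_adj s b xi eta : psi_preinner E pf (lam s b xi) eta =
  psi_preinner E pf xi (lam s^-1%g (gamma s^-1%g (star b)) eta).
Proof. by rewrite /= lam_adj. Qed.

Definition lam_prerep : prerep gamma (psi_preinner E pf) :=
  PreRep lam_linear lam_linearl lamM lam1 psi_lam_adj.

End FunctionalPrerep.

End RegularRepresentation.

(** * Coefficients and the approximate identity *)

Section FourierSpace.
Context (R : realType) (G : groupType) (A : cstarAlgType R).
Context (gamma : dynsys G A) (E : hilbertModType A) (iota : bsection gamma -> E).
Hypothesis ell2 : is_ell2 iota.
Implicit Types (s t : G) (xi : G -> R) (x y : E) (f : bsection gamma).

Lemma rnorm_sum_le_functionals (u : G -> A) x y l : sums_to u l ->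
  (forall psi (pf : positive_functional psi) k,
     sums_to (fun s => psi (u s) : R[i]^o) k ->
     cmod k <= pnorm (psi_preinner E pf) x * pnorm (psi_preinner E pf) y) ->
  rnorm l <= 8 * (rnorm x * rnorm y).
Proof.
move=> ul h; have -> : 8 * (rnorm x * rnorm y) = 2 * ((2 * rnorm x) * (2 * rnorm y)).
  by ring.
apply: rnorm_le_positive_functionals => psi pf.
apply: le_trans (ler_pM (pnorm_ge0 _ _) (pnorm_ge0 _ _) (pnorm_psi pf x) (pnorm_psi pf y)).
apply: (h psi pf).
apply: (sums_to_morph (W := R[i]^o) (h := psi) (c := 2)) ul => //.
  exact: (pfD pf).
exact: (pf_bound pf).
Qed.

Lemma rnorm_coef x y s (b : fibre gamma s) :
  rnorm (coef iota x y b) <= 8 * (rnorm x * rnorm y) * rnorm (b : A).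
Proof.
rewrite (le_trans (ler_rnorm_inner _ _))// -mulrA ler_wpM2l//.
rewrite mulrAC ler_wpM2r ?rnorm_ge0// mulrC; exact: (rnorm_lam ell2).
Qed.

Lemma coef_sums f x y : in_ell1 f -> (star_norm f <= 1)%E ->
  exists2 l, sums_to (fun s => coef iota x y (f s)) l &
    rnorm l <= 8 * (rnorm x * rnorm y).
Proof.
move=> f_ell1 f1; have [M fM] := in_ell1_abs_bounded f_ell1.
have c0 : 0 <= 8 * (rnorm x * rnorm y) by rewrite !mulr_ge0 ?rnorm_ge0.
have [l ul] := abs_bounded_sums_to (abs_bounded_le c0 (fun s => rnorm_coef x y (f s)) fM).
exists l => //; apply: (rnorm_sum_le_functionals ul) => psi pf k.
exact: (star_norm_coefficient (sig := lam_prerep ell2 pf)).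
Qed.

(** From |a b| <= (a^2 + b^2) / 2 under the sum, where both squares have sum 1. It makes the twisted
    sums absolutely convergent. *)
Lemma normr_autocorrelation xi s : fin_supp xi ->
  \sum_(t \in [set: G]) xi t ^+ 2 = 1 -> `|autocorrelation xi s| <= 1.
Proof.
move=> xf x1.
have fq (g : G -> R) : fin_supp g -> fin_supp (fun t => 2^-1 * g t ^+ 2).
  by move=> gf; apply: fin_supp_le gf _ => t ->; rewrite expr0n mulr0.
have fs := fin_supp_translate s xf.
have x1' : \sum_(t \in [set: G]) xi (s^-1 * t)%g ^+ 2 = 1.
  rewrite -x1 [RHS](reindex_fsbigT (fun t => (s^-1 * t)%g))//=.
  by exists (fun t => (s * t)%g) => t; rewrite ?mulKg ?mulVKg.
have half : \sum_(t \in [set: G]) (2^-1 * xi (s^-1 * t)%g ^+ 2 + 2^-1 * xi t ^+ 2) = 1.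
  rewrite fsumD; [|exact: (fq _ fs)|exact: fq].
  rewrite -(mulr_fsumr 2^-1 _ (fun t => xi (s^-1 * t)%g ^+ 2)).
  by rewrite -(mulr_fsumr 2^-1 _ (fun t => xi t ^+ 2)) x1 x1'; lra.
have fp : fin_supp (fun t => xi (s^-1 * t)%g * xi t).
  by apply: fin_supp_le xf _ => t ->; rewrite mulr0.
have fh := fin_suppD (fq _ fs) (fq _ xf).
rewrite ler_norml -half; apply/andP; split.
  rewrite (@fsum_morph _ _ _ (fun x : R => - x) _ fh) ?oppr0//.
    apply: ler_fsum => //; first by apply: fin_supp_le fh _ => t ->; rewrite oppr0.
    move=> t /=; move: (xi _) (xi t) => a b; have := sqr_ge0 (a + b).
    by rewrite sqrrD mulr2n; lra.
  by move=> a b; rewrite opprD.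
apply: ler_fsum => // t; move: (xi _) (xi t) => a b; have := sqr_ge0 (a - b).
by rewrite sqrrB mulr2n; lra.
Qed.

Lemma twisted_coef_sums xi f x y : fin_supp xi ->
  \sum_(t \in [set: G]) xi t ^+ 2 = 1 ->
  in_ell1 f -> (star_norm f <= 1)%E ->
  exists2 l, sums_to (fun s => (autocorrelation xi s)%:C *: coef iota x y (f s)) l &
    rnorm l <= 8 * (rnorm x * rnorm y).
Proof.
move=> xf x1 f_ell1 f1; have [M fM] := in_ell1_abs_bounded f_ell1.
have c0 : 0 <= 8 * (rnorm x * rnorm y) by rewrite !mulr_ge0 ?rnorm_ge0.
have bd s : rnorm ((autocorrelation xi s)%:C *: coef iota x y (f s)) <=
    8 * (rnorm x * rnorm y) * rnorm (f s : A).
  rewrite rnormZr (le_trans _ (rnorm_coef x y (f s)))// ler_piMl ?rnorm_ge0//.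
  exact: normr_autocorrelation.
have [l ul] := abs_bounded_sums_to (abs_bounded_le c0 bd fM).
exists l => //; apply: (rnorm_sum_le_functionals ul) => psi pf k uk.
apply: (star_norm_twisted_coefficient (sig := lam_prerep ell2 pf) xf x1 f_ell1 f1).
by move: uk; under eq_fun do rewrite (pfZ pf).
Qed.

Definition point_mass s : bsection gamma := fun t => if t == s then cone else 0.

Lemma point_mass_fin s : fin_supp (point_mass s : G -> A).
Proof.
by apply: (@fin_supp_sub _ _ _ [fset s]%fset) => t; rewrite inE /point_mass => /negPf ->.
Qed.

Lemma rnorm_le1 x : inner x x = cone -> rnorm x <= 1.
Proof.
move=> xx; have := rnorm_inner_self x; have := rnorm_cone A; rewrite xx.
by have := rnorm_ge0 x; move: (rnorm x) (rnorm _) => a b; nra.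
Qed.

Lemma rnorm_point_mass s : rnorm (iota (point_mass s)) <= 1.
Proof.
have pf := point_mass_fin s.
apply: rnorm_le1; rewrite (iota_inner ell2 pf pf) cc_innerE.
rewrite (@fsum_single _ _ _ s) /point_mass ?eqxx ?star1 ?gam_cone ?cmul1a//.
by move=> t /negPf ->; rewrite gam0 cmula0.
Qed.

(* The value f s can be read off a coefficient at two point masses. *)
Lemma rnorm_section_le f s : in_ell1 f -> (star_norm f <= 1)%E ->
  rnorm (f s : A) <= 8.
Proof.
move=> f_ell1 f1.
have [l fl l8] := coef_sums (iota (point_mass 1%g)) (iota (point_mass s)) f_ell1 f1.
have pf := point_mass_fin.
(* [f r] moves the mass at the unit to [r], so pairing with the mass at [s] leaves r = s only. The
   star comes from the first slot of the inner product. *)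
have uE r : coef iota (iota (point_mass 1%g)) (iota (point_mass s)) (f r) =
    if r == s then gamma s^-1%g (star (f s : A)) else 0.
  rewrite /coef -/(lam iota r (f r)) (lam_iota ell2)//.
  rewrite (iota_inner ell2 (act_fin _ _ _ (pf _)) (pf _)) cc_innerE.
  rewrite (@fsum_single _ _ _ s); last first.
    by move=> t /negPf ts; rewrite /point_mass ts gam0 cmula0.
  rewrite /act /point_mass eqxx gam_cone cmula1.
  have -> : ((r^-1 * s)%g == 1%g) = (r == s).
    by rewrite -(inj_eq (mulgI r) (r^-1 * s)%g 1%g) mulVKg mulg1 eq_sym.
  case: eqP => [->|_]; first by rewrite gam_cone cmula1.
  by rewrite gam0 cmula0 star0 gam0.
have le : l = gamma s^-1%g (star (f s : A)).
  apply: (sums_to_unique fl).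
  have : sums_to (fun r => if r == s then gamma s^-1%g (star (f s : A)) else 0)
    (\sum_(r \in [set: G]) if r == s then gamma s^-1%g (star (f s : A)) else 0).
    apply: sums_to_fin_supp; apply: (@fin_supp_sub _ _ _ [fset s]%fset) => r.
    by rewrite inE => /negPf ->.
  rewrite (@fsum_single _ _ _ s) ?eqxx//; last by move=> r /negPf ->.
  have -> // : (fun r => if r == s then gamma s^-1%g (star (f s : A)) else 0) =
      (fun r => coef iota (iota (point_mass 1%g)) (iota (point_mass s)) (f r)).
  by apply/funext => r; rewrite uE.
rewrite -rnorm_star -(gamK gamma s (star _)) (le_trans (rnorm_gam _ _ _))// -le.
rewrite (le_trans l8)// -[leRHS]mulr1 ler_wpM2l//.
by rewrite -[leRHS]mulr1 ler_pM ?rnorm_ge0 ?rnorm_point_mass.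
Qed.

Definition scalar_section xi : bsection gamma := fun t => (xi t)%:C *: cone.

Lemma scalar_section_fin xi : fin_supp xi -> fin_supp (scalar_section xi : G -> A).
Proof. by move=> xf; apply: fin_supp_le xf _ => t xt; rewrite /scalar_section xt scale0r. Qed.

(** The automorphisms fix the unit of [A], so scalar sections behave like functions on the group. *)
Lemma coef_scalar_section xi s : fin_supp xi ->
  inner (lam iota s cone (iota (scalar_section xi))) (iota (scalar_section xi)) =
  (autocorrelation xi s)%:C *: cone.
Proof.
move=> xf; have sf := scalar_section_fin xf.
rewrite (lam_iota ell2)// (iota_inner ell2 (act_fin _ _ _ sf) sf) cc_innerE.
have fp : fin_supp (fun t => xi (s^-1 * t)%g * xi t).
  by apply: fin_supp_le xf _ => t ->; rewrite mulr0.
rewrite [RHS](fsum_morph (h := fun r : R => r%:C *: (cone : A)) fp); last 2 first.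
- by rewrite scale0r.
- by move=> a b; rewrite (rmorphD (real_complex R)) scalerDl.
apply: eq_fsbigr => t _; rewrite /act /scalar_section.
rewrite !gamZ !gam_cone cmul1a starZr star1 gamZ gam_cone.
by rewrite cmulZl cmulZr cmul1a scalerA (rmorphM (real_complex R)).
Qed.

Lemma rnorm_scalar_section xi : fin_supp xi ->
  \sum_(t \in [set: G]) xi t ^+ 2 = 1 -> rnorm (iota (scalar_section xi)) <= 1.
Proof.
move=> xf x1; apply: rnorm_le1.
have := coef_scalar_section 1%g xf; rewrite (lam1 ell2) => ->.
have -> : autocorrelation xi 1 = 1.
  by rewrite -[RHS]x1; apply: eq_fsbigr => t _; rewrite invg1 mul1g.
by rewrite scale1r.
Qed.

Definition unit_coef xi : mapfam gamma :=
  coef iota (iota (scalar_section xi)) (iota (scalar_section xi)).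

Lemma fourier_norm_unit_coef xi : fin_supp xi ->
  \sum_(t \in [set: G]) xi t ^+ 2 = 1 -> (fourier_norm (unit_coef xi) <= 8%:E)%E.
Proof.
move=> xf x1; apply: ge_ereal_sup => _ [f [f_ell1 f1] <-]; rewrite lee_fin.
have [l ul l8] := coef_sums (iota (scalar_section xi)) (iota (scalar_section xi)) f_ell1 f1.
rewrite (usum_eq ul) (le_trans l8)// -[leRHS]mulr1 ler_wpM2l//.
by rewrite -[leRHS]mulr1 ler_pM ?rnorm_ge0 ?rnorm_scalar_section.
Qed.

(** [fourier_mul] picks arbitrary vectors for its factors. The first pair enters only through the
    value of the first factor at (s, 1), which the family determines; as that value is a scalar, it
    comes out of the inner product. *)
Lemma fourier_mul_unit_coef xi (u : mapfam gamma) : fin_supp xi ->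
  fourier_space iota u ->
  fourier_mul iota (unit_coef xi) u = fun s b => (autocorrelation xi s)%:C *: u s b.
Proof.
move=> xf [x [y uE]].
pose Q := [set w : mapfam gamma | exists x1 x2 x3 x4,
    [/\ unit_coef xi = coef iota x1 x2, u = coef iota x3 x4 &
      w = coef_mul iota x1 x2 x3 x4]].
have : Q (fourier_mul iota (unit_coef xi) u).
  apply: xgetPex; eexists; exists (iota (scalar_section xi)).
  by exists (iota (scalar_section xi)), x, y.
move=> [x1 [x2 [x3 [x4 [e12 u34 ->]]]]].
apply: functional_extensionality_dep => s; apply/funext => b.
rewrite /coef_mul /tens_inner u34.
have -> : inner (lambda iota (cone : fibre gamma s) x1) x2 =
    (autocorrelation xi s)%:C *: cone.
  rewrite -(coef_scalar_section s xf).
  have := congr1 (fun w : mapfam gamma => w s (cone : A)) e12.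
  exact: esym.
by rewrite -/(lam iota 1%g _ _) (lam1Z ell2) innerZr.
Qed.

(** The coefficient at [s] needs some [t] in the support of [y2] with s^-1 t in that of [y1], so
    that s = t r^-1. *)
Lemma coef_fin_supp (y1 y2 : G -> A) : fin_supp y1 -> fin_supp y2 ->
  exists T : {fset G}, forall s (b : fibre gamma s), s \notin T ->
    coef iota (iota (y1 : bsection gamma)) (iota (y2 : bsection gamma)) b = 0.
Proof.
move=> y1f y2f; have [X1 h1] := fin_supp_fset y1f; have [X2 h2] := fin_supp_fset y2f.
exists [fset (t * r^-1)%g | t in X2, r in X1]%fset => s b sT.
rewrite /coef -/(lam iota s b) (lam_iota ell2)//.
rewrite (iota_inner ell2 (act_fin _ _ _ y1f) y2f) cc_innerE fsbig1// => t _.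
have [tX2|/h2 ->] := boolP (t \in X2); last by rewrite gam0 cmula0.
have [stX1|/h1 e] := boolP ((s^-1 * t)%g \in X1); last first.
  by rewrite /act e gam0 cmula0 star0 gam0 cmul0a.
exfalso; move/negP: sT; apply; apply/imfset2P; exists t => //.
by exists (s^-1 * t)%g => //; rewrite invgM invgK mulVKg.
Qed.

(** [T] and [d] come before [xi]: closeness of phi to 1 on [T] takes care of finitely supported
    approximants of [x] and [y], and the bound uniform in [xi] takes care of the remainders. *)
Lemma unit_coef_approx x y (e : R) : 0 < e ->
  exists (T : {fset G}) (d : R), 0 < d /\ forall xi, fin_supp xi ->
  \sum_(t \in [set: G]) xi t ^+ 2 = 1 ->
  (forall s, s \in T -> `|autocorrelation xi s - 1| <= d) ->
  (fourier_norm (family_sub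
    (fun s b => (autocorrelation xi s)%:C *: coef iota x y b) (coef iota x y))
    <= e%:E)%E.
Proof.
move=> e0.
(* The remainders contribute 16 r |y| and 16 r (|x| + 1), each a twisted and an untwisted sum with
   constant 8; together they are r K / 2, at most e / 2. *)
pose K := 32 * (rnorm x + rnorm y + 1).
have K0 : 0 < K by rewrite mulr_gt0// ltr_wpDl// addr_ge0 ?rnorm_ge0.
pose r := Num.min 1 (e / K).
have r0 : 0 < r by rewrite lt_min ltr01 divr_gt0.
have r1 : r <= 1 by rewrite /r ge_min lexx.
have rK : r * K <= e by rewrite -ler_pdivlMr// /r ge_min lexx orbT.
have [y1 y1f xy1] := iota_approx ell2 x r0.
have [y2 y2f yy2] := iota_approx ell2 y r0.
set x' := iota y1 in xy1; set y' := iota y2 in yy2.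
have [T hT] := coef_fin_supp y1f y2f.
(* Bounds each value of the coefficient of [x'] and [y'] along [f]: one 8 from [rnorm_coef], the
   other from [rnorm_section_le]. *)
pose C := 8 * (rnorm x' * rnorm y') * 8.
have C0 : 0 <= C by rewrite !mulr_ge0 ?rnorm_ge0.
pose N := \sum_(s <- T) C + 1.
have N0 : 0 < N by rewrite ltr_wpDl// sumr_ge0.
exists T, (e / 2 / N); split; first by rewrite !divr_gt0.
move=> xi xf x1 hd; apply: ge_ereal_sup => _ [f [f_ell1 f1] <-]; rewrite lee_fin.
have [l1 s1 n1] := twisted_coef_sums (x - x') y xf x1 f_ell1 f1.
have [k1 t1 m1] := coef_sums (x - x') y f_ell1 f1.
have [l2 s2 n2] := twisted_coef_sums x' (y - y') xf x1 f_ell1 f1.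
have [k2 t2 m2] := coef_sums x' (y - y') f_ell1 f1.
(* The coefficient of (x, y) is the sum of those of (x - x', y), (x', y - y') and (x', y'); this is
   the third part, which vanishes off [T]. *)
pose w s := (autocorrelation xi s - 1)%:C *: coef iota x' y' (f s).
have wT s : s \notin T -> w s = 0 by move=> sT; rewrite /w (hT s (f s) sT) scaler0.
have s3 := sums_to_fin_supp (fin_supp_sub wT).
have n3 : rnorm (\sum_(s \in [set: G]) w s) <= e / 2.
  rewrite (fsbigTE T w wT) (le_trans (ler_rnorm_sum _ _ _))//.
  apply: (@le_trans _ _ (\sum_(s <- T) e / 2 / N * C)).
    rewrite big_seq [leRHS]big_seq; apply: ler_sum => s sT.
    rewrite rnormZr ler_pM ?rnorm_ge0 ?hd//.
    rewrite (le_trans (rnorm_coef x' y' (f s)))// ler_wpM2l//.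
      by rewrite !mulr_ge0 ?rnorm_ge0.
    exact: rnorm_section_le.
  rewrite -mulr_sumr mulrAC ler_pdivrMr// ler_wpM2l ?divr_ge0 ?(ltW e0)//.
  by rewrite lerDl.
have tot := sums_toD (sums_toD (sums_toD s1 (sums_toN t1)) (sums_toD s2 (sums_toN t2))) s3.
have -> : (fun s => family_sub (fun s b => (autocorrelation xi s)%:C *: coef iota x y b)
    (coef iota x y) (f s)) =
  (fun s => (autocorrelation xi s)%:C *: coef iota (x - x') y (f s) -
     coef iota (x - x') y (f s) +
     ((autocorrelation xi s)%:C *: coef iota x' (y - y') (f s) -
      coef iota x' (y - y') (f s)) + w s).
  apply/funext => s; rewrite /family_sub /w (rmorphB (real_complex R)) /=.
  set p := (autocorrelation xi s)%:C.
  have sc (v : A) : p *: v - v = (p - 1) *: v by rewrite scalerBl scale1r.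
  rewrite !sc -!scalerDr; congr (_ *: _).
  rewrite /coef -!/(lam iota s _ _).
  have -> : lam iota s (f s) (x - x') = lam iota s (f s) x - lam iota s (f s) x'.
    by apply: (addIr (lam iota s (f s) x')); rewrite -(lamD ell2) !subrK.
  have iB (v a b : E) : inner v (a - b) = inner v a - inner v b.
    by apply: (addIr (inner v b)); rewrite -innerDr !subrK.
  have iBl (v a b : E) : inner (a - b) v = inner a v - inner b v.
    by apply: (addIr (inner b v)); rewrite -innerDl !subrK.
  by rewrite iBl iB -addrA subrK subrK.
rewrite (usum_eq tot).
have h1 := rnorm_ge0 x; have h2 := rnorm_ge0 y; have h3 := rnorm_ge0 x'.
have h4 := rnorm_ge0 (x - x'); have h5 := rnorm_ge0 (y - y').
have h6 : rnorm x' <= rnorm x + r.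
  by rewrite -(subrK x x') addrC (le_trans (ler_rnormD _ _))// lerD2l ltW.
rewrite rdistC in xy1; rewrite rdistC in yy2.
have b1 : rnorm (l1 - k1) <= 16 * (r * rnorm y).
  rewrite (le_trans (ler_rnormB _ _))// (le_trans (lerD n1 m1))//.
  by move: xy1; set a := rnorm (x - x'); move: (rnorm y) h2 => b b0 ar; nra.
have b2 : rnorm (l2 - k2) <= 16 * ((rnorm x + 1) * r).
  rewrite (le_trans (ler_rnormB _ _))// (le_trans (lerD n2 m2))//.
  have h7 : rnorm x' * rnorm (y - y') <= (rnorm x + 1) * r.
    by rewrite ler_pM// ?(ltW yy2)// (le_trans h6)// lerD2l.
  by move: h7; lra.
rewrite (le_trans (ler_rnormD _ _))// (splitr e) lerD//.
rewrite (le_trans (ler_rnormD _ _))// (le_trans (lerD b1 b2))//.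
by move: rK; rewrite /K; lra.
Qed.

End FourierSpace.

Theorem theorem4p7 (R : realType) (G : groupType) (A : cstarAlgType R)
    (gamma : dynsys G A) (E : hilbertModType A) (iota : bsection gamma -> E) :
  amenable R G -> is_ell2 iota ->
  has_left_bounded_approximate_identity iota.
Proof.
move=> Gam ell2.
have inv0 n : 0 < n.+1%:R^-1 :> R by rewrite invr_gt0.
have /choice[X XP] : forall i : seq G * nat, exists xi : G -> R, [/\ fin_supp xi,
    \sum_(t \in [set: G]) xi t ^+ 2 = 1 & forall s, s \in i.1 ->
      `|autocorrelation xi s - 1| <= i.2.+1%:R^-1].
  by move=> [S n]; exact: amenable_coefficient.
(* An index consists of finitely many group elements and a precision 1/(n+1); [X] chooses a vector
   for each, and concatenation with the maximum gives directedness. *)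
pose le (i j : seq G * nat) : Prop := {subset i.1 <= j.1} /\ (i.2 <= j.2)%N.
exists (seq G * nat)%type, le, (fun i => unit_coef iota (X i)); split.
- split=> [|i|i j k [ij1 ij2] [jk1 jk2]|i j].
  + exact: (inhabits ([::], 0%N)).
  + by split.
  + by split; [move=> s /ij1/jk1|exact: leq_trans jk2].
  + exists (i.1 ++ j.1, maxn i.2 j.2); split; split=> /=; rewrite ?leq_maxl ?leq_maxr//.
      by move=> s si; rewrite mem_cat si.
    by move=> s sj; rewrite mem_cat sj orbT.
- by move=> i; eexists; eexists.
- by exists 8 => i; have [xf x1 _] := XP i; exact: fourier_norm_unit_coef.
move=> u [x [y uE]] e e0.
have [T [d [d0 hd]]] := unit_coef_approx ell2 x y e0.
(* Chosen so that the precision 1/(n+1) is at most [d]. *)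
pose n := Num.bound d^-1.
exists (T : seq G, n) => i [Ti ni]; have [xf x1 hx] := XP i.
rewrite (fourier_mul_unit_coef ell2)//; last by exists x, y.
rewrite uE; apply: hd => // s sT; rewrite (le_trans (hx s (Ti s sT)))//.
rewrite -[leRHS]invrK lef_pV2 ?posrE ?invr_gt0//.
rewrite ltW// (lt_le_trans (archi_boundP _)) ?invr_ge0 ?(ltW d0)// ler_nat.
exact: leq_trans ni _.
Qed.
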